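(* Let $F(z,w)=(f(z)-\delta w,z)$ be a transcendental Hénon map, and suppose the family $\{f_n\}_{n\in\mathbb N}$, $f_n(z)=f(nz)/n$, is not quasi-normal on $\mathbb C$. Then $h_{\mathrm{top}}(\mathbb C^2,F)=+\infty$.
   Context: A transcendental Hénon map is $F(z,w)=(f(z)-\delta w,z)$ with $f$ transcendental entire and $\delta\ne0$. A family $\mathcal F$ of holomorphic functions on a domain $\Omega$ is quasi-normal if for every sequence in $\mathcal F$ there exist a finite set $Q\subset\Omega$ and a subsequence converging uniformly on compact subsets of $\Omega\setminus Q$ with respect to the spherical metric (limit $\equiv\infty$ allowed). Topological entropy: for a continuous self-map $g$ of a compact metric space $X$, $h_{\mathrm{top}}(X,g)=\sup_{\varepsilon>0}\limsup_n\frac1n\log K(n,\varepsilon)$, where $K(n,\varepsilon)$ is the maximal cardinality of a set $E$ such that any two distinct points $z,w\in E$ satisfy $d(g^k z,g^k w)>\varepsilon$ for some $0\le k\le n-1$; for a non-compact metric space $Y$, $h_{\mathrm{top}}(Y,g)$ is the supremum of $h_{\mathrm{top}}(X,g|_X)$ over compact $X\subset Y$ with $g(X)\subset X$ ($0$ if none). *)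

(* Defs.v *)
From Stdlib Require Import Reals List.
From Coquelicot Require Import Coquelicot.
Open Scope R_scope.

Definition entire (f : C -> C) : Prop := forall z : C, ex_derive f z.

Definition horner (l : list C) (z : C) : C :=
  fold_right (fun a acc => Cplus a (Cmult z acc)) (RtoC 0) l.
Definition is_polynomial_fun (f : C -> C) : Prop :=
  exists l : list C, forall z, f z = horner l z.

Definition transcendental_entire (f : C -> C) : Prop :=
  entire f /\ ~ is_polynomial_fun f.

Definition henon (f : C -> C) (delta : C) (p : C * C) : C * C :=
  (Cminus (f (fst p)) (Cmult delta (snd p)), fst p).

Definition compact_set {T : UniformSpace} (K : T -> Prop) : Prop :=
  forall (I : Type) (U : I -> T -> Prop),
    (forall i, open (U i)) ->
    (forall x, K x -> exists i, U i x) ->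
    exists l : list I, forall x, K x -> exists i, In i l /\ U i x.

(** Riemann sphere Ĉ = C ∪ {∞} (None = ∞) with the chordal (spherical) metric. *)
Definition sphere_dist (a b : option C) : R :=
  match a, b with
  | Some x, Some y =>
      2 * Cmod (Cminus x y) / sqrt ((1 + Cmod x ^ 2) * (1 + Cmod y ^ 2))
  | Some x, None | None, Some x => 2 / sqrt (1 + Cmod x ^ 2)
  | None, None => 0
  end.

Definition quasi_normal (Omega : C -> Prop) (Fam : (C -> C) -> Prop) : Prop :=
  forall s : nat -> (C -> C), (forall k, Fam (s k)) ->
  exists (Q : list C) (phi : nat -> nat) (g : C -> option C),
    (forall q, In q Q -> Omega q) /\
    (forall k, (phi k < phi (S k))%nat) /\
    forall K : C -> Prop, compact_set K ->
      (forall z, K z -> Omega z /\ ~ In z Q) ->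
      forall eps, 0 < eps -> exists N, forall k, (N <= k)%nat ->
        forall z, K z -> sphere_dist (Some (s (phi k) z)) (g z) < eps.

Definition rescaled_family (f : C -> C) (h : C -> C) : Prop :=
  exists n : nat, (1 <= n)%nat /\
    h = (fun z => Cdiv (f (Cmult (RtoC (INR n)) z)) (RtoC (INR n))).

Definition dist2 (p q : C * C) : R :=
  sqrt (Cmod (Cminus (fst p) (fst q)) ^ 2 + Cmod (Cminus (snd p) (snd q)) ^ 2).

Definition separated_set (X : C * C -> Prop) (g : C * C -> C * C)
    (n : nat) (eps : R) (E : list (C * C)) : Prop :=
  NoDup E /\ (forall x, In x E -> X x) /\
  forall x y, In x E -> In y E -> x <> y ->
    exists k, (k < n)%nat /\ dist2 (Nat.iter k g x) (Nat.iter k g y) > eps.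

Definition Ksep (X : C * C -> Prop) (g : C * C -> C * C) (n : nat) (eps : R) : Rbar :=
  Lub_Rbar (fun r => exists E, separated_set X g n eps E /\ r = INR (length E)).

(** (1/n) log K(n,eps), as an extended real (log 0 = -oo). *)
Definition entropy_term (X : C * C -> Prop) (g : C * C -> C * C) (eps : R) (n : nat) : Rbar :=
  match Ksep X g n eps with
  | Finite k => if Rle_dec k 0 then m_infty else Finite (ln k / INR n)
  | p_infty => p_infty
  | m_infty => m_infty
  end.

Definition Rbar_limsup (u : nat -> Rbar) : Rbar :=
  Glb_Rbar (fun y => exists N : nat,
    Rbar_le (Lub_Rbar (fun x => exists n, (N <= n)%nat /\ Rbar_le x (u n))) y).

Definition htop_compact (X : C * C -> Prop) (g : C * C -> C * C) : Rbar :=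
  Lub_Rbar (fun x => exists eps, 0 < eps /\
    Rbar_le x (Rbar_limsup (entropy_term X g eps))).

(** Topological entropy of g on C^2 (non-compact): sup over compact invariant X
    (0 if there is none). *)
Definition htop_C2 (g : C * C -> C * C) : Rbar :=
  Lub_Rbar (fun x => x <= 0 \/ exists X : C * C -> Prop,
    compact_set X /\ (forall p, X p -> X (g p)) /\ Rbar_le x (htop_compact X g)).

(* Main.v *)
(** Suppose [f_n] is steep (large spherical derivative) near many points [z_1, ..., z_N] for one
    common [n]; such points exist for every [N] since otherwise a subsequence would be locally
    equicontinuous for the spherical metric off finitely many points, and Arzelà–Ascoli would give
    quasi-normality. An Ahlfors-type theorem then says that, given 64 values, [f_n] maps some
    small disc near [z_j] univalently over a disc around one of them. Applied to the values
    [z_k + delta z_i], it shows that from every pair [(z_i, z_j)] all but 63 choices of [z_k] are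
    possible next positions, up to a small error, for the recurrence
    [z_(t+1) = f_n z_t - delta z_(t-1)]; a contraction argument turns every itinerary into a true
    orbit. This gives entropy at least [ln (N - 63) / 2] for every [N].

    The Ahlfors-type theorem is proved by maximising [(r^2 - |z|^2)^16 * Lambda] on a disc, where
    [Lambda] is comparable with the 16th power of the spherical derivative: at a maximum point far
    from the 64 values the maximum principle bounds the spherical derivative, and near one of the
    values maximality controls [f'] well enough to produce an island. *)
Require Import Defs.
From Stdlib Require Import Reals List Lra Lia Psatz Classical ClassicalEpsilon Cantor FinFun.
From Coquelicot Require Import Coquelicot.
Open Scope R_scope.

(** * Complex differentiability *)

(** The number 64 is [4 * m] with [m = 16]. Suppose the weight is maximal at a point where [f] is
    within [tau] of the value [a], and let [f] vary by about [2 ^ m * tau]. The denominator then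
    grows at most by [2 ^ m] from [a] and by [4 ^ m] from the other values, and after an [m]-th root
    this costs [|f'|] only a factor 8, whatever [m] is. The room for [f] grows with [m], and at
    [m = 16] it outweighs the constants lost between a bound on [f'] and a nearly affine image
    covering [D(a, tau)].

    The constants of the island statement depend on the values alone, not on the function. Hence the
    points [z_j], and with them the values [z_k + delta z_i], are fixed first, then the shadowing
    radius, and only then a member of the family that is steep enough on that scale near all the
    points.

    The function theory rests on circle means. The maximum principle tolerates a centre where only
    continuity is known, so it applies to difference quotients; this gives Cauchy estimates, and
    from them the differentiability of [f'], without an integral formula or power series. *)

Definition ccont (f : C -> C) (z : C) : Prop :=
  forall eps, 0 < eps -> exists d, 0 < d /\
    forall w, Cmod (w - z) < d -> Cmod (f w - f z) < eps.

(** Carathéodory's form of complex differentiability. *)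
Definition cdiff (f : C -> C) (z d : C) : Prop :=
  exists Q, ccont Q z /\ Q z = d /\ forall w, f w = (f z + (w - z) * Q w)%C.

Lemma Cmod_minus_sym (x y : C) : Cmod (x - y) = Cmod (y - x).
Proof. rewrite <- Cmod_opp. f_equal. ring. Qed.

Lemma Cmod_triangle_minus (x y : C) : Cmod (x - y) <= Cmod x + Cmod y.
Proof.
  replace (x - y)%C with (x + (- y))%C by ring.
  rewrite <- (Cmod_opp y). apply Cmod_triangle.
Qed.

Lemma Cmod_triangle_via (y x z : C) : Cmod (x - z) <= Cmod (x - y) + Cmod (y - z).
Proof. replace (x - z)%C with ((x - y) + (y - z))%C by ring. apply Cmod_triangle. Qed.

Lemma Cmod_le_plus_dist (x y : C) : Cmod x <= Cmod y + Cmod (x - y).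
Proof. replace x with (y + (x - y))%C at 1 by ring. apply Cmod_triangle. Qed.

Lemma Cmod_self_minus (x : C) : Cmod (x - x) = 0.
Proof. replace (x - x)%C with (RtoC 0) by ring. apply Cmod_0. Qed.

Lemma Cminus_neq_0 (x y : C) : x <> y -> (x - y)%C <> RtoC 0.
Proof. intros H E. apply H. replace x with ((x - y) + y)%C by ring. rewrite E. ring. Qed.

Lemma Cmod_minus_pos (x y : C) : x <> y -> 0 < Cmod (x - y).
Proof. intros H. apply Cmod_gt_0, Cminus_neq_0, H. Qed.

Lemma Cmod_minus_0_eq (x y : C) : Cmod (x - y) <= 0 -> x = y.
Proof.
  intros H. apply NNPP. intros N. pose proof (Cmod_minus_pos x y N). lra.
Qed.

Lemma ccont_const (c z : C) : ccont (fun _ => c) z.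
Proof. intros e He. exists 1. split; [lra|]. intros w _. rewrite Cmod_self_minus. lra. Qed.

Lemma ccont_id (z : C) : ccont (fun w => w) z.
Proof. intros e He. exists e. split; [lra|]. auto. Qed.

Lemma ccont_plus (f g : C -> C) (z : C) :
  ccont f z -> ccont g z -> ccont (fun w => f w + g w)%C z.
Proof.
  intros Hf Hg e He.
  destruct (Hf (e/2)) as [d1 [P1 H1]]; [lra|].
  destruct (Hg (e/2)) as [d2 [P2 H2]]; [lra|].
  exists (Rmin d1 d2). split; [apply Rmin_pos; auto|].
  intros w Hw.
  specialize (H1 w (Rlt_le_trans _ _ _ Hw (Rmin_l _ _))).
  specialize (H2 w (Rlt_le_trans _ _ _ Hw (Rmin_r _ _))).
  replace (f w + g w - (f z + g z))%C with ((f w - f z) + (g w - g z))%C by ring.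
  pose proof (Cmod_triangle (f w - f z) (g w - g z)). lra.
Qed.

Lemma ccont_mult (f g : C -> C) (z : C) :
  ccont f z -> ccont g z -> ccont (fun w => f w * g w)%C z.
Proof.
  intros Hf Hg e He.
  set (M := 1 + Cmod (f z) + Cmod (g z)).
  assert (HM : 1 <= M) by (unfold M; pose proof (Cmod_ge_0 (f z)); pose proof (Cmod_ge_0 (g z)); lra).
  assert (HM' : 0 < Rmin 1 (e / (2 * M))).
  { apply Rmin_pos; [lra|]. apply Rdiv_lt_0_compat; lra. }
  destruct (Hf _ HM') as [d1 [P1 H1]].
  destruct (Hg _ HM') as [d2 [P2 H2]].
  exists (Rmin d1 d2). split; [apply Rmin_pos; auto|].
  intros w Hw.
  specialize (H1 w (Rlt_le_trans _ _ _ Hw (Rmin_l _ _))).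
  specialize (H2 w (Rlt_le_trans _ _ _ Hw (Rmin_r _ _))).
  replace (f w * g w - f z * g z)%C with ((f w - f z) * g w + f z * (g w - g z))%C by ring.
  eapply Rle_lt_trans; [apply Cmod_triangle|]. rewrite !Cmod_mult.
  pose proof (Rmin_l 1 (e / (2 * M))). pose proof (Rmin_r 1 (e / (2 * M))).
  set (t := Rmin 1 (e / (2 * M))) in *.
  pose proof (Cmod_le_plus_dist (g w) (g z)).
  assert (t * (2 * M) <= e).
  { apply Rmult_le_reg_r with (/ (2 * M)); [apply Rinv_0_lt_compat; lra|].
    rewrite Rmult_assoc, Rinv_r by lra. rewrite Rmult_1_r. exact H0. }
  pose proof (Cmod_ge_0 (f w - f z)). pose proof (Cmod_ge_0 (g w - g z)).
  pose proof (Cmod_ge_0 (f z)). pose proof (Cmod_ge_0 (g z)). pose proof (Cmod_ge_0 (g w)).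
  assert (Cmod (f w - f z) * Cmod (g w) <= t * M).
  { apply Rmult_le_compat; try lra. unfold M. lra. }
  assert (Cmod (f z) * Cmod (g w - g z) <= (M - 1) * t).
  { apply Rmult_le_compat; try lra. unfold M. lra. }
  nra.
Qed.

Lemma ccont_opp (f : C -> C) (z : C) : ccont f z -> ccont (fun w => - f w)%C z.
Proof.
  intros H e He. destruct (H e He) as [d [P Hd]]. exists d. split; auto.
  intros w Hw. replace (- f w - - f z)%C with (- (f w - f z))%C by ring.
  rewrite Cmod_opp. auto.
Qed.

Lemma ccont_minus (f g : C -> C) (z : C) :
  ccont f z -> ccont g z -> ccont (fun w => f w - g w)%C z.
Proof. intros Hf Hg. apply (ccont_plus f (fun w => - g w)%C); auto using ccont_opp. Qed.

Lemma ccont_comp (f g : C -> C) (z : C) :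
  ccont g z -> ccont f (g z) -> ccont (fun w => f (g w)) z.
Proof.
  intros Hg Hf e He. destruct (Hf e He) as [d [P H]]. destruct (Hg d P) as [d' [P' H']].
  exists d'. split; auto.
Qed.

Lemma ccont_inv (z : C) : z <> RtoC 0 -> ccont Cinv z.
Proof.
  intros Hz e He. assert (Hz' := proj1 (Cmod_gt_0 z) Hz). set (m := Cmod z) in *.
  exists (Rmin (m / 2) (e * m * m / 2)). split.
  { apply Rmin_pos; [lra|]. assert (0 < e * m) by nra. nra. }
  intros w Hw.
  assert (H1 := Rlt_le_trans _ _ _ Hw (Rmin_l _ _)).
  assert (H2 := Rlt_le_trans _ _ _ Hw (Rmin_r _ _)).
  assert (Hm : m / 2 < Cmod w).
  { pose proof (Cmod_le_plus_dist z w). rewrite Cmod_minus_sym in H. unfold m in *. lra. }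
  assert (Hw0 : w <> RtoC 0) by (apply Cmod_gt_0; lra).
  replace (/ w - / z)%C with ((z - w) / (w * z))%C by (field; split; assumption).
  rewrite Cmod_div, Cmod_mult by (apply Cmult_neq_0; assumption). fold m.
  rewrite Cmod_minus_sym.
  assert (0 < Cmod w * m) by nra.
  apply Rmult_lt_reg_r with (Cmod w * m); [nra|].
  unfold Rdiv. rewrite Rmult_assoc, Rinv_l, Rmult_1_r by lra.
  eapply Rlt_trans; [exact H2|].
  assert (m * (m / 2) < Cmod w * m) by nra.
  assert (e * (m * (m / 2)) < e * (Cmod w * m)) by (apply Rmult_lt_compat_l; auto). lra.
Qed.

Lemma ccont_ext_near (f g : C -> C) (z : C) (r : R) :
  0 < r -> (forall w, Cmod (w - z) < r -> f w = g w) -> ccont f z -> ccont g z.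
Proof.
  intros Hr E H e He. destruct (H e He) as [d [P Hd]].
  exists (Rmin d r). split; [apply Rmin_pos; auto|].
  intros w Hw. rewrite <- (E w), <- (E z).
  - apply Hd. apply (Rlt_le_trans _ _ _ Hw (Rmin_l _ _)).
  - rewrite Cmod_self_minus. auto.
  - apply (Rlt_le_trans _ _ _ Hw (Rmin_r _ _)).
Qed.

Lemma cdiff_ccont (f : C -> C) (z d : C) : cdiff f z d -> ccont f z.
Proof.
  intros [Q [HQ [_ H]]].
  apply (ccont_ext_near (fun w => f z + (w - z) * Q w)%C f z 1); [lra|auto|].
  apply ccont_plus; [apply ccont_const|]. apply ccont_mult; auto.
  apply ccont_minus; auto using ccont_id, ccont_const.
Qed.

Lemma cdiff_val (f : C -> C) (z d d' : C) : cdiff f z d -> d = d' -> cdiff f z d'.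
Proof. intros H <-. exact H. Qed.

Lemma cdiff_const (c z : C) : cdiff (fun _ => c) z 0.
Proof. exists (fun _ => RtoC 0). split; [apply ccont_const|split; auto]. intros. ring. Qed.

Lemma cdiff_id (z : C) : cdiff (fun w => w) z 1.
Proof. exists (fun _ => RtoC 1). split; [apply ccont_const|split; auto]. intros. ring. Qed.

Lemma cdiff_plus (f g : C -> C) (z d e : C) :
  cdiff f z d -> cdiff g z e -> cdiff (fun w => f w + g w)%C z (d + e)%C.
Proof.
  intros [P [HP [EP HP']]] [Q [HQ [EQ HQ']]]. exists (fun w => P w + Q w)%C.
  split; [apply ccont_plus; auto|]. split; [congruence|].
  intros w. rewrite (HP' w), (HQ' w). ring.
Qed.

Lemma cdiff_mult (f g : C -> C) (z d e : C) :
  cdiff f z d -> cdiff g z e -> cdiff (fun w => f w * g w)%C z (d * g z + f z * e)%C.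
Proof.
  intros Hf Hg. pose proof (cdiff_ccont _ _ _ Hg) as Cg.
  destruct Hf as [P [HP [EP HP']]]. destruct Hg as [Q [HQ [EQ HQ']]].
  exists (fun w => P w * g w + f z * Q w)%C.
  split; [apply ccont_plus; apply ccont_mult; auto using ccont_const|]. split; [congruence|].
  intros w. rewrite (HP' w). rewrite (HQ' w). ring.
Qed.

Lemma cdiff_opp (f : C -> C) (z d : C) : cdiff f z d -> cdiff (fun w => - f w)%C z (- d)%C.
Proof.
  intros [P [HP [EP HP']]]. exists (fun w => - P w)%C.
  split; [apply ccont_opp; auto|]. split; [congruence|]. intros w. rewrite (HP' w). ring.
Qed.

Lemma cdiff_minus (f g : C -> C) (z d e : C) :
  cdiff f z d -> cdiff g z e -> cdiff (fun w => f w - g w)%C z (d - e)%C.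
Proof. intros Hf Hg. apply (cdiff_plus f (fun w => - g w)%C); auto using cdiff_opp. Qed.

Lemma cdiff_comp (f g : C -> C) (z d e : C) :
  cdiff g z d -> cdiff f (g z) e -> cdiff (fun w => f (g w)) z (e * d)%C.
Proof.
  intros Hg Hf. pose proof (cdiff_ccont _ _ _ Hg) as Cg.
  destruct Hf as [P [HP [EP HP']]]. destruct Hg as [Q [HQ [EQ HQ']]].
  exists (fun w => P (g w) * Q w)%C.
  split; [apply ccont_mult; auto; apply (ccont_comp P g); auto|]. split; [congruence|].
  intros w. rewrite (HP' (g w)), (HQ' w) at 1. rewrite (HQ' w). ring.
Qed.

Lemma cdiff_inv (z : C) : z <> RtoC 0 -> cdiff Cinv z (- / (z * z))%C.
Proof.
  intros Hz.
  (* [/ 0 = 0] makes the difference quotient at [0] a special value. *)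
  exists (fun w => if excluded_middle_informative (w = RtoC 0) then / (z * z) else - / (w * z))%C.
  assert (Hz' := proj1 (Cmod_gt_0 z) Hz).
  split; [|split].
  - apply (ccont_ext_near (fun w => - / (w * z))%C _ z (Cmod z)); auto.
    + intros w Hw. destruct (excluded_middle_informative (w = RtoC 0)) as [E|E]; auto.
      subst w. replace (0 - z)%C with (- z)%C in Hw by ring. rewrite Cmod_opp in Hw. lra.
    + apply ccont_opp. apply (ccont_comp Cinv (fun w => w * z)%C).
      * apply ccont_mult; auto using ccont_id, ccont_const.
      * apply ccont_inv. apply Cmult_neq_0; auto.
  - destruct (excluded_middle_informative (z = RtoC 0)); [contradiction|auto].
  - intros w. destruct (excluded_middle_informative (w = RtoC 0)) as [E|E].
    + subst w. replace (/ 0)%C with (RtoC 0). field; auto.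
      unfold Cinv. simpl. unfold RtoC. f_equal; unfold Rdiv; ring.
    + field; auto.
Qed.

Lemma cdiff_pow (f : C -> C) (z : C) (n : nat) :
  (exists d, cdiff f z d) -> exists d, cdiff (fun w => f w ^ n)%C z d.
Proof.
  intros [d Hd]. induction n as [|n [e IH]].
  - exists (RtoC 0). exact (cdiff_const (RtoC 1) z).
  - eexists. exact (cdiff_mult f (fun w => f w ^ n)%C z d e Hd IH).
Qed.

Lemma cdiff_ext_near (f g : C -> C) (z d : C) (r : R) :
  0 < r -> (forall w, Cmod (w - z) < r -> f w = g w) -> cdiff f z d -> cdiff g z d.
Proof.
  intros Hr E [Q [HQ [EQ H]]].
  (* [Q] has to factor [g w - g z] for every [w], so outside the disc it is replaced by the
     difference quotient of [g]. *)
  exists (fun w => if Rlt_dec (Cmod (w - z)) r then Q w else (g w - g z) / (w - z))%C.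
  assert (Hz : Cmod (z - z) < r) by (rewrite Cmod_self_minus; auto).
  split; [|split].
  - apply (ccont_ext_near Q _ z r); auto. intros w Hw. destruct (Rlt_dec _ _); [auto|lra].
  - destruct (Rlt_dec _ _); [auto|lra].
  - intros w. destruct (Rlt_dec _ _) as [L|L].
    + rewrite <- (E w L), <- (E z Hz). apply H.
    + field. apply Cmod_gt_0. lra.
Qed.

Lemma cdiff_quotient (f : C -> C) (z d : C) :
  cdiff f z d -> forall eps, 0 < eps -> exists r, 0 < r /\
    forall w, Cmod (w - z) < r ->
      Cmod (f w - f z - d * (w - z)) <= eps * Cmod (w - z).
Proof.
  intros [Q [HQ [EQ H]]] e He. destruct (HQ e He) as [r [P Hr]]. exists r. split; auto.
  intros w Hw. rewrite (H w), <- EQ.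
  replace (f z + (w - z) * Q w - f z - Q z * (w - z))%C with ((Q w - Q z) * (w - z))%C by ring.
  rewrite Cmod_mult. apply Rmult_le_compat_r; [apply Cmod_ge_0|]. left. auto.
Qed.

Lemma cdiff_intro (f : C -> C) (z d : C) :
  (forall eps, 0 < eps -> exists r, 0 < r /\ forall w, Cmod (w - z) < r ->
      Cmod (f w - f z - d * (w - z)) <= eps * Cmod (w - z)) -> cdiff f z d.
Proof.
  intros H.
  exists (fun w => if excluded_middle_informative (w = z) then d else (f w - f z) / (w - z))%C.
  assert (E : (if excluded_middle_informative (z = z) then d else (f z - f z) / (z - z))%C = d).
  { destruct (excluded_middle_informative (z = z)); [auto|congruence]. }
  split; [|split].
  - intros e He. destruct (H (e/2)) as [r [P Hr]]; [lra|]. exists r. split; auto.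
    intros w Hw. rewrite E. destruct (excluded_middle_informative (w = z)) as [Ew|Ew].
    + rewrite Cmod_self_minus; auto.
    + specialize (Hr w Hw). pose proof (Cmod_minus_pos _ _ Ew).
      replace ((f w - f z) / (w - z) - d)%C with ((f w - f z - d * (w - z)) / (w - z))%C
        by (field; apply Cminus_neq_0; auto).
      rewrite Cmod_div by (apply Cminus_neq_0; auto).
      apply Rmult_lt_reg_r with (Cmod (w - z)); auto.
      unfold Rdiv. rewrite Rmult_assoc, Rinv_l, Rmult_1_r by lra. nra.
  - exact E.
  - intros w. destruct (excluded_middle_informative (w = z)) as [Ew|Ew].
    + subst. ring.
    + field. apply Cminus_neq_0; auto.
Qed.

Lemma ex_derive_cdiff (f : C -> C) (z : C) : ex_derive f z -> exists d, cdiff f z d.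
Proof.
  intros [d [_ H]]. exists d. apply cdiff_intro. intros e He.
  (* Differentiability along a filter is stated at every limit point of the filter; for [locally z]
     the point taken is [z]. *)
  specialize (H z (fun P HP => HP) (mkposreal e He)).
  destruct H as [r Hr]. exists r. split; [apply cond_pos|].
  intros w Hw. specialize (Hr w Hw).
  simpl in Hr. replace (d * (w - z))%C with ((w - z) * d)%C by ring. exact Hr.
Qed.

(** * Goursat's lemma on rectangles *)

(** The invariant [P] keeps the construction going and [S] records the link between consecutive
    terms; the bisection of rectangles and the nested subsequences both have this shape. *)
Lemma dependent_choice {T : Type} (P : nat -> T -> Prop) (S : nat -> T -> T -> Prop) (x0 : T) :
  P 0%nat x0 -> (forall n x, P n x -> exists y, P (Datatypes.S n) y /\ S n x y) ->
  exists s : nat -> T, s 0%nat = x0 /\ forall n, P n (s n) /\ S n (s n) (s (Datatypes.S n)).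
Proof.
  intros H0 H.
  pose (step := fun n (x : {x | P n x}) =>
    constructive_indefinite_description _ (H n (proj1_sig x) (proj2_sig x))).
  pose (s := fix s n : {x | P n x} := match n with
    | O => exist _ x0 H0
    | Datatypes.S m => exist _ (proj1_sig (step m (s m))) (proj1 (proj2_sig (step m (s m)))) end).
  exists (fun n => proj1_sig (s n)). split; [reflexivity|].
  intros n. split; [apply (proj2_sig (s n))|]. simpl. apply (proj2 (proj2_sig (step n (s n)))).
Qed.

Lemma nested_intervals (a w : nat -> R) :
  (forall n, 0 <= w n) -> (forall n, a n <= a (S n)) ->
  (forall n, a (S n) + w (S n) <= a n + w n) ->
  exists x, forall n, a n <= x <= a n + w n.
Proof.
  intros Hw Ha Hb.
  assert (La : forall n k, a n <= a (n + k)%nat).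
  { intros n k. induction k; [rewrite Nat.add_0_r; lra|]. rewrite Nat.add_succ_r.
    eapply Rle_trans; eauto. }
  assert (Lb : forall n k, a (n + k)%nat + w (n + k)%nat <= a n + w n).
  { intros n k. induction k; [rewrite Nat.add_0_r; lra|]. rewrite Nat.add_succ_r.
    eapply Rle_trans; [apply Hb|auto]. }
  assert (Lab : forall n m, a n <= a m + w m).
  { intros n m. destruct (Compare_dec.le_ge_dec n m) as [L|L].
    - replace m with (n + (m - n))%nat by lia. pose proof (La n (m-n)%nat).
      pose proof (Hw (n + (m - n))%nat). lra.
    - replace n with (m + (n - m))%nat by lia. pose proof (Lb m (n-m)%nat).
      pose proof (Hw (m + (n - m))%nat). lra. }
  destruct (completeness (fun x => exists n, x = a n)) as [x [Hx1 Hx2]].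
  - exists (a 0%nat + w 0%nat). intros y [n ->]. apply Lab.
  - exists (a 0%nat). exists 0%nat. auto.
  - exists x. intros n. split.
    + apply Hx1. eauto.
    + apply Hx2. intros y [m ->]. apply Lab.
Qed.

Lemma RInt_near_const (f : R -> R) (a b k e : R) :
  a <= b -> ex_RInt f a b -> (forall t, a <= t <= b -> Rabs (f t - k) <= e) ->
  Rabs (RInt f a b - k * (b - a)) <= e * (b - a).
Proof.
  intros Hab Hf H.
  assert (H1 : RInt f a b <= RInt (fun _ => k + e) a b).
  { apply RInt_le; auto. apply ex_RInt_const. intros t Ht.
    assert (Ht' : a <= t <= b) by lra. specialize (H t Ht'). apply Rabs_le_between in H. lra. }
  assert (H2 : RInt (fun _ => k - e) a b <= RInt f a b).
  { apply RInt_le; auto. apply ex_RInt_const. intros t Ht.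
    assert (Ht' : a <= t <= b) by lra. specialize (H t Ht'). apply Rabs_le_between in H. lra. }
  rewrite RInt_const in H1, H2. unfold scal in *; simpl in *; unfold mult in *; simpl in *.
  apply Rabs_le_between. lra.
Qed.

Lemma continuous_R_intro (f : R -> R) (x : R) :
  (forall e, 0 < e -> exists d, 0 < d /\ forall t, Rabs (t - x) < d -> Rabs (f t - f x) < e) ->
  continuous f x.
Proof.
  intros H. apply continuity_pt_filterlim. intros e He. destruct (H e He) as [d [P Hd]].
  exists d. split; auto. intros t [_ Ht]. apply Hd. apply Ht.
Qed.

(** [p + i q] is the derivative of [U + i V] with respect to [x + i y]. *)
Definition cr_diff (U V : R -> R -> R) (x y : R) : Prop :=
  exists p q, forall e, 0 < e -> exists d, 0 < d /\ forall x' y',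
    Rabs (x' - x) < d -> Rabs (y' - y) < d ->
    Rabs (U x' y' - U x y - (p * (x' - x) - q * (y' - y))) <= e * (Rabs (x' - x) + Rabs (y' - y)) /\
    Rabs (V x' y' - V x y - (q * (x' - x) + p * (y' - y))) <= e * (Rabs (x' - x) + Rabs (y' - y)).

Lemma affine_bound_small (p q e u v : R) : 0 < e ->
  Rabs u < e / (2 * (1 + Rabs p + Rabs q)) -> Rabs v < e / (2 * (1 + Rabs p + Rabs q)) ->
  Rabs (p * u + q * v) + (Rabs u + Rabs v) < e.
Proof.
  intros He Hu Hv. set (M := 1 + Rabs p + Rabs q) in *.
  assert (HM : 1 <= M) by (unfold M; pose proof (Rabs_pos p); pose proof (Rabs_pos q); lra).
  assert (Rabs (p * u + q * v) <= Rabs p * Rabs u + Rabs q * Rabs v).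
  { rewrite <- !Rabs_mult. apply Rabs_triang. }
  set (t := e / (2 * M)) in *.
  assert (Et : t * (2 * M) = e) by (unfold t; field; lra).
  pose proof (Rabs_pos p). pose proof (Rabs_pos q). pose proof (Rabs_pos u). pose proof (Rabs_pos v).
  assert (Rabs p * Rabs u <= Rabs p * t) by (apply Rmult_le_compat_l; lra).
  assert (Rabs q * Rabs v <= Rabs q * t) by (apply Rmult_le_compat_l; lra).
  unfold M in *. nra.
Qed.

Lemma cr_diff_continuous (U V : R -> R -> R) (x y : R) : cr_diff U V x y ->
  continuous (fun t => U t y) x /\ continuous (fun t => U x t) y /\
  continuous (fun t => V t y) x /\ continuous (fun t => V x t) y.
Proof.
  intros [p [q H]].
  assert (K : forall e, 0 < e -> exists d, 0 < d /\ forall x' y',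
    Rabs (x' - x) < d -> Rabs (y' - y) < d ->
    Rabs (U x' y' - U x y) < e /\ Rabs (V x' y' - V x y) < e).
  { intros e He. destruct (H 1) as [d [P Hd]]; [lra|].
    set (M := 1 + Rabs p + Rabs q).
    assert (HM : 1 <= M) by (unfold M; pose proof (Rabs_pos p); pose proof (Rabs_pos q); lra).
    exists (Rmin d (e / (2 * M))). split.
    { apply Rmin_pos; auto. apply Rdiv_lt_0_compat; lra. }
    intros x' y' Hx Hy.
    assert (X1 := Rlt_le_trans _ _ _ Hx (Rmin_l _ _)). assert (X2 := Rlt_le_trans _ _ _ Hx (Rmin_r _ _)).
    assert (Y1 := Rlt_le_trans _ _ _ Hy (Rmin_l _ _)). assert (Y2 := Rlt_le_trans _ _ _ Hy (Rmin_r _ _)).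
    destruct (Hd x' y' X1 Y1) as [A B].
    pose proof (affine_bound_small p (-q) e (x'-x) (y'-y) He) as S1.
    pose proof (affine_bound_small q p e (x'-x) (y'-y) He) as S2.
    rewrite Rabs_Ropp in S1. specialize (S1 X2 Y2).
    replace (1 + Rabs q + Rabs p) with M in S2 by (unfold M; ring). specialize (S2 X2 Y2).
    replace (p * (x' - x) + - q * (y' - y)) with (p * (x' - x) - q * (y' - y)) in S1 by ring.
    set (L1 := p * (x' - x) - q * (y' - y)) in *. set (L2 := q * (x' - x) + p * (y' - y)) in *.
    split.
    - replace (U x' y' - U x y) with ((U x' y' - U x y - L1) + L1) by ring.
      eapply Rle_lt_trans; [apply Rabs_triang|]. lra.
    - replace (V x' y' - V x y) with ((V x' y' - V x y - L2) + L2) by ring.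
      eapply Rle_lt_trans; [apply Rabs_triang|]. lra. }
  repeat split; apply continuous_R_intro; intros e He;
    destruct (K e He) as [d [P Hd]]; exists d; (split; [auto|]); intros t Ht;
    apply Hd; auto; replace (_ - _) with 0 by ring; rewrite Rabs_R0; auto.
Qed.

(** The imaginary part of the counterclockwise contour integral of [U + i V], that is, the integral
    of [V dx + U dy]. On vertical sides it integrates the real part, which is what circle means of
    [Re G] call for. *)
Definition rect_int (U V : R -> R -> R) (a b c d : R) : R :=
  RInt (fun x => V x c) a b + RInt (U b) c d - RInt (fun x => V x d) a b - RInt (U a) c d.

Lemma cr_diff_integrable (U V : R -> R -> R) (a b c d : R) : a <= b -> c <= d ->
  (forall x y, a <= x <= b -> c <= y <= d -> cr_diff U V x y) ->
  (forall x, a <= x <= b -> forall c' d', c <= c' -> c' <= d' -> d' <= d -> ex_RInt (U x) c' d') /\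
  (forall y, c <= y <= d -> forall a' b', a <= a' -> a' <= b' -> b' <= b -> ex_RInt (fun x => V x y) a' b').
Proof.
  intros Hab Hcd H. split.
  - intros x Hx c' d' H1 H2 H3. apply (ex_RInt_continuous (U x)). intros z Hz.
    rewrite Rmin_left, Rmax_right in Hz by lra. apply (cr_diff_continuous U V x z). apply H; lra.
  - intros y Hy a' b' H1 H2 H3. apply (ex_RInt_continuous (fun x => V x y)). intros z Hz.
    rewrite Rmin_left, Rmax_right in Hz by lra. apply (cr_diff_continuous U V z y). apply H; lra.
Qed.

Lemma rect_int_split (U V : R -> R -> R) (a m b c n d : R) : a <= m <= b -> c <= n <= d ->
  (forall x y, a <= x <= b -> c <= y <= d -> cr_diff U V x y) ->
  rect_int U V a b c d = rect_int U V a m c n + rect_int U V m b c n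
    + rect_int U V a m n d + rect_int U V m b n d.
Proof.
  intros Hm Hn H. destruct (cr_diff_integrable U V a b c d) as [EU EV]; try lra; auto.
  unfold rect_int.
  assert (CU : forall x, a <= x <= b -> RInt (U x) c d = RInt (U x) c n + RInt (U x) n d).
  { intros x Hx. symmetry. apply (RInt_Chasles (U x)); apply EU; lra. }
  assert (CV : forall y, c <= y <= d -> RInt (fun x => V x y) a b =
     RInt (fun x => V x y) a m + RInt (fun x => V x y) m b).
  { intros y Hy. symmetry. apply (RInt_Chasles (fun x => V x y)); apply EV; lra. }
  rewrite (CU a), (CU b), (CV c), (CV d) by lra. ring.
Qed.

(** Opposite sides are subtracted before integrating: for the affine part the differences are the
    constants [p * (c - d)] and [p * (b - a)], whose integrals cancel by the Cauchy-Riemann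
    equations. Only error terms remain, two per difference, hence [e / 2]. *)
Lemma rect_int_local (U V : R -> R -> R) (x y e : R) : cr_diff U V x y -> 0 < e ->
  exists r, 0 < r /\ forall a b c d, a <= x <= b -> c <= y <= d -> b - a < r -> d - c < r ->
    (forall x y, a <= x <= b -> c <= y <= d -> cr_diff U V x y) ->
    Rabs (rect_int U V a b c d) <= e * ((b - a) + (d - c)) ^ 2.
Proof.
  intros [p [q H]] He. destruct (H (e / 2)) as [r [P Hr]]; [lra|].
  exists r. split; auto. intros a b c d Hx Hy Hw Hh Hdiff.
  destruct (cr_diff_integrable U V a b c d) as [EU EV]; try lra; auto.
  set (s := (b - a) + (d - c)).
  assert (K : forall x' y', a <= x' <= b -> c <= y' <= d ->
    Rabs (U x' y' - U x y - (p * (x' - x) - q * (y' - y))) <= e / 2 * s /\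
    Rabs (V x' y' - V x y - (q * (x' - x) + p * (y' - y))) <= e / 2 * s).
  { intros x' y' Hx' Hy'.
    assert (A : Rabs (x' - x) <= b - a) by (apply Rabs_le_between; lra).
    assert (B : Rabs (y' - y) <= d - c) by (apply Rabs_le_between; lra).
    destruct (Hr x' y') as [E1 E2]; try lra.
    assert (e / 2 * (Rabs (x' - x) + Rabs (y' - y)) <= e / 2 * s).
    { apply Rmult_le_compat_l; unfold s; lra. }
    lra. }
  assert (T1 : Rabs (RInt (fun t => V t c - V t d) a b - (p * (c - d)) * (b - a)) <= e * s * (b - a)).
  { apply RInt_near_const; [lra| |].
    - apply (ex_RInt_minus (fun t => V t c) (fun t => V t d)); apply EV; lra.
    - intros t Ht. destruct (K t c) as [_ A]; try lra. destruct (K t d) as [_ B]; try lra.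
      apply Rabs_le_between in A. apply Rabs_le_between in B. apply Rabs_le_between. lra. }
  assert (T2 : Rabs (RInt (fun t => U b t - U a t) c d - (p * (b - a)) * (d - c)) <= e * s * (d - c)).
  { apply RInt_near_const; [lra| |].
    - apply (ex_RInt_minus (U b) (U a)); apply EU; lra.
    - intros t Ht. destruct (K b t) as [A _]; try lra. destruct (K a t) as [B _]; try lra.
      apply Rabs_le_between in A. apply Rabs_le_between in B. apply Rabs_le_between. lra. }
  assert (E1 : RInt (fun t => V t c - V t d) a b = RInt (fun t => V t c) a b - RInt (fun t => V t d) a b).
  { apply (RInt_minus (fun t => V t c) (fun t => V t d)); apply EV; lra. }
  assert (E2 : RInt (fun t => U b t - U a t) c d = RInt (U b) c d - RInt (U a) c d).
  { apply (RInt_minus (U b) (U a)); apply EU; lra. }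
  unfold rect_int. rewrite E1 in T1. rewrite E2 in T2.
  apply Rabs_le_between in T1. apply Rabs_le_between in T2. apply Rabs_le_between.
  replace (e * s ^ 2) with (e * s * (b - a) + e * s * (d - c)) by (unfold s; ring). lra.
Qed.

(** Bisection: one of the four quarters keeps a quarter of the integral, so [K / 4 ^ n] survives on
    a rectangle with sides divided by [2 ^ n]. At the common point of these rectangles the quadratic
    local bound contradicts this. *)
Lemma goursat_rect (U V : R -> R -> R) (a b c d : R) : a <= b -> c <= d ->
  (forall x y, a <= x <= b -> c <= y <= d -> cr_diff U V x y) -> rect_int U V a b c d = 0.
Proof.
  intros Hab Hcd H. apply NNPP. intros NJ.
  set (K := Rabs (rect_int U V a b c d)).
  assert (HK : 0 < K) by (apply Rabs_pos_lt; auto).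
  set (w := fun n : nat => (b - a) / 2 ^ n). set (h := fun n : nat => (d - c) / 2 ^ n).
  assert (P2 : forall n, 0 < 2 ^ n) by (intros; apply pow_lt; lra).
  assert (w2 : forall n, w n = 2 * w (S n)) by (intros n; unfold w; simpl; field; specialize (P2 n); lra).
  assert (h2 : forall n, h n = 2 * h (S n)) by (intros n; unfold h; simpl; field; specialize (P2 n); lra).
  assert (w0 : forall n, 0 <= w n) by (intros n; unfold w; apply Rdiv_le_0_compat; [lra|auto]).
  assert (h0 : forall n, 0 <= h n) by (intros n; unfold h; apply Rdiv_le_0_compat; [lra|auto]).
  set (P := fun n (ac : R * R) => a <= fst ac /\ fst ac + w n <= b /\ c <= snd ac /\ snd ac + h n <= d /\
     K / 4 ^ n <= Rabs (rect_int U V (fst ac) (fst ac + w n) (snd ac) (snd ac + h n))).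
  set (S' := fun n (p q : R * R) => fst p <= fst q /\ fst q + w (S n) <= fst p + w n /\
     snd p <= snd q /\ snd q + h (S n) <= snd p + h n).
  destruct (dependent_choice P S' (a, c)) as [s [_ Hs]].
  - unfold P, w, h; simpl. replace ((b - a) / 1) with (b - a) by field. replace ((d - c) / 1) with (d - c) by field.
    replace (a + (b - a)) with b by ring. replace (c + (d - c)) with d by ring.
    replace (K / 1) with K by field. unfold K. lra.
  - intros n [x y] [H1 [H2 [H3 [H4 H5]]]]. cbn [fst snd] in *.
    rewrite (rect_int_split U V x (x + w (S n)) (x + w n) y (y + h (S n)) (y + h n)) in H5;
      [| rewrite (w2 n) ; specialize (w0 (S n)); lra | rewrite (h2 n); specialize (h0 (S n)); lra
       | intros; apply H; lra].
    assert (C4 : forall A B C D k, k <= Rabs (A + B + C + D) ->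
      k / 4 <= Rabs A \/ k / 4 <= Rabs B \/ k / 4 <= Rabs C \/ k / 4 <= Rabs D).
    { intros A B C D k Hk.
      pose proof (Rabs_triang (A + B + C) D). pose proof (Rabs_triang (A + B) C). pose proof (Rabs_triang A B).
      destruct (Rle_dec (k/4) (Rabs A)); auto. destruct (Rle_dec (k/4) (Rabs B)); auto.
      destruct (Rle_dec (k/4) (Rabs C)); auto. right; right; right. lra. }
    apply C4 in H5.
    replace (K / 4 ^ n / 4) with (K / 4 ^ S n) in H5 by (simpl; field; apply pow_nonzero; lra).
    pose proof (w0 (S n)). pose proof (h0 (S n)). pose proof (w2 n). pose proof (h2 n).
    assert (Ew : x + w n = x + w (S n) + w (S n)) by lra.
    assert (Eh : y + h n = y + h (S n) + h (S n)) by lra.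
    rewrite Ew, Eh in H5.
    destruct H5 as [H5|[H5|[H5|H5]]].
    + exists (x, y). unfold P, S'; simpl fst; simpl snd. repeat split; try lra; auto.
    + exists (x + w (S n), y). unfold P, S'; simpl fst; simpl snd. repeat split; try lra; auto.
    + exists (x, y + h (S n)). unfold P, S'; simpl fst; simpl snd. repeat split; try lra; auto.
    + exists (x + w (S n), y + h (S n)). unfold P, S'; simpl fst; simpl snd. repeat split; try lra; auto.
  - destruct (nested_intervals (fun n => fst (s n)) w) as [x Hx]; auto.
    { intros n. apply (Hs n). } { intros n. apply (Hs n). }
    destruct (nested_intervals (fun n => snd (s n)) h) as [y Hy]; auto.
    { intros n. apply (Hs n). } { intros n. apply (Hs n). }
    assert (Hxy : cr_diff U V x y).
    { destruct (Hs 0%nat) as [[A [B [C [D _]]]] _]. specialize (Hx 0%nat). specialize (Hy 0%nat).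
      apply H; simpl in *; lra. }
    set (l := (b - a) + (d - c)).
    assert (Hl : 0 <= l) by (unfold l; lra).
    (* This makes [e * l ^ 2 < K], whereas stage [N] of the bisection yields [K <= e * l ^ 2]. *)
    set (e := K / (2 * (1 + l ^ 2))).
    assert (Hl2 : 0 <= l ^ 2) by (apply pow_le; auto).
    assert (He : 0 < e) by (apply Rdiv_lt_0_compat; lra).
    destruct (rect_int_local U V x y e Hxy He) as [r [Pr Hr]].
    destruct (pow_lt_1_zero (1/2)) with (y := r / (1 + l)) as [N HN].
    { rewrite Rabs_right; lra. } { apply Rdiv_lt_0_compat; lra. }
    specialize (HN N (le_n N)). rewrite Rabs_right in HN by (left; apply pow_lt; lra).
    assert (El : (1 / 2) ^ N = / 2 ^ N) by (unfold Rdiv; rewrite Rmult_1_l, pow_inv; auto).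
    rewrite El in HN.
    assert (Hsm : / 2 ^ N * (1 + l) < r).
    { apply Rmult_lt_reg_r with (/ (1 + l)); [apply Rinv_0_lt_compat; lra|].
      rewrite Rmult_assoc, Rinv_r by lra. lra. }
    assert (Hi : 0 < / 2 ^ N) by (apply Rinv_0_lt_compat; auto).
    destruct (Hs N) as [[A [B [C [D J]]]] _]. specialize (Hx N). specialize (Hy N). cbv beta in Hx, Hy.
    specialize (Hr (fst (s N)) (fst (s N) + w N) (snd (s N)) (snd (s N) + h N) Hx Hy).
    assert (Hr' := Hr ltac:(unfold w, l, Rdiv in *; nra) ltac:(unfold h, l, Rdiv in *; nra)
      ltac:(intros; apply H; lra)). clear Hr.
    replace (fst (s N) + w N - fst (s N) + (snd (s N) + h N - snd (s N))) with (l / 2 ^ N) in Hr'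
      by (unfold w, h, l; field; specialize (P2 N); lra).
    assert (J' := Rle_trans _ _ _ J Hr').
    replace (e * (l / 2 ^ N) ^ 2) with (e * l ^ 2 / 4 ^ N) in J'.
    2:{ replace 4 with (2 * 2) by ring. rewrite Rpow_mult_distr. field. specialize (P2 N); lra. }
    assert (P4 : 0 < 4 ^ N) by (apply pow_lt; lra).
    apply Rmult_le_compat_r with (r := 4 ^ N) in J'; [|lra].
    unfold Rdiv in J'. rewrite !Rmult_assoc, Rinv_l, !Rmult_1_r in J' by lra.
    assert (e * (2 * (1 + l ^ 2)) = K) by (unfold e; field; lra). nra.
Qed.

(** * Maximum principle and regularity of the derivative *)

Definition cexp (z : C) : C := (exp (Re z) * cos (Im z), exp (Re z) * sin (Im z)).

Lemma cexp_plus (x y : C) : cexp (x + y) = (cexp x * cexp y)%C.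
Proof.
  destruct x as [a b], y as [c d]. unfold cexp, Cplus, Cmult; simpl.
  rewrite exp_plus, cos_plus, sin_plus. f_equal; ring.
Qed.

Lemma cexp_0 : cexp 0 = 1.
Proof. unfold cexp; simpl. rewrite exp_0, cos_0, sin_0. unfold RtoC. f_equal; ring. Qed.

Lemma Cmod_cexp (z : C) : Cmod (cexp z) = exp (Re z).
Proof.
  unfold Cmod, cexp; simpl fst; simpl snd.
  replace ((exp (Re z) * cos (Im z)) ^ 2 + (exp (Re z) * sin (Im z)) ^ 2)
    with (exp (Re z) ^ 2 * (Rsqr (sin (Im z)) + Rsqr (cos (Im z)))) by (unfold Rsqr; ring).
  rewrite sin2_cos2, Rmult_1_r. apply sqrt_pow2. left. apply exp_pos.
Qed.

Lemma derivable_pt_lim_0_bound (f : R -> R) (l e : R) : derivable_pt_lim f 0 l -> 0 < e ->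
  exists d, 0 < d /\ forall h, Rabs h < d -> Rabs (f h - f 0 - l * h) <= e * Rabs h.
Proof.
  intros H He. destruct (H e He) as [d Hd]. exists d. split; [apply cond_pos|].
  intros h Hh. destruct (Req_dec h 0) as [->|N].
  - rewrite Rabs_R0. replace (f 0 - f 0 - l * 0) with 0 by ring. rewrite Rabs_R0. lra.
  - specialize (Hd h N Hh). rewrite Rplus_0_l in Hd.
    replace (f h - f 0 - l * h) with (((f h - f 0) / h - l) * h) by (field; auto).
    rewrite Rabs_mult. apply Rmult_le_compat_r; [apply Rabs_pos|lra].
Qed.

Lemma cexp_cdiff_0 : cdiff cexp 0 1.
Proof.
  apply cdiff_intro. intros e0 He0.
  (* The two coordinates collect errors of at most [3 * e * m] and [5 * e * m], and passing to
     [Cmod] costs at most a factor 2. *)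
  set (e := Rmin 1 (e0 / 10)).
  assert (He : 0 < e) by (apply Rmin_pos; lra).
  assert (He1 : e <= 1) by apply Rmin_l. assert (He2 : e <= e0 / 10) by apply Rmin_r.
  destruct (derivable_pt_lim_0_bound exp 1 e derivable_pt_lim_exp_0 He) as [d1 [P1 H1]].
  destruct (derivable_pt_lim_0_bound sin 1 e derivable_pt_lim_sin_0 He) as [d2 [P2 H2]].
  assert (Dc : derivable_pt_lim cos 0 0).
  { pose proof (derivable_pt_lim_cos 0) as D. rewrite sin_0, Ropp_0 in D. exact D. }
  destruct (derivable_pt_lim_0_bound cos 0 e Dc He) as [d3 [P3 H3]].
  exists (Rmin e (Rmin d1 (Rmin d2 d3))). split.
  { repeat (apply Rmin_pos; auto). }
  intros w Hw.
  assert (W0 := Rlt_le_trans _ _ _ Hw (Rmin_l _ _)).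
  assert (W' := Rlt_le_trans _ _ _ Hw (Rmin_r _ _)).
  assert (W1 := Rlt_le_trans _ _ _ W' (Rmin_l _ _)).
  assert (W'' := Rlt_le_trans _ _ _ W' (Rmin_r _ _)).
  assert (W2 := Rlt_le_trans _ _ _ W'' (Rmin_l _ _)).
  assert (W3 := Rlt_le_trans _ _ _ W'' (Rmin_r _ _)).
  replace (w - 0)%C with w in * by ring. rewrite cexp_0.
  destruct w as [x y]. set (m := Cmod (x, y)) in *.
  assert (Hx : Rabs x <= m) by (apply (re_le_Cmod (x,y))).
  assert (Hy : Rabs y <= m) by (eapply Rle_trans; [|apply (Rmax_Cmod (x,y))]; apply Rmax_r).
  specialize (H1 x ltac:(lra)). specialize (H2 y ltac:(lra)). specialize (H3 y ltac:(lra)).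
  rewrite exp_0 in H1. rewrite sin_0 in H2. rewrite cos_0 in H3.
  pose proof (Rabs_pos x). pose proof (Rabs_pos y).
  assert (Hm : 0 <= m) by apply Cmod_ge_0.
  replace (cexp (x,y) - 1 - 1 * (x,y))%C with
    ((exp x * cos y - 1 - x)%R, (exp x * sin y - y)%R).
  2:{ unfold cexp, Cminus, Cplus, Copp, Cmult, RtoC, Re, Im; cbn [fst snd]. f_equal; ring. }
  assert (B1 : Rabs (exp x * cos y - 1 - x) <= 3 * e * m).
  { replace (exp x * cos y - 1 - x) with
      ((exp x - 1 - 1 * x) * cos y + (1 + x) * (cos y - 1 - 0 * y)) by ring.
    eapply Rle_trans; [apply Rabs_triang|]. rewrite !Rabs_mult.
    assert (Rabs (cos y) <= 1) by (apply Rabs_le_between; apply COS_bound).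
    assert (Rabs (1 + x) <= 2).
    { eapply Rle_trans; [apply Rabs_triang|]. rewrite Rabs_R1. lra. }
    pose proof (Rabs_pos (exp x - 1 - 1 * x)). pose proof (Rabs_pos (cos y - 1 - 0 * y)).
    pose proof (Rabs_pos (cos y)). pose proof (Rabs_pos (1 + x)).
    assert (e * Rabs x <= e * m) by (apply Rmult_le_compat_l; lra).
    assert (e * Rabs y <= e * m) by (apply Rmult_le_compat_l; lra).
    assert (0 <= e * m) by nra. nra. }
  assert (B2 : Rabs (exp x * sin y - y) <= 5 * e * m).
  { replace (exp x * sin y - y) with
      ((1 + (1 * x + (exp x - 1 - 1 * x))) * (sin y - 0 - 1 * y) + (1 * x + (exp x - 1 - 1 * x)) * y) by ring.
    set (t := 1 * x + (exp x - 1 - 1 * x)).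
    assert (Ht : Rabs t <= 2 * e).
    { unfold t. eapply Rle_trans; [apply Rabs_triang|].
      replace (Rabs (1 * x)) with (Rabs x) by (f_equal; ring).
      assert (e * Rabs x <= e) by nra. lra. }
    eapply Rle_trans; [apply Rabs_triang|]. rewrite !Rabs_mult.
    assert (Rabs (1 + t) <= 3).
    { eapply Rle_trans; [apply Rabs_triang|]. rewrite Rabs_R1. lra. }
    pose proof (Rabs_pos (1 + t)). pose proof (Rabs_pos t). pose proof (Rabs_pos (sin y - 0 - 1 * y)).
    assert (e * Rabs y <= e * m) by (apply Rmult_le_compat_l; lra).
    assert (Rabs t * Rabs y <= 2 * e * m) by (apply Rmult_le_compat; lra).
    nra. }
  eapply Rle_trans; [apply Cmod_2Rmax|]. cbn [fst snd].
  assert (Rmax (Rabs (exp x * cos y - 1 - x)) (Rabs (exp x * sin y - y)) <= 5 * e * m).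
  { apply Rmax_lub; nra. }
  assert (sqrt 2 <= 2). { rewrite <- (sqrt_pow2 2) at 2 by lra. apply sqrt_le_1_alt; lra. }
  pose proof (sqrt_pos 2).
  assert (0 <= 5 * e * m) by nra.
  apply Rle_trans with (2 * (5 * e * m)); [|nra].
  apply Rmult_le_compat; auto. eapply Rle_trans; [apply Rabs_pos|apply Rmax_l].
Qed.

Lemma cexp_cdiff (z : C) : cdiff cexp z (cexp z).
Proof.
  destruct cexp_cdiff_0 as [Q [HQ [EQ H]]].
  exists (fun w => cexp z * Q (w - z))%C. split; [|split].
  - apply ccont_mult; [apply ccont_const|]. apply (ccont_comp Q (fun w => w - z)%C).
    + apply ccont_minus; auto using ccont_id, ccont_const.
    + replace (z - z)%C with (RtoC 0) by ring. auto.
  - replace (z - z)%C with (RtoC 0) by ring. rewrite EQ. ring.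
  - intros w. replace w with (z + (w - z))%C at 1 by ring. rewrite cexp_plus, (H (w - z)%C), cexp_0.
    ring.
Qed.

Lemma cdiff_cr_diff (G : C -> C) (x y : R) (d : C) : cdiff G (x, y) d ->
  cr_diff (fun x y => Re (G (x, y))) (fun x y => Im (G (x, y))) x y.
Proof.
  intros H. exists (Re d), (Im d). intros e He.
  destruct (cdiff_quotient G (x,y) d H (e / 2)) as [r [P Hr]]; [lra|].
  exists (r / 2). split; [lra|]. intros x' y' Hx Hy.
  assert (L : Cmod ((x', y') - (x, y)) <= Rabs (x' - x) + Rabs (y' - y)).
  { replace ((x', y') - (x, y))%C with (RtoC (x' - x) + Ci * RtoC (y' - y))%C.
    2:{ unfold Cminus, Cplus, Copp, Cmult, RtoC, Ci; cbn [fst snd]. f_equal; ring. }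
    eapply Rle_trans; [apply Cmod_triangle|]. rewrite Cmod_mult, Cmod_Ci, !Cmod_R. lra. }
  specialize (Hr (x', y') ltac:(lra)).
  set (E := (G (x', y') - G (x, y) - d * ((x', y') - (x, y)))%C) in *.
  assert (M := Rmax_Cmod E).
  assert (HE : Cmod E <= e * (Rabs (x' - x) + Rabs (y' - y))).
  { eapply Rle_trans; [exact Hr|]. pose proof (Cmod_ge_0 ((x', y') - (x, y))). nra. }
  split.
  - replace (_ - _) with (fst E).
    + eapply Rle_trans; [apply Rmax_l|]. eapply Rle_trans; [exact M|]. exact HE.
    + unfold E, Cminus, Cplus, Copp, Cmult, Re, Im; cbn [fst snd]. ring.
  - replace (_ - _) with (snd E).
    + eapply Rle_trans; [apply Rmax_r|]. eapply Rle_trans; [exact M|]. exact HE.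
    + unfold E, Cminus, Cplus, Copp, Cmult, Re, Im; cbn [fst snd]. ring.
Qed.

(** In the coordinate [s = log (w - z)] the circle means of [Re G] are integrals over
    vertical segments; they agree by Cauchy's theorem, as horizontal sides cancel by periodicity. *)
Lemma circle_bound_Re (G : C -> C) (z : C) (r B : R) : 0 < r -> ccont G z ->
  (forall w, 0 < Cmod (w - z) <= r -> exists d, cdiff G w d) ->
  (forall w, Cmod (w - z) = r -> Re (G w) <= B) -> Re (G z) <= B.
Proof.
  intros Hr Hc Hd HB. apply Rnot_lt_le. intros Hlt.
  set (e := (Re (G z) - B) / 2). assert (He : 0 < e) by (unfold e; lra).
  destruct (Hc e He) as [d [Pd Hcd]].
  set (Phi := fun s => G (z + cexp s)%C).
  set (U := fun x y => Re (Phi (x, y))). set (V := fun x y => Im (Phi (x, y))).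
  (* The right side of the rectangle is the circle of radius [r], the left side a circle on which
     [G] is within [e] of [G z], where [e] is half the supposed excess of [Re (G z)] over [B]. *)
  set (b := ln r). set (a := Rmin b (ln (d / 2))).
  assert (Ha : exp a < d).
  { assert (exp a <= exp (ln (d/2))).
    { destruct (Rle_lt_or_eq_dec a (ln (d/2)) (Rmin_r _ _)) as [L|L];
      [left; apply exp_increasing; auto|rewrite L; lra]. }
    rewrite exp_ln in H by lra. lra. }
  assert (Hab : a <= b) by apply Rmin_l.
  assert (Mod : forall s, Cmod ((z + cexp s) - z) = exp (Re s)).
  { intros s. replace (z + cexp s - z)%C with (cexp s) by ring. apply Cmod_cexp. }
  pose proof PI_RGT_0 as HPI.
  assert (Hcr : forall x y, a <= x <= b -> 0 <= y <= 2 * PI -> cr_diff U V x y).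
  { intros x y Hx _.
    destruct (Hd (z + cexp (x, y))%C) as [dd Hdd].
    - rewrite Mod. split; [apply exp_pos|]. unfold Re; cbn [fst].
      rewrite <- (exp_ln r) by auto. fold b.
      destruct (Rle_lt_or_eq_dec x b (proj2 Hx)) as [L|L];
      [left; apply exp_increasing; auto|rewrite L; lra].
    - apply (cdiff_cr_diff Phi x y _ (cdiff_comp G (fun s => z + cexp s)%C (x,y) _ _
        (cdiff_plus (fun _ => z) cexp (x,y) _ _ (cdiff_const z _) (cexp_cdiff _)) Hdd)). }
  assert (HJ := goursat_rect U V a b 0 (2 * PI) Hab ltac:(lra) Hcr).
  destruct (cr_diff_integrable U V a b 0 (2 * PI)) as [EU EV]; try lra; auto.
  unfold rect_int in HJ.
  assert (EqV : RInt (fun x => V x 0) a b = RInt (fun x => V x (2 * PI)) a b).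
  { apply RInt_ext. intros x _. unfold V, Phi, cexp, Re, Im; cbn [fst snd].
    rewrite cos_0, sin_0, cos_2PI, sin_2PI. reflexivity. }
  rewrite EqV in HJ.
  assert (Eab : RInt (U b) 0 (2 * PI) = RInt (U a) 0 (2 * PI)) by lra.
  assert (L1 : RInt (U b) 0 (2 * PI) <= B * (2 * PI)).
  { replace (B * (2 * PI)) with (RInt (fun _ => B) 0 (2 * PI)).
    2:{ rewrite RInt_const. unfold scal; simpl; unfold mult; simpl. ring. }
    apply RInt_le; [lra|apply EU; lra|apply ex_RInt_const|].
    intros y _. apply HB. rewrite Mod. apply exp_ln; auto. }
  assert (L2 : Rabs (RInt (U a) 0 (2 * PI) - Re (G z) * (2 * PI - 0)) <= e * (2 * PI - 0)).
  { apply RInt_near_const; [lra|apply EU; lra|]. intros y _.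
    assert (Cmod (G (z + cexp (a, y))%C - G z) < e).
    { apply Hcd. rewrite Mod. exact Ha. }
    left. eapply Rle_lt_trans; [|exact H]. exact (re_le_Cmod (G (z + cexp (a,y))%C - G z)). }
  apply Rabs_le_between in L2. rewrite Eab in L1. unfold e in L2. nra.
Qed.

(** Multiplying by [Cconj (G z)] turns a nonzero value at the centre into the positive number
    [m ^ 2], so the bound for real parts applies. The centre is left out of the differentiability
    hypothesis so that difference quotients qualify. *)
Lemma maximum_principle (G : C -> C) (z : C) (r B : R) : 0 < r -> ccont G z ->
  (forall w, 0 < Cmod (w - z) <= r -> exists d, cdiff G w d) ->
  (forall w, Cmod (w - z) = r -> Cmod (G w) <= B) -> Cmod (G z) <= B.
Proof.
  intros Hr Hc Hd HB.
  destruct (classic (G z = RtoC 0)) as [E|N].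
  - rewrite E, Cmod_0. eapply Rle_trans; [apply Cmod_ge_0|]. apply (HB (z + RtoC r)%C).
    replace (z + r - z)%C with (RtoC r) by ring. rewrite Cmod_R. apply Rabs_right. lra.
  - set (m := Cmod (G z)). assert (Hm : 0 < m) by (apply Cmod_gt_0; auto).
    assert (K : Re (Cconj (G z) * G z) <= m * B).
    { apply (circle_bound_Re (fun w => Cconj (G z) * G w)%C z r); auto.
      - apply ccont_mult; auto using ccont_const.
      - intros w Hw. destruct (Hd w Hw) as [d Hdd]. eexists.
        apply cdiff_mult; [apply cdiff_const|exact Hdd].
      - intros w Hw. eapply Rle_trans; [apply Rle_abs|]. eapply Rle_trans; [apply re_le_Cmod|].
        rewrite Cmod_mult, Cmod_conj. fold m. apply Rmult_le_compat_l; [lra|auto]. }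
    replace (Cconj (G z) * G z)%C with (RtoC (m ^ 2)) in K.
    2:{ unfold m. rewrite Cmod2_conj. ring. }
    simpl in K. nra.
Qed.

(** The maximum principle for the difference quotient. *)
Lemma cauchy_estimate (G : C -> C) (z d : C) (r M : R) : 0 < r -> cdiff G z d ->
  (forall w, Cmod (w - z) <= r -> exists d, cdiff G w d) ->
  (forall w, Cmod (w - z) <= r -> Cmod (G w - G z) <= M) -> Cmod d <= M / r.
Proof.
  intros Hr [Q [HQ [EQ HG]]] Hd HM.
  (* Off [z], [Q] is the difference quotient of [G], hence differentiable; at [z] its continuity is
     what the maximum principle asks for. *)
  assert (Qd : forall w, w <> z -> Cmod (w - z) <= r -> exists e, cdiff Q w e).
  { intros w Nw Hw. destruct (Hd w Hw) as [e He].
    assert (D1 := cdiff_minus _ _ _ _ _ He (cdiff_const (G z) w)).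
    assert (D2 := cdiff_minus _ _ _ _ _ (cdiff_id w) (cdiff_const z w)).
    assert (D3 := cdiff_comp Cinv (fun w => w - z)%C w _ _ D2 (cdiff_inv _ (Cminus_neq_0 _ _ Nw))).
    assert (D4 := cdiff_mult _ _ _ _ _ D1 D3). eexists.
    apply (cdiff_ext_near (fun w => (G w - G z) * / (w - z))%C Q w _ (Cmod (w - z)));
      [apply Cmod_minus_pos; auto| |exact D4].
    intros v Hv. assert (Nv : v <> z).
    { intros ->. rewrite Cmod_minus_sym in Hv. lra. }
    rewrite (HG v). field. apply Cminus_neq_0; auto. }
  rewrite <- EQ. apply (maximum_principle Q z r); auto.
  - intros w Hw. apply Qd; [|lra]. intros ->. rewrite Cmod_self_minus in Hw. lra.
  - intros w Hw. specialize (HM w ltac:(lra)). rewrite (HG w) in HM.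
    replace (G z + (w - z) * Q w - G z)%C with ((w - z) * Q w)%C in HM by ring.
    rewrite Cmod_mult, Hw in HM. apply Rmult_le_reg_l with r; auto.
    replace (r * (M / r)) with M by (field; lra). auto.
Qed.

(** * Mean value inequality and differentiability of the derivative *)

Lemma Cmod_unit_direction (v : C) : exists u, Cmod u = 1 /\ Re (u * v) = Cmod v.
Proof.
  destruct (classic (v = RtoC 0)) as [->|N].
  - exists (RtoC 1). rewrite Cmod_1, Cmod_0. split; auto. simpl. ring.
  - assert (Hm := proj1 (Cmod_gt_0 v) N).
    assert (Nm : RtoC (Cmod v) <> 0) by (apply Cmod_gt_0; rewrite Cmod_R, Rabs_right; lra).
    exists (Cconj v / RtoC (Cmod v))%C. split.
    + rewrite Cmod_div, Cmod_conj, Cmod_R, Rabs_right by (auto; lra). field. lra.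
    + replace (Cconj v / RtoC (Cmod v) * v)%C with (RtoC (Cmod v)); [reflexivity|].
      replace (Cconj v / RtoC (Cmod v) * v)%C with ((v * Cconj v) / RtoC (Cmod v))%C by (field; auto).
      rewrite <- Cmod2_conj. rewrite <- RtoC_div by lra. f_equal. field. lra.
Qed.

Lemma segment_dist (x y z : C) (t r : R) : 0 <= t <= 1 ->
  Cmod (x - z) <= r -> Cmod (y - z) <= r -> Cmod (x + RtoC t * (y - x) - z) <= r.
Proof.
  intros Ht Hx Hy.
  replace (x + RtoC t * (y - x) - z)%C with (RtoC (1 - t) * (x - z) + RtoC t * (y - z))%C
    by (rewrite RtoC_minus; ring).
  eapply Rle_trans; [apply Cmod_triangle|]. rewrite !Cmod_mult, !Cmod_R, !Rabs_right by lra. nra.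
Qed.

Lemma is_derive_Re_line (f : C -> C) (x v d : C) (t : R) : cdiff f (x + RtoC t * v) d ->
  is_derive (fun t => Re (f (x + RtoC t * v)%C)) t (Re (d * v)).
Proof.
  intros Hd. set (s := fun t : R => (x + RtoC t * v)%C). fold (s t) in Hd.
  apply is_derive_Reals. intros e He. pose proof (Cmod_ge_0 v) as Hv.
  destruct (cdiff_quotient _ _ _ Hd (e / (2 * (1 + Cmod v)))) as [r [P Hr]].
  { apply Rdiv_lt_0_compat; lra. }
  assert (Pr : 0 < r / (1 + Cmod v)) by (apply Rdiv_lt_0_compat; lra).
  exists (mkposreal _ Pr). intros h Nh Hh. simpl in Hh.
  assert (Hsh : (s (t + h)%R - s t = RtoC h * v)%C).
  { unfold s. rewrite RtoC_plus. ring. }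
  assert (Hm : Cmod (s (t + h)%R - s t) = Rabs h * Cmod v).
  { rewrite Hsh, Cmod_mult, Cmod_R. auto. }
  pose proof (Rabs_pos_lt h Nh) as Ph.
  specialize (Hr (s (t + h))).
  assert (Hlt : Cmod (s (t + h)%R - s t) < r).
  { rewrite Hm. apply Rmult_lt_compat_r with (r := 1 + Cmod v) in Hh; [|lra].
    unfold Rdiv in Hh. rewrite Rmult_assoc, Rinv_l in Hh by lra. nra. }
  specialize (Hr Hlt). rewrite Hm in Hr. fold (s (t + h)) (s t).
  set (E := (f (s (t + h)%R) - f (s t) - d * (s (t + h)%R - s t))%C) in *.
  assert (EE : (Re (f (s (t + h))) - Re (f (s t))) - Re (d * v) * h = Re E).
  { unfold E. rewrite Hsh. unfold Re, Cminus, Cplus, Copp, Cmult, RtoC; cbn [fst snd]. ring. }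
  replace ((Re (f (s (t + h))) - Re (f (s t))) / h - Re (d * v)) with
    (((Re (f (s (t + h))) - Re (f (s t))) - Re (d * v) * h) / h) by (field; auto).
  rewrite EE. unfold Rdiv. rewrite Rabs_mult, Rabs_inv.
  apply Rmult_lt_reg_r with (Rabs h); auto. rewrite Rmult_assoc, Rinv_l, Rmult_1_r by lra.
  eapply Rle_lt_trans; [apply re_le_Cmod|]. eapply Rle_lt_trans; [exact Hr|].
  set (m := Cmod v) in *.
  replace (e / (2 * (1 + m)) * (Rabs h * m)) with (e * Rabs h * (m / (2 * (1 + m)))) by (field; lra).
  assert (m / (2 * (1 + m)) < 1).
  { apply Rmult_lt_reg_r with (2 * (1 + m)); [lra|]. unfold Rdiv. rewrite Rmult_assoc, Rinv_l by lra. lra. }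
  assert (0 < e * Rabs h) by (apply Rmult_lt_0_compat; auto). nra.
Qed.

Lemma is_derive_Im_line (f : C -> C) (x v d : C) (t : R) : cdiff f (x + RtoC t * v) d ->
  is_derive (fun t => Im (f (x + RtoC t * v)%C)) t (Im (d * v)).
Proof.
  intros Hd.
  assert (K := is_derive_Re_line _ _ _ _ _ (cdiff_mult _ _ _ _ _ (cdiff_const (- Ci)%C _) Hd)).
  replace (Im (d * v)) with (Re ((0 * f (x + RtoC t * v)%C + - Ci * d) * v)).
  - apply (is_derive_ext (fun t => Re (- Ci * f (x + RtoC t * v)%C))); [|exact K].
    intros u. lazymatch goal with |- ?a = ?b => change (@eq R a b) end.
    unfold Re, Im, Ci, Copp, Cmult; cbn [fst snd]. ring.
  - unfold Re, Im, Ci, RtoC, Cplus, Copp, Cmult; cbn [fst snd]. ring.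
Qed.

(** The real mean value theorem is applied along the segment to [Re (u * (f w - c * w))], with the
    unit [u] that turns the total increment into its modulus. The choice [c = 0] yields Lipschitz
    bounds, other [c] closeness to an affine map. *)
Lemma mean_value_ineq (f f1 : C -> C) (x y c : C) (k : R) :
  (forall t, 0 <= t <= 1 -> cdiff f (x + RtoC t * (y - x)) (f1 (x + RtoC t * (y - x)))%C /\
     Cmod (f1 (x + RtoC t * (y - x))%C - c) <= k) ->
  Cmod (f y - f x - c * (y - x)) <= k * Cmod (y - x).
Proof.
  intros H. destruct (Cmod_unit_direction (f y - f x - c * (y - x))) as [u [Hu Eu]].
  set (s := fun t : R => (x + RtoC t * (y - x))%C).
  set (g := fun t => Re (u * (f (s t) - c * s t))).
  set (dg := fun t => Re (u * (f1 (s t) - c) * (y - x))).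
  assert (D : forall t, 0 <= t <= 1 -> is_derive g t (dg t)).
  { intros t Ht. destruct (H t Ht) as [Hd _].
    apply (is_derive_Re_line (fun w => u * (f w - c * w))%C x (y - x)).
    refine (cdiff_val _ _ _ _ (cdiff_mult _ _ _ _ _ (cdiff_const u _) (cdiff_minus _ _ _ _ _ Hd
      (cdiff_mult _ _ _ _ _ (cdiff_const c _) (cdiff_id _)))) _).
    unfold s. ring. }
  destruct (MVT_gen g 0 1 dg) as [t [Ht Et]].
  - rewrite Rmin_left, Rmax_right by lra. intros t Ht. apply D. lra.
  - rewrite Rmin_left, Rmax_right by lra. intros t Ht. apply continuity_pt_filterlim.
    apply (ex_derive_continuous g t). exists (dg t). apply D. lra.
  - rewrite Rmin_left, Rmax_right in Ht by lra. destruct (H t Ht) as [_ Hk]. fold (s t) in Hk.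
    replace (g 1 - g 0) with (Cmod (f y - f x - c * (y - x))) in Et.
    2:{ rewrite <- Eu. unfold g.
        replace (s 1) with y by (unfold s; rewrite <- (Cplus_0_r y) at 1; ring).
        replace (s 0) with x by (unfold s; ring).
        unfold Re, Cminus, Cplus, Copp, Cmult; cbn [fst snd]. ring. }
    rewrite Et, Rminus_0_r, Rmult_1_r. unfold dg.
    eapply Rle_trans; [apply Rle_abs|]. eapply Rle_trans; [apply re_le_Cmod|].
    rewrite !Cmod_mult, Hu, Rmult_1_l. apply Rmult_le_compat_r; [apply Cmod_ge_0|auto].
Qed.

Lemma C_complete (u : nat -> C) :
  (forall e, 0 < e -> exists N, forall n m, (N <= n)%nat -> (N <= m)%nat -> Cmod (u n - u m) < e) ->
  exists l, forall e, 0 < e -> exists N, forall n, (N <= n)%nat -> Cmod (u n - l) < e.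
Proof.
  intros H.
  assert (K : forall p : C -> R, (forall x y, Rabs (p x - p y) <= Cmod (x - y)) ->
    {l | Un_cv (fun n => p (u n)) l}).
  { intros p Hp. apply Rcomplete.R_complete. intros e He. destruct (H e He) as [N HN]. exists N.
    intros n m Hn Hm. eapply Rle_lt_trans; [apply Hp|]. apply HN; lia. }
  destruct (K Re) as [a Ha].
  { intros x y. exact (re_le_Cmod (x - y)%C). }
  destruct (K Im) as [b Hb].
  { intros x y. eapply Rle_trans; [|exact (Rmax_Cmod (x - y)%C)]. apply Rmax_r. }
  exists (a, b). intros e He. destruct (Ha (e/2)) as [N1 H1]; [lra|].
  destruct (Hb (e/2)) as [N2 H2]; [lra|]. exists (max N1 N2). intros n Hn.
  specialize (H1 n ltac:(lia)). specialize (H2 n ltac:(lia)). unfold Rdist in *.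
  replace (u n - (a, b))%C with (RtoC (Re (u n) - a) + Ci * RtoC (Im (u n) - b))%C.
  2:{ destruct (u n) as [p q]. unfold Ci, RtoC, Cminus, Cplus, Copp, Cmult, Re, Im; cbn [fst snd].
      f_equal; ring. }
  eapply Rle_lt_trans; [apply Cmod_triangle|]. rewrite Cmod_mult, Cmod_Ci, !Cmod_R. lra.
Qed.

(** Three Cauchy estimates: for [f], which bounds [f1]; for the difference quotients [g h], which
    makes [f1] Lipschitz and [g h] close to [f1]; and for [g h - g k], which makes the difference
    quotients of [f1] at [z] a Cauchy family as [h] tends to 0. *)
Lemma cdiff_derivative (f f1 : C -> C) (z : C) :
  (forall w, cdiff f w (f1 w)) -> exists d, cdiff f1 z d.
Proof.
  intros Hf.
  destruct (cdiff_ccont _ _ _ (Hf z) 1) as [d0 [P0 H0]]; [lra|].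
  set (r := d0 / 8). assert (Hr : 0 < r) by (unfold r; lra).
  (* On the disc of radius [d0 = 8 * r] the function [f] stays within 1 of [f z], so it oscillates
     by at most 2. *)
  set (M1 := 2 / r). assert (HM1 : 0 < M1) by (apply Rdiv_lt_0_compat; lra).
  assert (B1 : forall w, Cmod (w - z) <= 3 * r -> Cmod (f1 w) <= M1).
  { intros w Hw. apply (cauchy_estimate f w); eauto. intros v Hv.
    pose proof (Cmod_triangle_via w v z).
    assert (A1 := H0 v ltac:(unfold r in *; lra)). assert (A2 := H0 w ltac:(unfold r in *; lra)).
    pose proof (Cmod_triangle_via (f z) (f v) (f w)). rewrite (Cmod_minus_sym (f z)) in H1. lra. }
  set (g := fun h w => ((f (w + h) - f w) / h)%C).
  assert (Dg : forall h w, h <> RtoC 0 -> cdiff (g h) w ((f1 (w + h) - f1 w) / h)%C).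
  { intros h w Nh.
    assert (D1 := cdiff_comp f (fun v => v + h)%C w _ _
      (cdiff_plus _ _ _ _ _ (cdiff_id w) (cdiff_const h w)) (Hf (w + h)%C)).
    assert (D2 := cdiff_mult _ _ _ _ _ (cdiff_minus _ _ _ _ _ D1 (Hf w)) (cdiff_const (/ h)%C w)).
    refine (cdiff_val _ _ _ _ D2 _). unfold Cdiv. ring. }
  assert (Bg : forall h w, h <> RtoC 0 -> Cmod h <= r -> Cmod (w - z) <= 2 * r -> Cmod (g h w) <= M1).
  { intros h w Nh Hh Hw. unfold g. rewrite Cmod_div by auto.
    assert (Ph := proj1 (Cmod_gt_0 h) Nh).
    apply Rmult_le_reg_r with (Cmod h); auto. unfold Rdiv. rewrite Rmult_assoc, Rinv_l, Rmult_1_r by lra.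
    pose proof (mean_value_ineq f f1 w (w + h) 0 M1) as K.
    replace (f (w + h) - f w - 0 * (w + h - w))%C with (f (w + h) - f w)%C in K by ring.
    replace (Cmod (w + h - w)) with (Cmod h) in K by (f_equal; ring). apply K.
    intros t Ht. split; [apply Hf|].
    replace (f1 (w + RtoC t * (w + h - w)) - 0)%C with (f1 (w + RtoC t * (w + h - w)))%C by ring.
    apply B1. apply segment_dist; auto; [lra|].
    replace (w + h - z)%C with ((w - z) + h)%C by ring. pose proof (Cmod_triangle (w - z) h). lra. }
  set (M2 := 2 * M1 / r). assert (HM2 : 0 < M2) by (apply Rdiv_lt_0_compat; lra).
  assert (B2 : forall h w, Cmod h <= r -> Cmod (w - z) <= r -> Cmod (f1 (w + h)%C - f1 w) <= M2 * Cmod h).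
  { intros h w Hh Hw. destruct (classic (h = RtoC 0)) as [->|Nh].
    { rewrite Cplus_0_r, Cmod_self_minus, Cmod_0. lra. }
    assert (Ph := proj1 (Cmod_gt_0 h) Nh).
    assert (K : Cmod ((f1 (w + h)%C - f1 w) / h) <= M2).
    { apply (cauchy_estimate (g h) w); eauto. intros v Hv.
      pose proof (Cmod_triangle_via w v z).
      pose proof (Bg h v Nh Hh ltac:(lra)). pose proof (Bg h w Nh Hh ltac:(lra)).
      pose proof (Cmod_triangle_minus (g h v) (g h w)). lra. }
    rewrite Cmod_div in K by auto. apply Rmult_le_compat_r with (r := Cmod h) in K; [|lra].
    unfold Rdiv in K. rewrite Rmult_assoc, Rinv_l, Rmult_1_r in K by lra. auto. }
  assert (B3 : forall h w, h <> RtoC 0 -> Cmod h <= r -> Cmod (w - z) <= r -> Cmod (g h w - f1 w) <= M2 * Cmod h).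
  { intros h w Nh Hh Hw. assert (Ph := proj1 (Cmod_gt_0 h) Nh).
    replace (g h w - f1 w)%C with ((f (w + h) - f w - f1 w * (w + h - w)) / h)%C by (unfold g; field; auto).
    rewrite Cmod_div by auto.
    apply Rmult_le_reg_r with (Cmod h); auto. unfold Rdiv. rewrite Rmult_assoc, Rinv_l, Rmult_1_r by lra.
    replace (Cmod h) with (Cmod (w + h - w)) at 2 by (f_equal; ring).
    apply (mean_value_ineq f f1). intros t Ht. split; [apply Hf|].
    replace (w + RtoC t * (w + h - w))%C with (w + RtoC t * h)%C by ring.
    assert (Cmod (RtoC t * h) <= Cmod h).
    { rewrite Cmod_mult, Cmod_R, Rabs_right by lra. nra. }
    eapply Rle_trans; [apply B2; auto; lra|]. apply Rmult_le_compat_l; lra. }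
  set (q := fun h => ((f1 (z + h) - f1 z) / h)%C).
  set (M3 := 2 * M2 / r). assert (HM3 : 0 < M3) by (apply Rdiv_lt_0_compat; lra).
  (* At [z] the derivative of [g h - g k] is [q h - q k], and by [B3] both [g h] and [g k] are close
     to [f1] near [z]. *)
  assert (B4 : forall h k, h <> RtoC 0 -> k <> RtoC 0 -> Cmod h <= r -> Cmod k <= r ->
    Cmod (q h - q k) <= M3 * (Cmod h + Cmod k)).
  { intros h k Nh Nk Hh Hk.
    replace (M3 * (Cmod h + Cmod k)) with (2 * (M2 * (Cmod h + Cmod k)) / r) by (unfold M3; field; lra).
    apply (cauchy_estimate (fun w => g h w - g k w)%C z); auto.
    - apply cdiff_minus; apply Dg; auto.
    - intros w _. eexists. apply cdiff_minus; apply Dg; auto.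
    - assert (T : forall w, Cmod (w - z) <= r -> Cmod (g h w - g k w) <= M2 * (Cmod h + Cmod k)).
      { intros w Hw. pose proof (Cmod_triangle_via (f1 w) (g h w) (g k w)).
        rewrite (Cmod_minus_sym (f1 w)) in H.
        pose proof (B3 h w Nh Hh Hw). pose proof (B3 k w Nk Hk Hw). lra. }
      intros w Hw. pose proof (T w Hw). pose proof (T z ltac:(rewrite Cmod_self_minus; lra)).
      pose proof (Cmod_triangle_minus (g h w - g k w) (g h z - g k z)). lra. }
  set (hn := fun n : nat => RtoC (r / (INR n + 1))).
  assert (Hhn : forall n, 0 < r / (INR n + 1)).
  { intros n. pose proof (pos_INR n). apply Rdiv_lt_0_compat; lra. }
  assert (Mhn : forall n, Cmod (hn n) = r / (INR n + 1)).
  { intros n. unfold hn. rewrite Cmod_R, Rabs_right; auto. specialize (Hhn n); lra. }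
  assert (Nhn : forall n, hn n <> RtoC 0) by (intros n; apply Cmod_gt_0; rewrite Mhn; auto).
  assert (Lhn : forall n, Cmod (hn n) <= r).
  { intros n. rewrite Mhn. pose proof (pos_INR n). apply Rmult_le_reg_r with (INR n + 1); [lra|].
    unfold Rdiv. rewrite Rmult_assoc, Rinv_l by lra. nra. }
  assert (Shn : forall e, 0 < e -> exists N, forall n, (N <= n)%nat -> Cmod (hn n) < e).
  { intros e He. destruct (INR_unbounded (r / e)) as [N HN]. exists N. intros n Hn. rewrite Mhn.
    apply le_INR in Hn. pose proof (pos_INR n).
    apply Rmult_lt_reg_r with (INR n + 1); [lra|]. unfold Rdiv.
    rewrite Rmult_assoc, Rinv_l, Rmult_1_r by lra.
    apply Rmult_lt_compat_r with (r := e) in HN; auto. unfold Rdiv in HN.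
    rewrite Rmult_assoc, Rinv_l in HN by lra. nra. }
  destruct (C_complete (fun n => q (hn n))) as [l Hl].
  { intros e He. destruct (Shn (e / (2 * M3))) as [N HN]; [apply Rdiv_lt_0_compat; lra|].
    exists N. intros n m Hn Hm. eapply Rle_lt_trans; [apply B4; auto|].
    specialize (HN n Hn) as A1. specialize (HN m Hm) as A2.
    replace e with (M3 * (e / (2 * M3) + e / (2 * M3))) by (field; lra).
    apply Rmult_lt_compat_l; lra. }
  exists l. apply cdiff_intro. intros e He.
  exists (Rmin r (e / M3)). split; [apply Rmin_pos; auto; apply Rdiv_lt_0_compat; lra|].
  intros w Hw.
  assert (W1 := Rlt_le_trans _ _ _ Hw (Rmin_l _ _)). assert (W2 := Rlt_le_trans _ _ _ Hw (Rmin_r _ _)).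
  destruct (classic (w = z)) as [->|Nw].
  { replace (f1 z - f1 z - l * (z - z))%C with (RtoC 0) by ring. rewrite Cmod_self_minus, Cmod_0. lra. }
  set (h := (w - z)%C) in *. assert (Nh : h <> RtoC 0) by (apply Cminus_neq_0; auto).
  assert (Ph := proj1 (Cmod_gt_0 h) Nh).
  replace (f1 w - f1 z - l * h)%C with ((q h - l) * h)%C.
  2:{ unfold q. replace (z + h)%C with w by (unfold h; ring). field. auto. }
  rewrite Cmod_mult. apply Rmult_le_compat_r; [lra|].
  assert (Hq : Cmod (q h - l) <= M3 * Cmod h).
  { apply Rnot_lt_le. intros Hlt. set (gap := Cmod (q h - l) - M3 * Cmod h).
    assert (Hgap : 0 < gap) by (unfold gap; lra).
    destruct (Hl (gap / 2)) as [N1 HN1]; [lra|].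
    destruct (Shn (gap / (2 * M3))) as [N2 HN2]; [apply Rdiv_lt_0_compat; lra|].
    specialize (HN1 (max N1 N2) ltac:(lia)). specialize (HN2 (max N1 N2) ltac:(lia)).
    set (k := hn (max N1 N2)) in *.
    pose proof (B4 h k Nh ltac:(apply Nhn) ltac:(lra) ltac:(apply Lhn)) as K.
    pose proof (Cmod_triangle_via (q k) (q h) l).
    apply Rmult_lt_compat_l with (r := M3) in HN2; [|lra].
    replace (M3 * (gap / (2 * M3))) with (gap / 2) in HN2 by (field; lra). unfold gap in *. lra. }
  eapply Rle_trans; [exact Hq|].
  apply Rmult_lt_compat_l with (r := M3) in W2; [|lra].
  replace (M3 * (e / M3)) with e in W2 by (field; lra). lra.
Qed.

(** * Extraction of subsequences *)

Definition strictly_incr (phi : nat -> nat) : Prop := forall k, (phi k < phi (S k))%nat.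

Lemma strictly_incr_lt (phi : nat -> nat) (n m : nat) :
  strictly_incr phi -> (n < m)%nat -> (phi n < phi m)%nat.
Proof.
  intros H L. induction L; [apply H|]. specialize (H m). lia.
Qed.

Lemma strictly_incr_ge (phi : nat -> nat) (n : nat) : strictly_incr phi -> (n <= phi n)%nat.
Proof. intros H. induction n; [lia|]. specialize (H n). lia. Qed.

Lemma strictly_incr_comp (phi psi : nat -> nat) :
  strictly_incr phi -> strictly_incr psi -> strictly_incr (fun n => phi (psi n)).
Proof. intros H K n. apply strictly_incr_lt; auto. Qed.

Lemma strictly_incr_id : strictly_incr (fun n => n).
Proof. intros n. lia. Qed.

Lemma frequently_subseq (P : nat -> nat -> Prop) :
  (forall n N, exists k, (N <= k)%nat /\ P n k) ->
  exists phi, strictly_incr phi /\ forall n, P n (phi n).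
Proof.
  intros H. destruct (H 0%nat 0%nat) as [k0 [_ Hk0]].
  destruct (dependent_choice (fun n k => P n k) (fun _ k k' => (k < k')%nat) k0 Hk0) as [s [_ Hs]].
  - intros n k _. destruct (H (S n) (S k)) as [k' [L Hk']]. exists k'. split; auto.
  - exists s. split; intros n; apply Hs.
Qed.

Lemma bounded_subseq (u : nat -> R) (M : R) : (forall n, Rabs (u n) <= M) ->
  exists phi l, strictly_incr phi /\ Un_cv (fun n => u (phi n)) l.
Proof.
  intros H.
  destruct (Bolzano_Weierstrass u (fun x => - M <= x <= M)) as [l Hl].
  - apply compact_P3.
  - intros n. apply Rabs_le_between, H.
  - destruct (frequently_subseq (fun n k => Rabs (u k - l) < / (INR n + 1))) as [phi [I Hphi]].
    + intros n N. pose proof (pos_INR n).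
      assert (P : 0 < / (INR n + 1)) by (apply Rinv_0_lt_compat; lra).
      destruct (Hl (disc l (mkposreal _ P)) N) as [k [L Hk]].
      { exists (mkposreal _ P). intros x Hx. exact Hx. }
      exists k. split; auto.
    + exists phi, l. split; auto. intros e He.
      destruct (INR_unbounded (/ e)) as [N HN]. exists N. intros n Hn.
      eapply Rlt_trans; [apply Hphi|]. apply le_INR in Hn. pose proof (Rinv_0_lt_compat e He).
      rewrite <- (Rinv_inv e). apply Rinv_lt_contravar; [nra|lra].
Qed.

Lemma diagonal_subseq (a : nat -> nat -> R) (M : R) : (forall i n, Rabs (a i n) <= M) ->
  exists phi, strictly_incr phi /\ forall i, exists l, Un_cv (fun n => a i (phi n)) l.
Proof.
  intros H.
  destruct (bounded_subseq (a 0%nat) M (H 0%nat)) as [psi0 [l0 [I0 L0]]].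
  destruct (dependent_choice
    (fun n psi => strictly_incr psi /\ exists l, Un_cv (fun k => a n (psi k)) l)
    (fun _ psi psi' => exists theta, strictly_incr theta /\ forall k, psi' k = psi (theta k))
    psi0) as [s [_ Hs]].
  - split; auto. exists l0; auto.
  - intros n psi [I _].
    destruct (bounded_subseq (fun k => a (S n) (psi k)) M) as [th [l [It Lt]]].
    { intros k. apply H. }
    exists (fun k => psi (th k)). split; [split|].
    + apply strictly_incr_comp; auto.
    + exists l. auto.
    + exists th. auto.
  - assert (K : forall i d, exists th, strictly_incr th /\ forall k, s (i + d)%nat k = s i (th k)).
    { intros i d. induction d as [|d [th [It Et]]].
      - exists (fun n => n). split; [apply strictly_incr_id|]. intros. rewrite Nat.add_0_r. auto.
      - rewrite Nat.add_succ_r. destruct (Hs (i + d)%nat) as [_ [th' [It' Et']]].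
        exists (fun k => th (th' k)). split; [apply strictly_incr_comp; auto|].
        intros k. rewrite Et', Et. auto. }
    (* From index [i] on, the diagonal is a subsequence of [s i], so it inherits the convergence of
       row [i]. *)
    exists (fun n => s n n). split.
    + intros n. destruct (Hs n) as [[I _] [th [It Et]]]. rewrite Et.
      apply strictly_incr_lt; auto. pose proof (strictly_incr_ge th (S n) It). lia.
    + intros i. destruct (Hs i) as [[I [l Hl]] _]. exists l.
      intros e He. destruct (Hl e He) as [N HN]. exists (max i N). intros n Hn.
      destruct (K i (n - i)%nat) as [th [It Et]].
      replace (s n n) with (s i (th n)).
      2:{ rewrite <- Et. f_equal. lia. }
      apply HN. pose proof (strictly_incr_ge th n It). lia.
Qed.

Lemma C_bounded_subseq (u : nat -> C) (M : R) : (forall n, Cmod (u n) <= M) ->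
  exists phi l, strictly_incr phi /\
    forall e, 0 < e -> exists N, forall n, (N <= n)%nat -> Cmod (u (phi n) - l) < e.
Proof.
  intros H.
  destruct (diagonal_subseq (fun i n => match i with O => Re (u n) | _ => Im (u n) end) M)
    as [phi [I L]].
  { intros i n. assert (Rabs (Re (u n)) <= M /\ Rabs (Im (u n)) <= M).
    { pose proof (Rmax_Cmod (u n)) as A. pose proof (Rmax_l (Rabs (fst (u n))) (Rabs (snd (u n)))).
      pose proof (Rmax_r (Rabs (fst (u n))) (Rabs (snd (u n)))). specialize (H n).
      unfold Re, Im. lra. }
    destruct i; tauto. }
  destruct (L 0%nat) as [x Hx]. destruct (L 1%nat) as [y Hy].
  exists phi. destruct (C_complete (fun n => u (phi n))) as [l Hl].
  - intros e He. destruct (Hx (e/4)) as [N1 H1]; [lra|]. destruct (Hy (e/4)) as [N2 H2]; [lra|].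
    exists (max N1 N2). intros n m Hn Hm.
    pose proof (H1 n ltac:(lia)) as A1. pose proof (H1 m ltac:(lia)) as A2.
    pose proof (H2 n ltac:(lia)) as A3. pose proof (H2 m ltac:(lia)) as A4.
    unfold Rdist in *. apply Rabs_lt_between in A1, A2, A3, A4.
    replace (u (phi n) - u (phi m))%C with
      (RtoC (Re (u (phi n)) - Re (u (phi m))) + Ci * RtoC (Im (u (phi n)) - Im (u (phi m))))%C.
    2:{ destruct (u (phi n)) as [p q]. destruct (u (phi m)) as [p' q'].
        unfold Ci, RtoC, Cminus, Cplus, Copp, Cmult, Re, Im; cbn [fst snd]. f_equal; ring. }
    eapply Rle_lt_trans; [apply Cmod_triangle|]. rewrite Cmod_mult, Cmod_Ci, !Cmod_R.
    assert (Rabs (Re (u (phi n)) - Re (u (phi m))) < e / 2) by (apply Rabs_lt_between; lra).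
    assert (Rabs (Im (u (phi n)) - Im (u (phi m))) < e / 2) by (apply Rabs_lt_between; lra).
    lra.
  - exists l. auto.
Qed.

Lemma disc_max (F : C -> R) (r : R) : 0 <= r ->
  (forall z, ccont (fun w => RtoC (F w)) z) ->
  exists z0, Cmod z0 <= r /\ forall z, Cmod z <= r -> F z <= F z0.
Proof.
  intros Hr HF.
  assert (HF' : forall z e, 0 < e -> exists d, 0 < d /\
    forall w, Cmod (w - z) < d -> Rabs (F w - F z) < e).
  { intros z e He. destruct (HF z e He) as [d [P Hd]]. exists d. split; auto.
    intros w Hw. specialize (Hd w Hw). rewrite <- RtoC_minus, Cmod_R in Hd. auto. }
  assert (Hb : bound (fun y => exists z, Cmod z <= r /\ y = F z)).
  { apply NNPP. intros N.
    assert (K : forall n : nat, exists z, Cmod z <= r /\ INR n < F z).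
    { intros n. apply NNPP. intros K. apply N. exists (INR n). intros y [z [Hz ->]].
      apply Rnot_lt_le. intros L. apply K. eauto. }
    destruct (choice _ K) as [u Hu].
    destruct (C_bounded_subseq u r) as [phi [l [I L]]]; [apply Hu|].
    destruct (HF' l 1) as [d [P Hd]]; [lra|]. destruct (L d P) as [N0 HN0].
    destruct (INR_unbounded (F l + 1)) as [N1 HN1].
    set (n := max N0 N1). specialize (HN0 n ltac:(lia)). specialize (Hd _ HN0).
    destruct (Hu (phi n)) as [_ Hn]. pose proof (strictly_incr_ge phi n I).
    assert (INR N1 <= INR (phi n)) by (apply le_INR; lia).
    apply Rabs_lt_between in Hd. lra. }
  destruct (completeness _ Hb) as [M [M1 M2]].
  { exists (F 0). exists (RtoC 0). rewrite Cmod_0. auto. }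
  assert (K : forall n : nat, exists z, Cmod z <= r /\ M - / (INR n + 1) < F z).
  { intros n. apply NNPP. intros K. pose proof (pos_INR n).
    assert (0 < / (INR n + 1)) by (apply Rinv_0_lt_compat; lra).
    assert (M <= M - / (INR n + 1)); [|lra].
    apply M2. intros y [z [Hz ->]]. apply Rnot_lt_le. intros L. apply K. eauto. }
  destruct (choice _ K) as [u Hu].
  destruct (C_bounded_subseq u r) as [phi [l [I L]]]; [apply Hu|].
  exists l. split.
  - apply Rnot_lt_le. intros Hlt. destruct (L (Cmod l - r)) as [N HN]; [lra|].
    specialize (HN N (le_n N)). pose proof (Cmod_le_plus_dist l (u (phi N))) as A.
    rewrite Cmod_minus_sym in A. destruct (Hu (phi N)) as [B _]. lra.
  - intros z Hz. apply Rle_trans with M; [apply M1; eauto|].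
    apply Rnot_lt_le. intros Hlt. set (e := (M - F l) / 2). assert (He : 0 < e) by (unfold e; lra).
    destruct (HF' l e He) as [d [P Hd]]. destruct (L d P) as [N0 HN0].
    destruct (INR_unbounded (/ e)) as [N1 HN1].
    set (n := max N0 N1). specialize (HN0 n ltac:(lia)). specialize (Hd _ HN0).
    destruct (Hu (phi n)) as [_ Hn]. pose proof (strictly_incr_ge phi n I).
    assert (INR N1 <= INR (phi n)) by (apply le_INR; lia).
    assert (/ (INR (phi n) + 1) < e).
    { rewrite <- (Rinv_inv e). pose proof (Rinv_0_lt_compat e He).
      apply Rinv_lt_contravar; [nra|lra]. }
    apply Rabs_lt_between in Hd. unfold e in *. lra.
Qed.

(** * Islands over 64 values *)

Definition rcont (F : C -> R) (z : C) : Prop := ccont (fun w => RtoC (F w)) z.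

Lemma rcont_ext (F G : C -> R) (z : C) : (forall w, F w = G w) -> rcont F z -> rcont G z.
Proof.
  intros E H. apply (ccont_ext_near (fun w => RtoC (F w)) _ z 1); [lra| |exact H].
  intros w _. rewrite E. auto.
Qed.

Lemma rcont_const (c : R) (z : C) : rcont (fun _ => c) z.
Proof. exact (ccont_const (RtoC c) z). Qed.

Lemma rcont_plus (F G : C -> R) (z : C) : rcont F z -> rcont G z -> rcont (fun w => F w + G w) z.
Proof.
  intros H K. apply (ccont_ext_near _ _ z 1 Rlt_0_1 (fun w _ => eq_sym (RtoC_plus (F w) (G w)))).
  apply ccont_plus; auto.
Qed.

Lemma rcont_mult (F G : C -> R) (z : C) : rcont F z -> rcont G z -> rcont (fun w => F w * G w) z.
Proof.
  intros H K. apply (ccont_ext_near _ _ z 1 Rlt_0_1 (fun w _ => eq_sym (RtoC_mult (F w) (G w)))).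
  apply ccont_mult; auto.
Qed.

Lemma rcont_minus (F G : C -> R) (z : C) : rcont F z -> rcont G z -> rcont (fun w => F w - G w) z.
Proof.
  intros H K. apply (rcont_ext (fun w => F w + (-1) * G w)); [intros; ring|].
  apply rcont_plus; auto. apply rcont_mult; auto using rcont_const.
Qed.

Lemma rcont_pow (F : C -> R) (z : C) (n : nat) : rcont F z -> rcont (fun w => F w ^ n) z.
Proof.
  intros H. induction n; [apply rcont_const|]. simpl. apply rcont_mult; auto.
Qed.

Lemma rcont_eps (F : C -> R) (z : C) : rcont F z <->
  forall e, 0 < e -> exists d, 0 < d /\ forall w, Cmod (w - z) < d -> Rabs (F w - F z) < e.
Proof.
  split; intros H e He; destruct (H e He) as [d [P Hd]]; exists d; split; auto;
    intros w Hw; specialize (Hd w Hw).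
  - rewrite <- RtoC_minus, Cmod_R in Hd. auto.
  - rewrite <- RtoC_minus, Cmod_R. auto.
Qed.

Lemma rcont_lipschitz (G : C -> C) (F : C -> R) (z : C) : ccont G z ->
  (forall x y, Rabs (F x - F y) <= Cmod (G x - G y)) -> rcont F z.
Proof.
  intros H L. apply rcont_eps. intros e He. destruct (H e He) as [d [P Hd]]. exists d. split; auto.
  intros w Hw. eapply Rle_lt_trans; [apply L|auto].
Qed.

Lemma Cmod_Cmod_diff (x y : C) : Rabs (Cmod x - Cmod y) <= Cmod (x - y).
Proof.
  apply Rabs_le_between. pose proof (Cmod_le_plus_dist x y). pose proof (Cmod_le_plus_dist y x).
  rewrite (Cmod_minus_sym y x) in H0. lra.
Qed.

Lemma rcont_Cmod (f : C -> C) (z : C) : ccont f z -> rcont (fun w => Cmod (f w)) z.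
Proof. intros H. apply (rcont_lipschitz f); auto. intros. apply Cmod_Cmod_diff. Qed.

Lemma rcont_inv (F : C -> R) (z : C) : F z <> 0 -> rcont F z -> rcont (fun w => / F w) z.
Proof.
  intros N H. apply rcont_eps. intros e He.
  assert (N' : RtoC (F z) <> 0) by (intros E; apply N; injection E; auto).
  assert (K := ccont_comp Cinv (fun w => RtoC (F w)) z H (ccont_inv _ N')).
  destruct (K e He) as [d [P Hd]].
  apply rcont_eps with (e := Rabs (F z)) in H; [|apply Rabs_pos_lt; auto].
  destruct H as [d' [P' Hd']].
  exists (Rmin d d'). split; [apply Rmin_pos; auto|]. intros w Hw.
  assert (W1 := Rlt_le_trans _ _ _ Hw (Rmin_l _ _)). assert (W2 := Rlt_le_trans _ _ _ Hw (Rmin_r _ _)).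
  specialize (Hd w W1). specialize (Hd' w W2).
  assert (F w <> 0).
  { intros E. rewrite E in Hd'. replace (0 - F z) with (- F z) in Hd' by ring.
    rewrite Rabs_Ropp in Hd'. lra. }
  rewrite <- !RtoC_inv, <- RtoC_minus, Cmod_R in Hd by auto. auto.
Qed.

(** Truncation keeps the denominator of the weight positive at the values themselves. Where [f] is
    farther than [tau] from all of them, the product of the truncated distances is the modulus of a
    holomorphic function. *)
Definition trunc_dist (tau : R) (w a : C) : R := Rmax (Cmod (w - a)) tau.

Lemma rcont_trunc_dist (tau : R) (f : C -> C) (a z : C) :
  ccont f z -> rcont (fun w => trunc_dist tau (f w) a) z.
Proof.
  intros H. apply (rcont_lipschitz f); auto. intros x y.
  assert (K : Rabs (Cmod (f x - a) - Cmod (f y - a)) <= Cmod (f x - f y)).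
  { eapply Rle_trans; [apply Cmod_Cmod_diff|]. right. f_equal. ring. }
  apply Rabs_le_between in K. unfold trunc_dist, Rmax.
  repeat destruct (Rle_dec _ _); apply Rabs_le_between; lra.
Qed.

Definition lprod (g : C -> R) (l : list C) : R := fold_right (fun a acc => g a * acc) 1 l.

Lemma lprod_app (g : C -> R) (l1 l2 : list C) : lprod g (l1 ++ l2) = lprod g l1 * lprod g l2.
Proof. induction l1; simpl; [ring|]. rewrite IHl1. ring. Qed.

Lemma lprod_const (c : R) (l : list C) : lprod (fun _ => c) l = c ^ length l.
Proof. induction l; simpl; auto. rewrite IHl. auto. Qed.

Lemma lprod_pos (g : C -> R) (l : list C) : (forall a, In a l -> 0 < g a) -> 0 < lprod g l.
Proof.
  induction l; simpl; intros H; [lra|]. apply Rmult_lt_0_compat; [apply H; auto|apply IHl; auto].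
Qed.

Lemma lprod_le (g h : C -> R) (k : R) (l : list C) : 0 <= k ->
  (forall a, In a l -> 0 <= g a <= k * h a) -> 0 <= lprod g l <= k ^ length l * lprod h l.
Proof.
  intros Hk. induction l; simpl; intros H; [lra|].
  destruct (H a) as [H1 H2]; auto. destruct IHl as [I1 I2]; auto.
  split; [apply Rmult_le_pos; auto|].
  replace (k * k ^ length l * (h a * lprod h l)) with ((k * h a) * (k ^ length l * lprod h l)) by ring.
  apply Rmult_le_compat; auto.
Qed.

Lemma lprod_ext (g h : C -> R) (l : list C) : (forall a, In a l -> g a = h a) -> lprod g l = lprod h l.
Proof. induction l; simpl; intros H; auto. rewrite H, IHl; auto. Qed.

Lemma rcont_lprod (g : C -> C -> R) (l : list C) (z : C) :
  (forall a, rcont (fun w => g w a) z) -> rcont (fun w => lprod (g w) l) z.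
Proof. intros H. induction l; simpl; [apply rcont_const|]. apply rcont_mult; auto. Qed.

Lemma pow_le_inv (x y : R) (n : nat) : n <> O -> 0 <= x -> 0 <= y -> x ^ n <= y ^ n -> x <= y.
Proof.
  intros Hn Hx Hy H. apply Rnot_lt_le. intros L.
  assert (K : forall m, y ^ S m < x ^ S m).
  { induction m; [simpl; lra|]. change (y * y ^ S m < x * x ^ S m).
    assert (0 <= y ^ S m) by (apply pow_le; auto). nra. }
  destruct n; [congruence|]. specialize (K n). lra.
Qed.

(** * Maximum of the weight far from the values *)

Definition near (z : C) (P : C -> Prop) : Prop :=
  exists r, 0 < r /\ forall w, Cmod (w - z) < r -> P w.

Lemma near_and (z : C) (P Q : C -> Prop) : near z P -> near z Q -> near z (fun w => P w /\ Q w).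
Proof.
  intros [r [Pr Hr]] [s [Ps Hs]]. exists (Rmin r s). split; [apply Rmin_pos; auto|].
  intros w Hw. split; [apply Hr|apply Hs]; eapply Rlt_le_trans; eauto; [apply Rmin_l|apply Rmin_r].
Qed.

Lemma near_all_list {T : Type} (l : list T) (z : C) (P : T -> C -> Prop) :
  (forall a, In a l -> near z (P a)) -> near z (fun w => forall a, In a l -> P a w).
Proof.
  induction l as [|b l IH]; intros H.
  - exists 1. split; [lra|]. intros w _ a [].
  - destruct (near_and z _ _ (H b (or_introl eq_refl)) (IH (fun a Ha => H a (or_intror Ha)))) as [r [P1 Hr]].
    exists r. split; auto.
    intros w Hw a Ha. destruct (Hr w Hw) as [K1 K2]. destruct Ha as [<-|Ha]; auto.
Qed.

Lemma rcont_near_lt (F : C -> R) (z : C) (c : R) : rcont F z -> c < F z -> near z (fun w => c < F w).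
Proof.
  intros H L. apply rcont_eps with (e := F z - c) in H; [|lra].
  destruct H as [d [P Hd]]. exists d. split; auto. intros w Hw. specialize (Hd w Hw).
  apply Rabs_lt_between in Hd. lra.
Qed.

(** Polarisation of [r ^ 2 - |z| ^ 2]: up to a correction of second order at [z0], the product
    becomes the squared modulus of a function holomorphic in [z]. *)
Lemma disc_identity (r : R) (z z0 : C) :
  (r ^ 2 - Cmod z ^ 2) * (r ^ 2 - Cmod z0 ^ 2)
   = Cmod (RtoC (r ^ 2) - Cconj z0 * z) ^ 2 - r ^ 2 * Cmod (z - z0) ^ 2.
Proof.
  rewrite !Cmod2_alt. destruct z as [a b], z0 as [c d].
  unfold Re, Im, RtoC, Cconj, Cminus, Cplus, Copp, Cmult; cbn [fst snd]. ring.
Qed.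

(** The analogue for the spherical metric, with the correction of the opposite sign. Which of the
    two corrections prevails decides the estimate far from the values. *)
Lemma sphere_identity (w w0 : C) :
  (1 + Cmod w ^ 2) * (1 + Cmod w0 ^ 2) = Cmod (1 + Cconj w0 * w) ^ 2 + Cmod (w - w0) ^ 2.
Proof.
  rewrite !Cmod2_alt. destruct w as [a b], w0 as [c d].
  unfold Re, Im, RtoC, Cconj, Cminus, Cplus, Copp, Cmult; cbn [fst snd]. ring.
Qed.

Fixpoint cprod (f : C -> C) (l : list C) (z : C) : C :=
  match l with nil => RtoC 1 | a :: l' => ((f z - a) * cprod f l' z)%C end.

Lemma cdiff_cprod (f : C -> C) (l : list C) (z : C) :
  (exists d, cdiff f z d) -> exists d, cdiff (cprod f l) z d.
Proof.
  intros [d Hd]. induction l as [|a l [e He]]; [eexists; apply cdiff_const|].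
  eexists. apply (cdiff_mult (fun z => f z - a)%C (cprod f l)); [|exact He].
  apply cdiff_minus; [exact Hd|apply cdiff_const].
Qed.

Lemma Cmod_cprod (f : C -> C) (l : list C) (z : C) :
  Cmod (cprod f l z) = lprod (fun a => Cmod (f z - a)) l.
Proof. induction l; simpl; [apply Cmod_1|]. rewrite Cmod_mult, IHl. auto. Qed.

(** The weight whose maximum over a disc is studied. With 64 = 4 * 16 values, it is
    comparable with [((r^2 - |z|^2) * |f'| / (1 + |f|^2)) ^ 16]. *)
Definition weight (f f1 : C -> C) (r tau : R) (l : list C) (z : C) : R :=
  ((r ^ 2 - Cmod z ^ 2) * Cmod (f1 z) * (1 + Cmod (f z) ^ 2)) ^ 16
    * / lprod (trunc_dist tau (f z)) l.

Lemma trunc_dist_pos (tau : R) (w a : C) : 0 < tau -> 0 < trunc_dist tau w a.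
Proof. intros H. eapply Rlt_le_trans; [exact H|apply Rmax_r]. Qed.

Lemma rcont_weight (f f1 : C -> C) (r tau : R) (l : list C) (z : C) : 0 < tau ->
  ccont f z -> ccont f1 z -> rcont (weight f f1 r tau l) z.
Proof.
  intros Ht Hf H1. apply rcont_mult.
  - apply rcont_pow. apply rcont_mult; [apply rcont_mult|].
    + apply rcont_minus; [apply rcont_const|]. apply rcont_pow. apply (rcont_Cmod (fun w => w)). apply ccont_id.
    + apply rcont_Cmod; auto.
    + apply rcont_plus; [apply rcont_const|]. apply rcont_pow. apply rcont_Cmod; auto.
  - apply rcont_inv.
    + pose proof (lprod_pos (trunc_dist tau (f z)) l (fun a _ => trunc_dist_pos tau _ a Ht)). lra.
    + apply rcont_lprod. intros a. apply rcont_trunc_dist; auto.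
Qed.

Lemma cdiff_near_expand (f : C -> C) (z d : C) (k : R) : cdiff f z d -> k < Cmod d ->
  near z (fun w => k * Cmod (w - z) <= Cmod (f w - f z)).
Proof.
  intros H L. destruct (cdiff_quotient f z d H (Cmod d - k)) as [r [P Hr]]; [lra|].
  exists r. split; auto. intros w Hw. specialize (Hr w Hw).
  pose proof (Cmod_le_plus_dist (d * (w - z)) (f w - f z)) as K.
  rewrite Cmod_mult, (Cmod_minus_sym (d * (w - z))%C) in K.
  replace (f w - f z - d * (w - z))%C with (f w - f z - (d * (w - z)))%C in Hr by ring. nra.
Qed.

(** Away from the values in [l], the weight is the product of the modulus of a holomorphic
    function with a power of [(r^2 - |z|^2)(1 + |f|^2)], which is strictly subharmonic in the
    logarithm where the conclusion fails. *)
Lemma weight_max_far (f f1 : C -> C) (r tau : R) (l : list C) (z0 : C) :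
  0 < r -> 0 < tau -> (forall w, cdiff f w (f1 w)) -> Cmod z0 < r ->
  (forall z, Cmod z <= r -> weight f f1 r tau l z <= weight f f1 r tau l z0) ->
  (forall a, In a l -> tau < Cmod (f z0 - a)) ->
  Cmod (f1 z0) * (r ^ 2 - Cmod z0 ^ 2) <= r * (1 + Cmod (f z0) ^ 2).
Proof.
  intros Hr Ht Hf Hz0 Hmax Hfar. apply Rnot_lt_le. intros Hlt.
  set (A := Cmod (f1 z0)) in *. set (D := r ^ 2 - Cmod z0 ^ 2) in *.
  set (w0 := f z0) in *. set (q := 1 + Cmod w0 ^ 2) in *.
  assert (HD : 0 < D) by (unfold D; pose proof (Cmod_ge_0 z0); nra).
  assert (Hq : 1 <= q) by (unfold q; pose proof (pow2_ge_0 (Cmod w0)); lra).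
  (* Strictly between [r * q / D] and [A]: exceeding the former makes [T z0] below positive, staying
     under the latter gives [|f z - w0| >= A' * |z - z0|] near [z0]. *)
  set (A' := (A + r * q / D) / 2).
  assert (HA0 : r * q / D < A).
  { apply Rmult_lt_reg_r with D; auto. unfold Rdiv. rewrite Rmult_assoc, Rinv_l by lra. lra. }
  assert (HA' : A' < A) by (unfold A'; lra).
  assert (HA'D : r * q < A' * D).
  { assert (r * q / D < A') by (unfold A'; lra). apply Rmult_lt_compat_r with (r := D) in H; auto.
    unfold Rdiv in H. rewrite Rmult_assoc, Rinv_l in H by lra. lra. }
  assert (PA' : 0 < A') by nra.
  set (al := fun z => Cmod (RtoC (r ^ 2) - Cconj z0 * z) ^ 2).
  set (be := fun z => Cmod (1 + Cconj w0 * f z) ^ 2).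
  set (y := fun z => Cmod (f z - w0) ^ 2).
  set (kap := A' ^ 2 / r ^ 2).
  assert (Cf : forall z, ccont f z) by (intros z; eapply cdiff_ccont; apply Hf).
  assert (Cal : rcont al z0).
  { apply rcont_pow, rcont_Cmod. apply ccont_minus; [apply ccont_const|].
    apply ccont_mult; [apply ccont_const|apply ccont_id]. }
  assert (Cbe : rcont be z0).
  { apply rcont_pow, rcont_Cmod. apply ccont_plus; [apply ccont_const|].
    apply ccont_mult; [apply ccont_const|apply Cf]. }
  assert (Cy : rcont y z0).
  { apply rcont_pow, rcont_Cmod. apply ccont_minus; [apply Cf|apply ccont_const]. }
  assert (Eal : al z0 = D ^ 2).
  { pose proof (disc_identity r z0 z0) as E. rewrite Cmod_self_minus in E. unfold al.
    fold D in E. rewrite <- (Rminus_0_r (_ ^ 2)). rewrite <- (Rmult_0_r (r ^ 2)).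
    replace 0 with (0 ^ 2) at 1 by ring. rewrite <- E. ring. }
  assert (Ebe : be z0 = q ^ 2).
  { pose proof (sphere_identity w0 w0) as E. rewrite Cmod_self_minus in E. unfold be. fold w0.
    fold q in E. nra. }
  assert (Ey : y z0 = 0).
  { unfold y. fold w0. rewrite Cmod_self_minus. ring. }
  (* On the circle of radius [rho] put [x = r ^ 2 * rho ^ 2]. There [y >= kap * x], so the polarised
     product [(al - x) * (be + y)] is at least [al * be + x * T]. *)
  set (T := fun z => kap * al z - be z - y z).
  assert (HT : 0 < T z0).
  { unfold T. rewrite Eal, Ebe, Ey. unfold kap.
    assert (q ^ 2 < A' ^ 2 / r ^ 2 * D ^ 2); [|lra].
    apply Rmult_lt_reg_l with (r ^ 2); [apply pow_lt; auto|].
    replace (r ^ 2 * (A' ^ 2 / r ^ 2 * D ^ 2)) with ((A' * D) ^ 2) by (field; lra).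
    replace (r ^ 2 * q ^ 2) with ((r * q) ^ 2) by ring.
    assert (0 < r * q) by nra. nra. }
  set (Mb := al z0 * be z0 + 1).
  assert (N1 : near z0 (fun z => T z0 / 2 < T z)).
  { apply rcont_near_lt; [|lra]. apply rcont_minus; auto. apply rcont_minus; auto.
    apply rcont_mult; auto using rcont_const. }
  assert (N2 : near z0 (fun z => - Mb < - 1 * (al z * be z))).
  { apply (rcont_near_lt (fun z => -1 * (al z * be z))).
    - apply rcont_mult; [apply rcont_const|apply (rcont_mult al be); auto].
    - unfold Mb. lra. }
  assert (N3 : near z0 (fun z => forall a, In a l -> tau < Cmod (f z - a))).
  { apply (near_all_list l z0 (fun a z => tau < Cmod (f z - a))). intros a Ha.
    apply (rcont_near_lt (fun z => Cmod (f z - a))); [|apply Hfar; auto].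
    apply rcont_Cmod. apply ccont_minus; [apply Cf|apply ccont_const]. }
  assert (N4 := cdiff_near_expand f z0 (f1 z0) A' (Hf z0) HA').
  destruct (near_and _ _ _ N1 (near_and _ _ _ N2 (near_and _ _ _ N3 N4))) as [p [Pp Hp]].
  set (rho := Rmin (p / 2) (r - Cmod z0)).
  assert (Prho : 0 < rho) by (apply Rmin_pos; lra).
  assert (Hrho1 : rho < p) by (eapply Rle_lt_trans; [apply Rmin_l|lra]).
  assert (Hrho2 : rho <= r - Cmod z0) by apply Rmin_r.
  (* The numerator of the weight before the 16th power, multiplied by the constant [D * q] and
     stripped of the two corrections, is the modulus of this holomorphic function. *)
  set (h := fun z => ((RtoC (r ^ 2) - Cconj z0 * z) * (RtoC (r ^ 2) - Cconj z0 * z)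
      * (f1 z * ((1 + Cconj w0 * f z) * (1 + Cconj w0 * f z))))%C).
  set (H := fun z => ((h z) ^ 16 * / cprod f l z)%C).
  assert (Mh : forall z, Cmod (h z) = Cmod (f1 z) * (al z * be z)).
  { intros z. unfold h, al, be. rewrite !Cmod_mult. ring. }
  assert (Pl : forall z, Cmod (z - z0) <= rho -> 0 < lprod (trunc_dist tau (f z)) l).
  { intros z _. apply lprod_pos. intros. apply trunc_dist_pos; auto. }
  assert (El : forall z, Cmod (z - z0) <= rho -> Cmod (cprod f l z) = lprod (trunc_dist tau (f z)) l).
  { intros z Hz. rewrite Cmod_cprod. apply lprod_ext. intros a Ha.
    destruct (Hp z ltac:(lra)) as [_ [_ [K _]]]. specialize (K a Ha).
    unfold trunc_dist. rewrite Rmax_left; lra. }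
  assert (Nl : forall z, Cmod (z - z0) <= rho -> cprod f l z <> RtoC 0).
  { intros z Hz. apply Cmod_gt_0. rewrite El; auto. }
  assert (MH : forall z, Cmod (z - z0) <= rho ->
     Cmod (H z) = (Cmod (f1 z) * (al z * be z)) ^ 16 * / lprod (trunc_dist tau (f z)) l).
  { intros z Hz. unfold H. rewrite Cmod_mult, Cmod_pow, Cmod_inv, Mh, El; auto. }
  assert (Hz0' : Cmod (z0 - z0) <= rho) by (rewrite Cmod_self_minus; lra).
  assert (MH0 : Cmod (H z0) = (D * q) ^ 16 * weight f f1 r tau l z0).
  { rewrite MH, Eal, Ebe by auto. unfold weight. fold w0 A D q. ring. }
  assert (PA : 0 < A) by lra.
  assert (PH0 : 0 < Cmod (H z0)).
  { rewrite MH, Eal, Ebe by auto. apply Rmult_lt_0_compat.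
    - apply pow_lt. apply Rmult_lt_0_compat; auto. apply Rmult_lt_0_compat; apply pow_lt; lra.
    - apply Rinv_0_lt_compat; auto. }
  (* Since [al * be <= Mb] near [z0], the additive gain of at least [x * T z0 / 2] amounts to a
     factor of at least [1 + e]. *)
  set (e := T z0 / 2 * (r ^ 2 * rho ^ 2) / Mb).
  assert (PMb : 1 <= Mb).
  { unfold Mb. rewrite Eal, Ebe. pose proof (pow2_ge_0 D). pose proof (pow2_ge_0 q). nra. }
  assert (Pr2 : 0 < r ^ 2) by (apply pow_lt; auto).
  assert (Prho2 : 0 < rho ^ 2) by (apply pow_lt; auto).
  assert (Pe : 0 < e).
  { unfold e. apply Rdiv_lt_0_compat; [|lra]. apply Rmult_lt_0_compat; nra. }
  assert (DH : forall z, Cmod (z - z0) <= rho -> exists d, cdiff H z d).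
  { intros z Hz.
    assert (Dh : exists d, cdiff h z d).
    { destruct (cdiff_derivative f f1 z Hf) as [d2 Hd2]. eexists.
      apply cdiff_mult; [|apply cdiff_mult; [exact Hd2|]].
      - apply cdiff_mult; (apply cdiff_minus; [apply cdiff_const|apply cdiff_mult;[apply cdiff_const|apply cdiff_id]]).
      - apply cdiff_mult; (apply cdiff_plus; [apply cdiff_const|apply cdiff_mult;[apply cdiff_const|apply Hf]]). }
    destruct (cdiff_pow h z 16 Dh) as [d Hd].
    destruct (cdiff_cprod f l z (ex_intro _ _ (Hf z))) as [d' Hd'].
    eexists. apply (cdiff_mult (fun z => h z ^ 16)%C (fun z => / cprod f l z)%C); [exact Hd|].
    exact (cdiff_comp Cinv (cprod f l) z _ _ Hd' (cdiff_inv _ (Nl z Hz))). }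
  (* On the circle [(D * q) ^ 16] times the weight is at least [1 + e] times [|H|], while at [z0]
     the two agree. As the weight is maximal at [z0], [|H|] is smaller on the circle than at its
     centre, against the maximum principle. *)
  assert (Hle : Cmod (H z0) <= Cmod (H z0) / (1 + e)).
  { apply (maximum_principle H z0 rho); auto.
    - destruct (DH z0 Hz0') as [d Hd]. eapply cdiff_ccont. exact Hd.
    - intros z [_ Hz]. auto.
    - intros z Hz. destruct (Hp z ltac:(lra)) as [K1 [K2 [K3 K4]]].
      assert (Hzr : Cmod z <= r).
      { pose proof (Cmod_le_plus_dist z z0). lra. }
      specialize (Hmax z Hzr).
      set (N := (r ^ 2 - Cmod z ^ 2) * Cmod (f1 z) * (1 + Cmod (f z) ^ 2)).
      assert (HN : Cmod (f1 z) * (al z * be z) * (1 + e) <= N * (D * q)).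
      { replace (N * (D * q)) with (Cmod (f1 z) * ((r ^ 2 - Cmod z ^ 2) * D * ((1 + Cmod (f z) ^ 2) * q)))
          by (unfold N; ring).
        rewrite Rmult_assoc. apply Rmult_le_compat_l; [apply Cmod_ge_0|].
        unfold D at 1, q. rewrite disc_identity, sphere_identity. fold (al z) (be z) (y z). rewrite Hz.
        assert (Hy : kap * (r ^ 2 * rho ^ 2) <= y z).
        { unfold kap, y. fold w0 in K4. replace (A' ^ 2 / r ^ 2 * (r ^ 2 * rho ^ 2)) with ((A' * rho) ^ 2) by (field; lra).
          rewrite Hz in K4. apply pow_incr. split; [nra|exact K4]. }
        assert (Hee : al z * be z * e <= T z0 / 2 * (r ^ 2 * rho ^ 2)).
        { apply Rle_trans with (Mb * e).
          - apply Rmult_le_compat_r; lra.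
          - right. unfold e. field. lra. }
        set (x := r ^ 2 * rho ^ 2) in *. assert (Px : 0 < x) by (unfold x; nra).
        assert (Hal : 0 <= al z) by (unfold al; apply pow2_ge_0).
        assert (al z * (kap * x) <= al z * y z) by (apply Rmult_le_compat_l; auto).
        assert (T z0 / 2 * x <= T z * x) by (apply Rmult_le_compat_r; lra).
        unfold T in H1 at 2. nra. }
      rewrite MH by lra.
      assert (PN : 0 <= Cmod (f1 z) * (al z * be z)).
      { apply Rmult_le_pos; [apply Cmod_ge_0|]. apply Rmult_le_pos; apply pow2_ge_0. }
      apply Rmult_le_reg_r with (1 + e); [lra|].
      unfold Rdiv. rewrite (Rmult_assoc (Cmod (H z0))), Rinv_l, Rmult_1_r by lra.
      assert (HH : (Cmod (f1 z) * (al z * be z)) ^ 16 * (1 + e) <= (N * (D * q)) ^ 16).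
      { apply Rle_trans with ((Cmod (f1 z) * (al z * be z) * (1 + e)) ^ 16).
        - rewrite (Rpow_mult_distr (Cmod (f1 z) * (al z * be z))). apply Rmult_le_compat_l; [apply pow_le; auto|].
          rewrite <- (pow_1 (1 + e)) at 1. apply Rle_pow; [lra|lia].
        - apply pow_incr. split; [|exact HN]. apply Rmult_le_pos; lra. }
      rewrite MH0.
      apply Rle_trans with ((D * q) ^ 16 * weight f f1 r tau l z).
      + unfold weight. fold N. rewrite (Rpow_mult_distr N) in HH.
        assert (PI' : 0 < / lprod (trunc_dist tau (f z)) l) by (apply Rinv_0_lt_compat, Pl; lra).
        set (i := / lprod (trunc_dist tau (f z)) l) in *.
        apply Rmult_le_compat_r with (r := i) in HH; [|lra]. nra.
      + apply Rmult_le_compat_l; auto. apply pow_le. nra. }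
  apply Rmult_le_compat_r with (r := 1 + e) in Hle; [|lra].
  unfold Rdiv in Hle. rewrite Rmult_assoc, Rinv_l, Rmult_1_r in Hle by lra. nra.
Qed.

(** [f] is nearly affine with slope [c] on a disc inside [D(z0, r)], so that it covers
    [D(a, eta)] univalently from there. *)
Definition island (f : C -> C) (z0 : C) (r : R) (a : C) (eta : R) : Prop :=
  exists p s c, 0 < s /\ c <> RtoC 0 /\ Cmod (p - z0) + s <= r /\
    Cmod (f p - a) + eta <= Cmod c * s / 2 /\
    forall x y, Cmod (x - p) <= s -> Cmod (y - p) <= s ->
      Cmod (f x - f y - c * (x - y)) <= Cmod c * Cmod (x - y) / 2.

(** * Maximum of the weight near one of the values *)

(** A connectedness argument, run through the supremum of the times up to which the strict bound
    holds. It resolves a circularity: [f1] is bounded where [f] has moved little, and [f] moves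
    little where [f1] is bounded. *)
Lemma bootstrap (g : R -> R) (b : R) :
  (forall t e, 0 <= t <= 1 -> 0 < e -> exists d, 0 < d /\
     forall t', 0 <= t' <= 1 -> Rabs (t' - t) < d -> Rabs (g t' - g t) < e) ->
  g 0 < b ->
  (forall t, 0 <= t <= 1 -> (forall t', 0 <= t' <= t -> g t' <= b) -> g t < b) ->
  forall t, 0 <= t <= 1 -> g t < b.
Proof.
  intros Hc H0 Hb t Ht. apply Rnot_le_lt. intros L.
  set (E := fun s => 0 <= s <= 1 /\ forall t', 0 <= t' <= s -> g t' < b).
  destruct (completeness E) as [s [Hs1 Hs2]].
  - exists 1. intros x [Hx _]. lra.
  - exists 0. split; [lra|]. intros t' Ht'. replace t' with 0 by lra. auto.
  - assert (E0 : E 0). { split; [lra|]. intros t' Ht'. replace t' with 0 by lra. auto. }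
    assert (s0 : 0 <= s) by (apply Hs1; auto).
    assert (s1 : s <= 1) by (apply Hs2; intros x [Hx _]; lra).
    assert (K : forall t', 0 <= t' < s -> g t' < b).
    { intros t' Ht'. apply NNPP. intros N. assert (s <= t'); [|lra].
      apply Hs2. intros x [Hx1 Hx2]. apply Rnot_lt_le. intros Lx. apply N. apply Hx2. lra. }
    assert (Hs : g s < b).
    { apply Hb; [lra|]. intros t' Ht'. destruct (Req_dec t' s) as [->|Ns]; [|left; apply K; lra].
      apply Rnot_lt_le. intros Lb.
      assert (Ps : 0 < s). { destruct s0 as [|<-]; auto. lra. }
      destruct (Hc s (g s - b)) as [d [Pd Hd]]; [lra|lra|].
      set (t2 := Rmax 0 (s - d / 2)).
      assert (T1 : 0 <= t2) by apply Rmax_l. assert (T2 : t2 < s) by (apply Rmax_lub_lt; lra).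
      assert (T3 : s - d / 2 <= t2) by apply Rmax_r.
      specialize (Hd t2 ltac:(lra) ltac:(apply Rabs_lt_between; lra)).
      specialize (K t2 ltac:(lra)). apply Rabs_lt_between in Hd. lra. }
    assert (Kt : s < t).
    { apply Rnot_le_lt. intros Lt. destruct (Req_dec t s) as [->|N]; [lra|].
      specialize (K t ltac:(lra)). lra. }
    destruct (Hc s (b - g s)) as [d [Pd Hd]]; [lra|lra|].
    set (s2 := Rmin 1 (s + d / 2)).
    assert (S1 : s2 <= 1) by apply Rmin_l. assert (S2 : s2 <= s + d / 2) by apply Rmin_r.
    assert (S3 : s < s2) by (apply Rmin_glb_lt; lra).
    assert (s2 <= s); [|lra]. apply Hs1. split; [lra|]. intros t' Ht'.
    destruct (Rlt_le_dec t' s) as [Lt|Lt]; [apply K; lra|].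
    specialize (Hd t' ltac:(lra) ltac:(apply Rabs_lt_between; lra)).
    apply Rabs_lt_between in Hd. lra.
Qed.

(** The truncated distance to [a] grows at most by [2 ^ 16] and the 63 others by [5 / 4] each,
    together by at most [2 ^ 48 = 8 ^ 16]. The 16th root costs a factor 8, and the factors
    [r ^ 2 - |z| ^ 2] and [1 + |f z| ^ 2] cost 2 each, hence 32. *)
Lemma weight_bound_near (f f1 : C -> C) (r tau d : R) (l : list C) (a z0 z : C) :
  0 < r -> 0 < tau -> tau * 65536 <= d / 16 -> d <= 1 -> length l = 64%nat -> NoDup l -> In a l ->
  (forall x y, In x l -> In y l -> x <> y -> d <= Cmod (x - y)) ->
  Cmod z0 < r ->
  weight f f1 r tau l z <= weight f f1 r tau l z0 ->
  Cmod (f z0 - a) <= tau ->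
  Cmod (z - z0) <= (r - Cmod z0) / 4 ->
  Cmod (f z - f z0) <= 65535 * tau ->
  Cmod (f1 z) <= 32 * Cmod (f1 z0).
Proof.
  intros Hr Ht Hd Hd1 Hl Hnd Ha Hsep Hz0 Hmax Hta Hz Hfz.
  set (w := f z) in *. set (w0 := f z0) in *.
  assert (Pz0 := Cmod_ge_0 z0). assert (Pz := Cmod_ge_0 z).
  set (D := r ^ 2 - Cmod z0 ^ 2).
  assert (HD : 0 < D) by (unfold D; nra).
  assert (HDz : D / 2 <= r ^ 2 - Cmod z ^ 2).
  { pose proof (Cmod_le_plus_dist z z0). set (u := Cmod z) in *. set (u0 := Cmod z0) in *.
    unfold D. set (v := u0 + (r - u0) / 4) in *.
    assert (u ^ 2 <= v ^ 2) by (apply pow_incr; unfold v; lra).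
    unfold v in *. nra. }
  assert (Hq : 1 + Cmod w0 ^ 2 <= 2 * (1 + Cmod w ^ 2)).
  { pose proof (Cmod_le_plus_dist w0 w). rewrite Cmod_minus_sym in Hfz.
    pose proof (Cmod_ge_0 w0). pose proof (Cmod_ge_0 w). pose proof (Cmod_ge_0 (w0 - w)).
    assert (Cmod (w0 - w) <= 1/16) by lra.
    assert (Cmod w0 ^ 2 <= (Cmod w + 1/16) ^ 2) by (apply pow_incr; lra).
    pose proof (pow2_ge_0 (Cmod w - 1)). nra. }
  destruct (in_split a l Ha) as [l1 [l2 El]].
  assert (Hlp : lprod (trunc_dist tau w) l <= 2 ^ 48 * lprod (trunc_dist tau w0) l).
  { assert (Hother : forall b, In b l -> b <> a -> 0 <= trunc_dist tau w b <= 5 / 4 * trunc_dist tau w0 b).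
    { intros b Hb Nb. specialize (Hsep b a Hb Ha Nb).
      pose proof (Cmod_triangle_via w0 b a). rewrite (Cmod_minus_sym b w0) in H.
      pose proof (Cmod_triangle_via w0 w b).
      unfold trunc_dist. split; [eapply Rle_trans; [|apply Rmax_r]; lra|].
      pose proof (Rmax_l (Cmod (w0 - b)) tau). pose proof (Rmax_r (Cmod (w0 - b)) tau).
      apply Rmax_lub; lra. }
    assert (Haa : 0 <= trunc_dist tau w a <= 2 ^ 16 * trunc_dist tau w0 a).
    { unfold trunc_dist. split; [eapply Rle_trans; [|apply Rmax_r]; lra|].
      pose proof (Cmod_triangle_via w0 w a).
      pose proof (Rmax_r (Cmod (w0 - a)) tau).
      replace (2 ^ 16) with 65536 by ring. apply Rmax_lub; lra. }
    assert (Na : forall b, In b (l1 ++ l2) -> b <> a).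
    { intros b Hb ->. rewrite El in Hnd. apply NoDup_remove_2 in Hnd. auto. }
    assert (Hin : forall b, In b (l1 ++ l2) -> In b l).
    { intros b Hb. rewrite El. apply in_or_app. apply in_app_or in Hb. simpl. tauto. }
    destruct (lprod_le (trunc_dist tau w) (trunc_dist tau w0) (5/4) (l1 ++ l2)) as [L1 L2]; [lra| |].
    { intros b Hb. apply Hother; auto. }
    assert (Len : length (l1 ++ l2) = 63%nat).
    { rewrite El, length_app in Hl. simpl in Hl. rewrite length_app. lia. }
    rewrite Len in L2.
    assert (Sp : forall g, lprod g l = g a * lprod g (l1 ++ l2)).
    { intros g. rewrite El, !lprod_app. simpl. ring. }
    rewrite !Sp.
    assert (P63 : (5 / 4) ^ 63 <= 2 ^ 32).
    { apply Rle_trans with (((5/4) ^ 2) ^ 32).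
      - rewrite <- pow_mult. apply Rle_pow; [lra|lia].
      - apply pow_incr. lra. }
    set (X := lprod (trunc_dist tau w) (l1 ++ l2)) in *.
    set (Y := lprod (trunc_dist tau w0) (l1 ++ l2)) in *.
    assert (PY : 0 < Y) by (apply lprod_pos; intros; apply trunc_dist_pos; auto).
    assert (X <= 2 ^ 32 * Y).
    { eapply Rle_trans; [exact L2|]. apply Rmult_le_compat_r; lra. }
    replace (2 ^ 48 * (trunc_dist tau w0 a * Y)) with ((2 ^ 16 * trunc_dist tau w0 a) * (2 ^ 32 * Y)) by ring.
    apply Rmult_le_compat; lra. }
  unfold weight in Hmax. fold w w0 D in Hmax.
  set (P := lprod (trunc_dist tau w) l) in *. set (P0 := lprod (trunc_dist tau w0) l) in *.
  assert (PP : 0 < P) by (apply lprod_pos; intros; apply trunc_dist_pos; auto).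
  assert (PP0 : 0 < P0) by (apply lprod_pos; intros; apply trunc_dist_pos; auto).
  set (q := 1 + Cmod w ^ 2) in *. set (q0 := 1 + Cmod w0 ^ 2) in *.
  assert (Pq : 1 <= q) by (unfold q; pose proof (pow2_ge_0 (Cmod w)); lra).
  assert (Pq0 : 1 <= q0) by (unfold q0; pose proof (pow2_ge_0 (Cmod w0)); lra).
  pose proof (Cmod_ge_0 (f1 z)) as PB. pose proof (Cmod_ge_0 (f1 z0)) as PA.
  set (B := Cmod (f1 z)) in *. set (A := Cmod (f1 z0)) in *.
  assert (K : (D * q0 * (B / 4)) ^ 16 <= (D * q0 * (8 * A)) ^ 16).
  { apply Rle_trans with (((r ^ 2 - Cmod z ^ 2) * B * q) ^ 16).
    - apply pow_incr. split.
      + apply Rmult_le_pos; [apply Rmult_le_pos|]; lra.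
      + replace (D * q0 * (B / 4)) with ((D / 2 * (q0 / 2)) * B) by field.
        replace ((r ^ 2 - Cmod z ^ 2) * B * q) with (((r ^ 2 - Cmod z ^ 2) * q) * B) by ring.
        apply Rmult_le_compat_r; auto. apply Rmult_le_compat; lra.
    - apply Rmult_le_compat_r with (r := P) in Hmax; [|lra].
      rewrite Rmult_assoc, Rinv_l, Rmult_1_r in Hmax by lra.
      eapply Rle_trans; [exact Hmax|].
      replace (D * q0 * (8 * A)) with (8 * (D * A * q0)) by ring.
      rewrite (Rpow_mult_distr 8). replace (8 ^ 16) with (2 ^ 48) by ring.
      set (Y := (D * A * q0) ^ 16).
      assert (PY : 0 <= Y).
      { apply pow_le. apply Rmult_le_pos; [apply Rmult_le_pos|]; lra. }
      apply Rle_trans with (Y * / P0 * (2 ^ 48 * P0)).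
      + apply Rmult_le_compat_l; auto. apply Rmult_le_pos; auto. left. apply Rinv_0_lt_compat; auto.
      + right. field. lra. }
  apply pow_le_inv in K; [|lia| |].
  - apply Rmult_le_reg_l in K; [lra|]. apply Rmult_lt_0_compat; lra.
  - apply Rmult_le_pos; [|lra]. apply Rmult_le_pos; lra.
  - apply Rmult_le_pos; [|lra]. apply Rmult_le_pos; lra.
Qed.

(** Near a value of [l] the maximality of the weight controls [f'] on a disc of size
    comparable with [tau / |f'(z0)|], hence yields an island. *)
Lemma weight_max_near (f f1 : C -> C) (r tau d : R) (l : list C) (a z0 : C) :
  0 < r -> 0 < tau -> tau * 65536 <= d / 16 -> d <= 1 -> length l = 64%nat -> NoDup l -> In a l ->
  (forall x y, In x l -> In y l -> x <> y -> d <= Cmod (x - y)) ->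
  (forall w, cdiff f w (f1 w)) -> Cmod z0 < r ->
  (forall z, Cmod z <= r -> weight f f1 r tau l z <= weight f f1 r tau l z0) ->
  Cmod (f z0 - a) <= tau -> ~ island f 0 r a tau ->
  Cmod (f1 z0) * (r ^ 2 - Cmod z0 ^ 2) <= 2 * r * (1 + Cmod (f z0) ^ 2).
Proof.
  intros Hr Ht Hd Hd1 Hl Hnd Ha Hsep Hf Hz0 Hmax Hta Hni.
  assert (Pz0 := Cmod_ge_0 z0). pose proof (Cmod_ge_0 (f1 z0)) as PA.
  assert (Pq := pow2_ge_0 (Cmod (f z0))).
  set (c := f1 z0) in *. set (A := Cmod c) in *.
  (* If the slope [A] is small on the scale of the distance to the boundary, the conclusion holds
     outright; otherwise the disc of radius [s0] below fits well inside [D(0, r)]. *)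
  destruct (Rle_lt_dec (A * (r - Cmod z0)) 1) as [Hsmall|Hbig].
  { assert (A * (r ^ 2 - Cmod z0 ^ 2) <= 1 * (2 * r)).
    { replace (A * (r ^ 2 - Cmod z0 ^ 2)) with ((A * (r - Cmod z0)) * (r + Cmod z0)) by ring.
      apply Rmult_le_compat; try lra. apply Rmult_le_pos; lra. }
    nra. }
  exfalso. apply Hni.
  assert (HA : 0 < A) by nra.
  (* [e0] is the variation of [f] allowed by [weight_bound_near]: together with [|f z0 - a| <= tau]
     it makes [2 ^ 16 * tau]. On radius [s0] a derivative of size [32 * A] cannot exceed it. *)
  set (e0 := 65535 * tau). set (s0 := e0 / (32 * A)).
  assert (He0 : 0 < e0) by (unfold e0; lra).
  assert (Hs0 : 0 < s0) by (apply Rdiv_lt_0_compat; lra).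
  assert (Es0 : 32 * A * s0 = e0) by (unfold s0; field; lra).
  assert (Hs0r : s0 <= (r - Cmod z0) / 4).
  { apply Rmult_le_reg_l with (32 * A); [lra|]. rewrite Es0. unfold e0. lra. }
  assert (Hin : forall z, Cmod (z - z0) < s0 -> Cmod z <= r).
  { intros z Hz. pose proof (Cmod_le_plus_dist z z0). lra. }
  assert (Hder : forall z, Cmod (z - z0) < s0 -> Cmod (f z - f z0) <= e0 -> Cmod (f1 z) <= 32 * A).
  { intros z Hz Hfz. apply (weight_bound_near f f1 r tau d l a z0 z); auto. lra. }
  assert (Hball : forall z, Cmod (z - z0) < s0 -> Cmod (f z - f z0) <= e0).
  { intros z Hz.
    set (g := fun t => Cmod (f (z0 + RtoC t * (z - z0))%C - f z0)).
    assert (Cg : forall t e, 0 <= t <= 1 -> 0 < e -> exists d, 0 < d /\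
     forall t', 0 <= t' <= 1 -> Rabs (t' - t) < d -> Rabs (g t' - g t) < e).
    { intros t e _ He. destruct (cdiff_ccont _ _ _ (Hf (z0 + RtoC t * (z - z0))%C) e He) as [dl [P Hdl]].
      pose proof (Cmod_ge_0 (z - z0)) as Pm.
      exists (dl / (1 + Cmod (z - z0))). split; [apply Rdiv_lt_0_compat; lra|].
      intros t' _ Htt. unfold g. eapply Rle_lt_trans; [apply Cmod_Cmod_diff|].
      replace (f (z0 + RtoC t' * (z - z0)) - f z0 - (f (z0 + RtoC t * (z - z0)) - f z0))%C
        with (f (z0 + RtoC t' * (z - z0)) - f (z0 + RtoC t * (z - z0)))%C by ring.
      apply Hdl.
      replace (z0 + RtoC t' * (z - z0) - (z0 + RtoC t * (z - z0)))%C with (RtoC (t' - t) * (z - z0))%C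
        by (rewrite RtoC_minus; ring).
      rewrite Cmod_mult, Cmod_R.
      apply Rmult_lt_compat_r with (r := 1 + Cmod (z - z0)) in Htt; [|lra].
      unfold Rdiv in Htt. rewrite Rmult_assoc, Rinv_l in Htt by lra.
      pose proof (Rabs_pos (t' - t)). nra. }
    assert (K := bootstrap g e0 Cg).
    assert (G1 : g 1 < e0).
    { apply K; [| |lra].
      - unfold g. replace (z0 + 0 * (z - z0))%C with z0 by ring. rewrite Cmod_self_minus. auto.
      - intros t Hti Hle. unfold g.
        set (v := (z0 + RtoC t * (z - z0))%C).
        assert (Hv : Cmod (v - z0) <= Cmod (z - z0)).
        { unfold v. replace (z0 + RtoC t * (z - z0) - z0)%C with (RtoC t * (z - z0))%C by ring.
          rewrite Cmod_mult, Cmod_R, Rabs_right by lra. pose proof (Cmod_ge_0 (z - z0)). nra. }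
        assert (M : Cmod (f v - f z0 - 0 * (v - z0)) <= 32 * A * Cmod (v - z0)).
        { apply (mean_value_ineq f f1). intros t' Ht'. split; [apply Hf|].
          replace (z0 + RtoC t' * (v - z0))%C with (z0 + RtoC (t' * t) * (z - z0))%C
            by (unfold v; rewrite RtoC_mult; ring).
          replace (f1 (z0 + RtoC (t' * t) * (z - z0)) - 0)%C with (f1 (z0 + RtoC (t' * t) * (z - z0)))%C by ring.
          apply Hder.
          - replace (z0 + RtoC (t' * t) * (z - z0) - z0)%C with (RtoC (t' * t) * (z - z0))%C by ring.
            rewrite Cmod_mult, Cmod_R, Rabs_right by nra. pose proof (Cmod_ge_0 (z - z0)).
            assert (t' * t <= 1) by nra. nra.
          - apply (Hle (t' * t)). nra. }
        replace (f v - f z0 - 0 * (v - z0))%C with (f v - f z0)%C in M by ring.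
        eapply Rle_lt_trans; [exact M|]. rewrite <- Es0. apply Rmult_lt_compat_l; lra. }
    unfold g in G1. replace (z0 + 1 * (z - z0))%C with z in G1 by ring. lra. }
  assert (Hder' : forall z, Cmod (z - z0) < s0 -> Cmod (f1 z) <= 32 * A) by auto.
  assert (Hf2 : forall w, exists d, cdiff f1 w d) by (intros w; apply (cdiff_derivative f); auto).
  destruct (choice _ Hf2) as [f2 Hf2'].
  (* The Cauchy estimate [64 * A / (s0 / 2)] on [f2] times [s] is [A / 2], which is the
     near-affinity required. Moreover [A * s / 2 = e0 / 16384] is at least [2 * tau], so [D(a, tau)]
     is covered. *)
  set (s := s0 / 256).
  assert (B2 : forall w, Cmod (w - z0) <= s -> Cmod (f2 w) <= 64 * A / (s0 / 2)).
  { intros w Hw. apply (cauchy_estimate f1 w); auto; [lra|].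
    intros v Hv. pose proof (Cmod_triangle_via w v z0).
    pose proof (Hder' v ltac:(unfold s in *; lra)). pose proof (Hder' w ltac:(unfold s in *; lra)).
    pose proof (Cmod_triangle_minus (f1 v) (f1 w)). lra. }
  assert (B1 : forall w, Cmod (w - z0) <= s -> Cmod (f1 w - c) <= A / 2).
  { intros w Hw.
    assert (M : Cmod (f1 w - f1 z0 - 0 * (w - z0)) <= 64 * A / (s0 / 2) * Cmod (w - z0)).
    { apply (mean_value_ineq f1 f2). intros t Hti. split; [apply Hf2'|].
      replace (f2 (z0 + RtoC t * (w - z0)) - 0)%C with (f2 (z0 + RtoC t * (w - z0)))%C by ring.
      apply B2. apply segment_dist; auto. rewrite Cmod_self_minus. unfold s. lra. }
    replace (f1 w - f1 z0 - 0 * (w - z0))%C with (f1 w - c)%C in M by (unfold c; ring).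
    eapply Rle_trans; [exact M|].
    replace (A / 2) with (64 * A / (s0 / 2) * s) by (unfold s; field; lra).
    apply Rmult_le_compat_l; auto. apply Rlt_le. apply Rdiv_lt_0_compat; lra. }
  exists z0, s, c. repeat split.
  - unfold s. lra.
  - apply Cmod_gt_0. exact HA.
  - replace (z0 - 0)%C with z0 by ring. unfold s. lra.
  - fold A. replace (A * s / 2) with (32 * A * s0 / 16384) by (unfold s; field). rewrite Es0.
    unfold e0. lra.
  - intros x y Hx Hy. fold A. replace (A * Cmod (x - y) / 2) with (A / 2 * Cmod (x - y)) by field.
    apply (mean_value_ineq f f1). intros t Hti. split; [apply Hf|].
    apply B1. apply segment_dist; auto.
Qed.

(** * Spherical derivative of functions without islands *)

Lemma separation (l : list C) : exists d, 0 < d <= 1 /\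
  forall x y, In x l -> In y l -> x <> y -> d <= Cmod (x - y).
Proof.
  assert (K : forall a, exists d, 0 < d <= 1 /\ forall y, In y l -> a <> y -> d <= Cmod (a - y)).
  { intros a. induction l as [|b l' [d [Hd IH]]].
    - exists 1. split; [lra|]. intros y [].
    - destruct (classic (a = b)) as [->|N].
      + exists d. split; auto. intros y [<-|Hy] Ny; [congruence|auto].
      + pose proof (Cmod_minus_pos a b N). exists (Rmin d (Cmod (a - b))).
        pose proof (Rmin_l d (Cmod (a - b))). pose proof (Rmin_r d (Cmod (a - b))).
        split. { split; [apply Rmin_pos; lra|lra]. }
        intros y [<-|Hy] Ny; [lra|]. specialize (IH y Hy Ny). lra. }
  assert (G : forall l', exists d, 0 < d <= 1 /\ forall x y, In x l' -> In y l -> x <> y -> d <= Cmod (x - y)).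
  { induction l' as [|b l' [d [Hd IH]]].
    - exists 1. split; [lra|]. intros x y [].
    - destruct (K b) as [d' [Hd' H']]. exists (Rmin d d').
      pose proof (Rmin_l d d'). pose proof (Rmin_r d d').
      split. { split; [apply Rmin_pos; lra|lra]. }
      intros x y [<-|Hx] Hy N; [specialize (H' y Hy N); lra|specialize (IH x y Hx Hy N); lra]. }
  exact (G l).
Qed.

Lemma list_Cmod_bound (l : list C) : exists M, 0 <= M /\ forall a, In a l -> Cmod a <= M.
Proof.
  induction l as [|b l [M [HM H]]].
  - exists 0. split; [lra|]. intros a [].
  - exists (Rmax M (Cmod b)). pose proof (Rmax_l M (Cmod b)). pose proof (Rmax_r M (Cmod b)).
    split; [lra|]. intros a [<-|Ha]; [auto|]. specialize (H a Ha). lra.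
Qed.

(** Half of the derivative measured by [sphere_dist]; the missing factor 2 reappears in
    [stereo_lipschitz]. *)
Definition spherical_derivative (f f1 : C -> C) (z : C) : R := Cmod (f1 z) / (1 + Cmod (f z) ^ 2).

(** A truncated distance and [sqrt (1 + |w| ^ 2)] are both bounded below and both grow like [|w|],
    so they are comparable factor by factor, with constants depending only on [tau] and [M]. *)
Lemma lprod_trunc_dist_bounds (tau M : R) (l : list C) (w : C) : 0 < tau <= 1 -> 0 <= M ->
  (forall a, In a l -> Cmod a <= M) ->
  lprod (trunc_dist tau w) l <= (M + 2) ^ length l * sqrt (1 + Cmod w ^ 2) ^ length l /\
  sqrt (1 + Cmod w ^ 2) ^ length l <= ((1 + M) / tau + 1) ^ length l * lprod (trunc_dist tau w) l.
Proof.
  intros Ht HM Hl. set (u := sqrt (1 + Cmod w ^ 2)).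
  pose proof (Cmod_ge_0 w) as Pw. pose proof (pow2_ge_0 (Cmod w)) as Pw2.
  assert (U1 : 1 <= u). { rewrite <- sqrt_1. apply sqrt_le_1_alt. lra. }
  assert (U2 : Cmod w <= u). { rewrite <- (sqrt_pow2 (Cmod w)) by auto. apply sqrt_le_1_alt. lra. }
  assert (U3 : u <= 1 + Cmod w).
  { rewrite <- (sqrt_pow2 (1 + Cmod w)) by lra. apply sqrt_le_1_alt. nra. }
  rewrite <- (lprod_const u). split; apply lprod_le.
  - lra.
  - intros a Ha. specialize (Hl a Ha). split; [left; apply trunc_dist_pos; lra|].
    pose proof (Cmod_triangle_minus w a). apply Rmax_lub; nra.
  - assert (0 <= (1 + M) / tau) by (apply Rdiv_le_0_compat; lra). lra.
  - intros a Ha. specialize (Hl a Ha). split; [lra|].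
    pose proof (Cmod_le_plus_dist w a). unfold trunc_dist.
    pose proof (Rmax_l (Cmod (w - a)) tau). pose proof (Rmax_r (Cmod (w - a)) tau).
    set (m := Rmax (Cmod (w - a)) tau) in *.
    assert (1 + M <= (1 + M) / tau * m).
    { replace (1 + M) with ((1 + M) / tau * tau) at 1 by (field; lra).
      apply Rmult_le_compat_l; auto. apply Rdiv_le_0_compat; lra. }
    lra.
Qed.

(** At its maximum point the weight is at most of order [r ^ 16], by the far and the near estimate;
    at the centre it is of the order of the 16th power of [r ^ 2] times the spherical derivative.
    Comparing the two leaves a bound of order [1 / r]. *)
Lemma no_island_bound (l : list C) : length l = 64%nat -> NoDup l ->
  exists eta K, 0 < eta /\ 0 < K /\ forall f f1 p r, (forall w, cdiff f w (f1 w)) -> 0 < r ->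
    (forall a, In a l -> ~ island f p r a eta) -> spherical_derivative f f1 p <= K / r.
Proof.
  intros Hl Hnd. destruct (separation l) as [d [Hd Hsep]]. destruct (list_Cmod_bound l) as [M [HM HlM]].
  (* Chosen so that [65536 * tau = d / 16], as [weight_bound_near] asks. *)
  set (tau := d / 2 ^ 20). assert (Etau : tau = d / 1048576) by (unfold tau; f_equal; ring).
  assert (Ht : 0 < tau <= 1) by lra.
  set (k2 := M + 2). set (k3 := (1 + M) / tau + 1).
  assert (Hk3 : 1 <= k3).
  { assert (0 <= (1 + M) / tau) by (apply Rdiv_le_0_compat; lra). unfold k3; lra. }
  (* The comparison constants enter once for each of the 64 factors, and a 16th root is taken:
     [64 / 16 = 4]. *)
  set (k := (k2 * k3) ^ 4).
  assert (Hk : 0 < k). { apply pow_lt. unfold k2. nra. }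
  assert (Main : forall f f1 r, (forall w, cdiff f w (f1 w)) -> 0 < r ->
    (forall a, In a l -> ~ island f 0 r a tau) -> spherical_derivative f f1 0 <= 2 * k / r).
  { intros f f1 r Hf Hr Hni.
    assert (Cf : forall z, ccont f z) by (intros z; eapply cdiff_ccont; apply Hf).
    assert (Cf1 : forall z, ccont f1 z).
    { intros z. destruct (cdiff_derivative f f1 z Hf) as [d2 H2]. eapply cdiff_ccont. exact H2. }
    destruct (disc_max (weight f f1 r tau l) r) as [z0 [Hz0 Hmax]]; [lra| |].
    { intros z. apply rcont_weight; auto. lra. }
    set (D := r ^ 2 - Cmod z0 ^ 2). set (q := 1 + Cmod (f z0) ^ 2).
    assert (HDA : Cmod (f1 z0) * D <= 2 * r * q).
    { pose proof (pow2_ge_0 (Cmod (f z0))) as Pq.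
      destruct (Rle_lt_or_eq_dec _ _ Hz0) as [Hz0'|E].
      - destruct (classic (exists a, In a l /\ Cmod (f z0 - a) <= tau)) as [[a [Ha Hta]]|Hfar].
        + apply (weight_max_near f f1 r tau d l a z0); auto; lra.
        + apply Rle_trans with (r * q); [|unfold q; nra].
          apply (weight_max_far f f1 r tau l z0); auto; [lra|].
          intros a Ha. apply Rnot_le_lt. intros L. apply Hfar. eauto.
      - unfold D. rewrite E. unfold q. nra. }
    specialize (Hmax 0 ltac:(rewrite Cmod_0; lra)). unfold weight in Hmax. fold D q in Hmax.
    rewrite Cmod_0 in Hmax. replace (r ^ 2 - 0 ^ 2) with (r ^ 2) in Hmax by ring.
    unfold spherical_derivative. set (A0 := Cmod (f1 0)) in *. set (q0 := 1 + Cmod (f 0) ^ 2) in *.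
    pose proof (Cmod_ge_0 (f1 0)) as PA0. fold A0 in PA0.
    pose proof (Cmod_ge_0 (f1 z0)) as PA. set (A := Cmod (f1 z0)) in *.
    assert (Pq : 1 <= q) by (unfold q; pose proof (pow2_ge_0 (Cmod (f z0))); lra).
    assert (Pq0 : 1 <= q0) by (unfold q0; pose proof (pow2_ge_0 (Cmod (f 0))); lra).
    assert (PD : 0 <= D). { unfold D. pose proof (Cmod_ge_0 z0). nra. }
    destruct (lprod_trunc_dist_bounds tau M l (f z0) Ht HM HlM) as [_ L1].
    destruct (lprod_trunc_dist_bounds tau M l (f 0) Ht HM HlM) as [L2 _].
    fold q in L1. fold q0 in L2. fold k2 in L2. fold k3 in L1. rewrite Hl in L1, L2.
    assert (S64 : forall x, 1 <= x -> sqrt x ^ 64 = x ^ 32).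
    { intros x Hx. change 64%nat with (2 * 32)%nat. rewrite pow_mult, pow2_sqrt by lra. auto. }
    rewrite S64 in L1, L2 by auto.
    set (P := lprod (trunc_dist tau (f z0)) l) in *. set (P0 := lprod (trunc_dist tau (f 0)) l) in *.
    assert (PP : 0 < P) by (apply lprod_pos; intros; apply trunc_dist_pos; lra).
    assert (PP0 : 0 < P0) by (apply lprod_pos; intros; apply trunc_dist_pos; lra).
    assert (Hcross : (r ^ 2 * A0 * q0) ^ 16 * P <= (D * A * q) ^ 16 * P0).
    { apply Rmult_le_compat_r with (r := P * P0) in Hmax; [|nra].
      replace ((r ^ 2 * A0 * q0) ^ 16 * / P0 * (P * P0)) with ((r ^ 2 * A0 * q0) ^ 16 * P) in Hmax by (field; lra).
      replace ((D * A * q) ^ 16 * / P * (P * P0)) with ((D * A * q) ^ 16 * P0) in Hmax by (field; lra).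
      exact Hmax. }
    assert (Pr2 : 0 < r ^ 2) by (apply pow_lt; auto).
    assert (PX : 0 <= (r ^ 2 * A0 * q0) ^ 16).
    { apply pow_le. apply Rmult_le_pos; [apply Rmult_le_pos|]; lra. }
    assert (PY : 0 <= (D * A * q) ^ 16).
    { apply pow_le. apply Rmult_le_pos; [apply Rmult_le_pos|]; lra. }
    assert (Pk3 : 0 < k3 ^ 64) by (apply pow_lt; lra).
    assert (Hpow : (r ^ 2 * A0 * q0 * q ^ 2) ^ 16 <= (k * (D * A * q) * q0 ^ 2) ^ 16).
    { rewrite (Rpow_mult_distr (r ^ 2 * A0 * q0)), <- pow_mult. change (2 * 16)%nat with 32%nat.
      apply Rle_trans with ((r ^ 2 * A0 * q0) ^ 16 * (k3 ^ 64 * P)).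
      { apply Rmult_le_compat_l; auto. }
      apply Rle_trans with (k3 ^ 64 * ((D * A * q) ^ 16 * (k2 ^ 64 * q0 ^ 32))).
      - replace ((r ^ 2 * A0 * q0) ^ 16 * (k3 ^ 64 * P)) with (k3 ^ 64 * ((r ^ 2 * A0 * q0) ^ 16 * P)) by ring.
        apply Rmult_le_compat_l; [lra|]. eapply Rle_trans; [exact Hcross|].
        apply Rmult_le_compat_l; auto.
      - right. rewrite (Rpow_mult_distr (k * (D * A * q))), (Rpow_mult_distr k), <- (pow_mult q0).
        change (2 * 16)%nat with 32%nat. unfold k. rewrite <- pow_mult. change (4 * 16)%nat with 64%nat.
        rewrite (Rpow_mult_distr k2). ring. }
    assert (Pq2 : 0 < q ^ 2) by (apply pow_lt; lra). assert (Pq02 : 0 < q0 ^ 2) by (apply pow_lt; lra).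
    apply pow_le_inv in Hpow; [|lia| |].
    2:{ apply Rmult_le_pos; [|lra]. apply Rmult_le_pos; [apply Rmult_le_pos|]; lra. }
    2:{ apply Rmult_le_pos; [|lra]. apply Rmult_le_pos; [lra|]. apply Rmult_le_pos; [apply Rmult_le_pos|]; lra. }
    assert (H2 : r ^ 2 * A0 * q0 * q ^ 2 <= (2 * k * r * q0 ^ 2) * q ^ 2).
    { eapply Rle_trans; [exact Hpow|].
      replace (k * (D * A * q) * q0 ^ 2) with ((k * q0 ^ 2 * q) * (A * D)) by ring.
      replace (2 * k * r * q0 ^ 2 * q ^ 2) with ((k * q0 ^ 2 * q) * (2 * r * q)) by ring.
      apply Rmult_le_compat_l; auto. apply Rmult_le_pos; [apply Rmult_le_pos|]; lra. }
    apply Rmult_le_reg_r in H2; auto.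
    apply Rmult_le_reg_r with (r ^ 2 * q0 ^ 2); [apply Rmult_lt_0_compat; lra|].
    replace (A0 / q0 * (r ^ 2 * q0 ^ 2)) with (r ^ 2 * A0 * q0) by (field; lra).
    replace (2 * k / r * (r ^ 2 * q0 ^ 2)) with (2 * k * r * q0 ^ 2) by (field; lra). exact H2. }
  exists tau, (2 * k). split; [lra|]. split; [lra|].
  intros f f1 p r Hf Hr Hni.
  assert (Hg : forall w, cdiff (fun z => f (p + z)%C) w (f1 (p + w)%C)).
  { intros w. refine (cdiff_val _ _ _ _ (cdiff_comp f (fun z => p + z)%C w _ _
      (cdiff_plus _ _ _ _ _ (cdiff_const p w) (cdiff_id w)) (Hf _)) _). ring. }
  specialize (Main (fun z => f (p + z)%C) (fun z => f1 (p + z)%C) r Hg Hr).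
  unfold spherical_derivative in *. rewrite Cplus_0_r in Main. apply Main.
  intros a Ha [c0 [s [c [H1 [H2 [H3 [H4 H5]]]]]]]. apply (Hni a Ha).
  exists (p + c0)%C, s, c. repeat split; auto.
  - replace (p + c0 - p)%C with (c0 - 0)%C by ring. auto.
  - intros x y Hx Hy. specialize (H5 (x - p)%C (y - p)%C).
    replace (p + (x - p))%C with x in H5 by ring. replace (p + (y - p))%C with y in H5 by ring.
    replace (x - p - (y - p))%C with (x - y)%C in H5 by ring.
    apply H5.
    + replace (x - p - c0)%C with (x - (p + c0))%C by ring. auto.
    + replace (y - p - c0)%C with (y - (p + c0))%C by ring. auto.
Qed.

(** * Chordal metric and quasi-normality *)

(** Coordinates 0, 1, 2 of stereographic projection onto the unit sphere, on which
    [sphere_dist] is the Euclidean distance. *)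
Definition stereo (i : nat) (a : option C) : R :=
  match a, i with
  | None, 0%nat | None, 1%nat => 0
  | None, _ => 1
  | Some w, 0%nat => 2 * Re w / (1 + Cmod w ^ 2)
  | Some w, 1%nat => 2 * Im w / (1 + Cmod w ^ 2)
  | Some w, _ => (Cmod w ^ 2 - 1) / (1 + Cmod w ^ 2)
  end.

Lemma stereo_sphere (w : C) :
  stereo 0 (Some w) ^ 2 + stereo 1 (Some w) ^ 2 + stereo 2 (Some w) ^ 2 = 1.
Proof.
  unfold stereo. rewrite Cmod2_alt. pose proof (pow2_ge_0 (Re w)). pose proof (pow2_ge_0 (Im w)).
  field. lra.
Qed.

Lemma stereo_bound (i : nat) (w : C) : Rabs (stereo i (Some w)) <= 1.
Proof.
  pose proof (stereo_sphere w) as E. pose proof (pow2_ge_0 (stereo 0 (Some w))).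
  pose proof (pow2_ge_0 (stereo 1 (Some w))). pose proof (pow2_ge_0 (stereo 2 (Some w))).
  assert (K : forall x, x ^ 2 <= 1 -> Rabs x <= 1).
  { intros x Hx. rewrite <- (Rabs_R1). apply Rsqr_le_abs_0. unfold Rsqr. lra. }
  destruct i as [|[|i]]; [apply K; lra|apply K; lra|].
  change (stereo (S (S i)) (Some w)) with (stereo 2 (Some w)). apply K; lra.
Qed.

Lemma sphere_dist_stereo (x : C) (b : option C) : sphere_dist (Some x) b ^ 2 =
  (stereo 0 (Some x) - stereo 0 b) ^ 2 + (stereo 1 (Some x) - stereo 1 b) ^ 2
   + (stereo 2 (Some x) - stereo 2 b) ^ 2.
Proof.
  unfold sphere_dist, stereo. destruct b as [y|].
  - pose proof (Cmod_ge_0 x). pose proof (Cmod_ge_0 y).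
    assert (P1 : 0 < 1 + Cmod x ^ 2) by nra. assert (P2 : 0 < 1 + Cmod y ^ 2) by nra.
    unfold Rdiv at 1. rewrite !Rpow_mult_distr, pow_inv, pow2_sqrt by nra.
    rewrite !Cmod2_alt in *.
    destruct x as [a b], y as [c d]. unfold Re, Im, Cminus, Cplus, Copp in *; cbn [fst snd] in *.
    field. split; lra.
  - pose proof (Cmod_ge_0 x). assert (P1 : 0 < 1 + Cmod x ^ 2) by nra.
    unfold Rdiv at 1. rewrite !Rpow_mult_distr, pow_inv, pow2_sqrt by nra.
    rewrite !Cmod2_alt in *. field. lra.
Qed.

Lemma sphere_dist_le_stereo (x : C) (b : option C) : sphere_dist (Some x) b <=
  Rabs (stereo 0 (Some x) - stereo 0 b) + Rabs (stereo 1 (Some x) - stereo 1 b)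
   + Rabs (stereo 2 (Some x) - stereo 2 b).
Proof.
  pose proof (Rabs_pos (stereo 0 (Some x) - stereo 0 b)) as A0.
  pose proof (Rabs_pos (stereo 1 (Some x) - stereo 1 b)) as A1.
  pose proof (Rabs_pos (stereo 2 (Some x) - stereo 2 b)) as A2.
  apply (pow_le_inv _ _ 2); [lia| |lra|].
  - unfold sphere_dist. destruct b as [y|].
    + apply Rdiv_le_0_compat; [pose proof (Cmod_ge_0 (x - y)); lra|]. apply sqrt_lt_R0.
      pose proof (Cmod_ge_0 x). pose proof (Cmod_ge_0 y). nra.
    + apply Rdiv_le_0_compat; [lra|]. apply sqrt_lt_R0. pose proof (Cmod_ge_0 x). nra.
  - rewrite sphere_dist_stereo.
    rewrite <- (pow2_abs (stereo 0 (Some x) - stereo 0 b)), <- (pow2_abs (stereo 1 (Some x) - stereo 1 b)),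
      <- (pow2_abs (stereo 2 (Some x) - stereo 2 b)). nra.
Qed.

(** Supplies the limit value in [C] with infinity once the three coordinates converge; [c = 1] is
    the pole [None]. *)
Lemma stereo_onto (a b c : R) : a ^ 2 + b ^ 2 + c ^ 2 = 1 ->
  exists p, stereo 0 p = a /\ stereo 1 p = b /\ stereo 2 p = c.
Proof.
  intros H. destruct (Req_dec c 1) as [->|N].
  - exists None. simpl. repeat split; nra.
  - exists (Some ((a / (1 - c))%R, (b / (1 - c))%R)). unfold stereo. rewrite Cmod2_alt.
    unfold Re, Im; cbn [fst snd].
    assert (Hc : c < 1) by (pose proof (pow2_ge_0 a); pose proof (pow2_ge_0 b); nra).
    assert (E : 1 + ((a / (1 - c)) ^ 2 + (b / (1 - c)) ^ 2) = 2 / (1 - c)).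
    { replace (1 + ((a / (1 - c)) ^ 2 + (b / (1 - c)) ^ 2)) with
        ((a ^ 2 + b ^ 2 + (1 - c) ^ 2) / (1 - c) ^ 2) by (field; lra).
      replace (a ^ 2 + b ^ 2 + (1 - c) ^ 2) with (2 * (1 - c)) by nra. field. lra. }
    rewrite E. replace ((a / (1 - c)) ^ 2 + (b / (1 - c)) ^ 2 - 1) with (2 / (1 - c) - 2) by lra.
    repeat split; field; lra.
Qed.

(** Stereographic projection is conformal with factor [2 / n], so a curve of speed [m] gets an image
    of speed [2 * m / n], and no coordinate moves faster. The slack in the squared inequality is
    exhibited as a sum of squares. *)
Lemma stereo_derivative_bound (u v du dv m n k : R) : n = 1 + (u ^ 2 + v ^ 2) ->
  m ^ 2 = du ^ 2 + dv ^ 2 -> 0 <= m -> m <= k * n ->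
  Rabs ((2 * du * n - 2 * u * (2 * u * du + 2 * v * dv)) / n ^ 2) <= 2 * k /\
  Rabs (((2 * u * du + 2 * v * dv) * n - (u ^ 2 + v ^ 2 - 1) * (2 * u * du + 2 * v * dv)) / n ^ 2) <= 2 * k.
Proof.
  intros En Em Hm Hk. pose proof (pow2_ge_0 u). pose proof (pow2_ge_0 v).
  assert (Hn : 1 <= n) by lra.
  assert (Pn : 0 < n ^ 2) by (apply pow_lt; lra).
  assert (G : forall x, x ^ 2 <= (2 * m * n) ^ 2 -> Rabs (x / n ^ 2) <= 2 * k).
  { intros x Hx. assert (Rabs x <= 2 * m * n).
    { apply (pow_le_inv _ _ 2); [lia|apply Rabs_pos|nra|]. rewrite pow2_abs. auto. }
    unfold Rdiv. rewrite Rabs_mult, (Rabs_right (/ n ^ 2)).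
    - apply Rmult_le_reg_r with (n ^ 2); auto. rewrite Rmult_assoc, Rinv_l by lra.
      assert (2 * m * n <= 2 * (k * n) * n) by nra. nra.
    - left. apply Rinv_0_lt_compat; auto. }
  split; apply G.
  - assert (E : (2 * m * n) ^ 2 - (2 * du * n - 2 * u * (2 * u * du + 2 * v * dv)) ^ 2 =
      4 * (2 * u * v * du + dv * (1 + v ^ 2 - u ^ 2)) ^ 2 + 16 * u ^ 2 * m ^ 2).
    { replace ((2 * m * n) ^ 2) with (4 * m ^ 2 * n ^ 2) by ring. rewrite Em, En. ring. }
    pose proof (pow2_ge_0 (2 * u * v * du + dv * (1 + v ^ 2 - u ^ 2))).
    pose proof (pow2_ge_0 m). assert (0 <= u ^ 2 * m ^ 2) by (apply Rmult_le_pos; auto). lra.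
  - assert (E : (2 * m * n) ^ 2 - ((2 * u * du + 2 * v * dv) * n - (u ^ 2 + v ^ 2 - 1) * (2 * u * du + 2 * v * dv)) ^ 2 =
      16 * (u * dv - v * du) ^ 2 + 4 * (1 - u ^ 2 - v ^ 2) ^ 2 * m ^ 2).
    { replace ((2 * m * n) ^ 2) with (4 * m ^ 2 * n ^ 2) by ring. rewrite Em, En. ring. }
    pose proof (pow2_ge_0 (u * dv - v * du)). pose proof (pow2_ge_0 m).
    assert (0 <= (1 - u ^ 2 - v ^ 2) ^ 2 * m ^ 2) by (apply Rmult_le_pos; auto; apply pow2_ge_0). lra.
Qed.

Lemma is_derive_stereo_coords (U V : R -> R) (t du dv : R) : is_derive U t du -> is_derive V t dv ->
  is_derive (fun t => 2 * U t / (1 + (U t ^ 2 + V t ^ 2))) t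
    ((2 * du * (1 + (U t ^ 2 + V t ^ 2)) - 2 * U t * (2 * U t * du + 2 * V t * dv))
       / (1 + (U t ^ 2 + V t ^ 2)) ^ 2) /\
  is_derive (fun t => (U t ^ 2 + V t ^ 2 - 1) / (1 + (U t ^ 2 + V t ^ 2))) t
    (((2 * U t * du + 2 * V t * dv) * (1 + (U t ^ 2 + V t ^ 2))
       - (U t ^ 2 + V t ^ 2 - 1) * (2 * U t * du + 2 * V t * dv)) / (1 + (U t ^ 2 + V t ^ 2)) ^ 2).
Proof.
  intros DU DV. pose proof (pow2_ge_0 (U t)). pose proof (pow2_ge_0 (V t)).
  assert (N : 1 + (U t ^ 2 + V t ^ 2) <> 0) by lra.
  assert (EU : ex_derive U t) by (exists du; exact DU).
  assert (EV : ex_derive V t) by (exists dv; exact DV).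
  assert (FU : Derive (fun x : R => U x) t = du) by exact (is_derive_unique U t du DU).
  assert (FV : Derive (fun x : R => V x) t = dv) by exact (is_derive_unique V t dv DV).
  split; auto_derive.
  - repeat split; assumption.
  - rewrite FU, FV. field. assumption.
  - repeat split; assumption.
  - rewrite FU, FV. field. assumption.
Qed.

Lemma stereo_lipschitz (f f1 : C -> C) (x y : C) (k : R) (i : nat) :
  (forall t, 0 <= t <= 1 -> cdiff f (x + RtoC t * (y - x)) (f1 (x + RtoC t * (y - x)))%C /\
     spherical_derivative f f1 (x + RtoC t * (y - x))%C <= k) ->
  Rabs (stereo i (Some (f y)) - stereo i (Some (f x))) <= 2 * k * Cmod (y - x).
Proof.
  intros H. set (s := fun t : R => (x + RtoC t * (y - x))%C).
  set (U := fun t => Re (f (s t))). set (V := fun t => Im (f (s t))).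
  set (dU := fun t => Re (f1 (s t) * (y - x))). set (dV := fun t => Im (f1 (s t) * (y - x))).
  assert (DU : forall t, 0 <= t <= 1 -> is_derive U t (dU t)).
  { intros t Ht. apply is_derive_Re_line. apply H; auto. }
  assert (DV : forall t, 0 <= t <= 1 -> is_derive V t (dV t)).
  { intros t Ht. apply is_derive_Im_line. apply H; auto. }
  set (n := fun t => 1 + (U t ^ 2 + V t ^ 2)).
  assert (Hn : forall t, 1 <= n t).
  { intros t. unfold n. pose proof (pow2_ge_0 (U t)). pose proof (pow2_ge_0 (V t)). lra. }
  assert (B : forall t, 0 <= t <= 1 ->
    (Cmod (f1 (s t)) * Cmod (y - x)) ^ 2 = dU t ^ 2 + dV t ^ 2 /\
    Cmod (f1 (s t)) * Cmod (y - x) <= k * Cmod (y - x) * n t).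
  { intros t Ht. rewrite <- Cmod_mult, Cmod2_alt. split; [reflexivity|].
    destruct (H t Ht) as [_ K]. fold (s t) in K. unfold spherical_derivative in K.
    rewrite Cmod2_alt in K. fold (U t) (V t) in K. fold (n t) in K. specialize (Hn t).
    apply Rmult_le_compat_r with (r := n t) in K; [|lra].
    unfold Rdiv in K. rewrite Rmult_assoc, Rinv_l, Rmult_1_r in K by lra.
    rewrite Cmod_mult. pose proof (Cmod_ge_0 (y - x)). nra. }
  assert (M : forall g dg, (forall t, 0 <= t <= 1 -> is_derive g t (dg t)) ->
    (forall t, 0 <= t <= 1 -> Rabs (dg t) <= 2 * (k * Cmod (y - x))) ->
    Rabs (g 1 - g 0) <= 2 * k * Cmod (y - x)).
  { intros g dg D Hb. destruct (MVT_gen g 0 1 dg) as [t [Ht Et]].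
    - rewrite Rmin_left, Rmax_right by lra. intros t Ht. apply D. lra.
    - rewrite Rmin_left, Rmax_right by lra. intros t Ht. apply continuity_pt_filterlim.
      apply (ex_derive_continuous g t). exists (dg t). apply D. lra.
    - rewrite Rmin_left, Rmax_right in Ht by lra. rewrite Et, Rminus_0_r, Rmult_1_r.
      specialize (Hb t Ht). lra. }
  assert (S1 : s 1 = y) by (unfold s; ring). assert (S0 : s 0 = x) by (unfold s; ring).
  destruct i as [|[|i]].
  - replace (stereo 0 (Some (f y))) with (2 * U 1 / n 1)
      by (unfold stereo, n, U, V; rewrite Cmod2_alt, S1; reflexivity).
    replace (stereo 0 (Some (f x))) with (2 * U 0 / n 0)
      by (unfold stereo, n, U, V; rewrite Cmod2_alt, S0; reflexivity).
    apply (M (fun t => 2 * U t / n t)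
      (fun t => (2 * dU t * n t - 2 * U t * (2 * U t * dU t + 2 * V t * dV t)) / n t ^ 2)).
    + intros t Ht. apply (is_derive_stereo_coords U V); auto.
    + intros t Ht. destruct (B t Ht) as [B1 B2].
      apply (stereo_derivative_bound _ _ _ _ _ _ _ eq_refl B1); auto.
      apply Rmult_le_pos; apply Cmod_ge_0.
  (* Coordinate 1 is coordinate 0 with [U] and [V] exchanged. *)
  - set (n' := fun t => 1 + (V t ^ 2 + U t ^ 2)).
    assert (En : forall t, n t = n' t) by (intros t; unfold n, n'; ring).
    replace (stereo 1 (Some (f y))) with (2 * V 1 / n' 1)
      by (rewrite <- En; unfold stereo, n, U, V; rewrite Cmod2_alt, S1; reflexivity).
    replace (stereo 1 (Some (f x))) with (2 * V 0 / n' 0)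
      by (rewrite <- En; unfold stereo, n, U, V; rewrite Cmod2_alt, S0; reflexivity).
    apply (M (fun t => 2 * V t / n' t)
      (fun t => (2 * dV t * n' t - 2 * V t * (2 * V t * dV t + 2 * U t * dU t)) / n' t ^ 2)).
    + intros t Ht. apply (is_derive_stereo_coords V U); auto.
    + intros t Ht. destruct (B t Ht) as [B1 B2].
      rewrite (Rplus_comm (dU t ^ 2)) in B1. rewrite En in B2.
      apply (stereo_derivative_bound _ _ _ _ _ _ _ eq_refl B1); auto.
      apply Rmult_le_pos; apply Cmod_ge_0.
  - change (stereo (S (S i)) (Some (f y))) with (stereo 2 (Some (f y))).
    change (stereo (S (S i)) (Some (f x))) with (stereo 2 (Some (f x))).
    replace (stereo 2 (Some (f y))) with ((U 1 ^ 2 + V 1 ^ 2 - 1) / n 1)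
      by (unfold stereo, n, U, V; rewrite Cmod2_alt, S1; reflexivity).
    replace (stereo 2 (Some (f x))) with ((U 0 ^ 2 + V 0 ^ 2 - 1) / n 0)
      by (unfold stereo, n, U, V; rewrite Cmod2_alt, S0; reflexivity).
    apply (M (fun t => (U t ^ 2 + V t ^ 2 - 1) / n t)
      (fun t => ((2 * U t * dU t + 2 * V t * dV t) * n t
         - (U t ^ 2 + V t ^ 2 - 1) * (2 * U t * dU t + 2 * V t * dV t)) / n t ^ 2)).
    + intros t Ht. apply (is_derive_stereo_coords U V); auto.
    + intros t Ht. destruct (B t Ht) as [B1 B2].
      apply (stereo_derivative_bound _ _ _ _ _ _ _ eq_refl B1); auto.
      apply Rmult_le_pos; apply Cmod_ge_0.
Qed.

Lemma R_dense_sequence : exists q : nat -> R, forall x e, 0 < e -> exists m, Rabs (q m - x) < e.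
Proof.
  exists (fun m => let (a, k) := of_nat m in let (b, n) := of_nat k in (INR a - INR b) / (INR n + 1)).
  intros x e He. destruct (INR_unbounded (/ e)) as [n Hn].
  pose proof (pos_INR n) as Pn. pose proof (Rinv_0_lt_compat e He).
  (* The numerator may have either sign, so it is coded as a difference of two natural numbers, one
     of which is 0. *)
  set (k := up (x * (INR n + 1))). destruct (archimed (x * (INR n + 1))) as [A1 A2]. fold k in A1, A2.
  exists (to_nat (Z.to_nat k, to_nat (Z.to_nat (- k), n))). rewrite !cancel_of_to.
  replace (INR (Z.to_nat k) - INR (Z.to_nat (- k))) with (IZR k).
  2:{ rewrite !INR_IZR_INZ, <- minus_IZR. f_equal. lia. }
  replace (IZR k / (INR n + 1) - x) with ((IZR k - x * (INR n + 1)) / (INR n + 1)) by (field; lra).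
  unfold Rdiv. rewrite Rabs_mult, (Rabs_right (IZR k - x * (INR n + 1))) by lra.
  rewrite Rabs_right by (left; apply Rinv_0_lt_compat; lra).
  apply Rmult_lt_reg_r with (INR n + 1); [lra|]. rewrite Rmult_assoc, Rinv_l, Rmult_1_r by lra.
  assert (e * / e = 1) by (field; lra). nra.
Qed.

Lemma C_dense_sequence : exists q : nat -> C, forall z e, 0 < e -> exists m, Cmod (q m - z) < e.
Proof.
  destruct R_dense_sequence as [q Hq].
  exists (fun m => let (a, b) := of_nat m in (q a, q b)). intros [x y] e He.
  destruct (Hq x (e / 2)) as [a Ha]; [lra|]. destruct (Hq y (e / 2)) as [b Hb]; [lra|].
  exists (to_nat (a, b)). rewrite cancel_of_to.
  replace ((q a, q b) - (x, y))%C with (RtoC (q a - x) + Ci * RtoC (q b - y))%C.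
  2:{ unfold Ci, RtoC, Cminus, Cplus, Copp, Cmult; cbn [fst snd]. f_equal; ring. }
  eapply Rle_lt_trans; [apply Cmod_triangle|]. rewrite Cmod_mult, Cmod_Ci, !Cmod_R. lra.
Qed.

(** * Steep points and the Arzelà-Ascoli argument *)

Definition holo (f : C -> C) : Prop := forall z, exists d, cdiff f z d.

Definition Cderiv (f : C -> C) (z : C) : C := epsilon (inhabits (RtoC 0)) (fun d => cdiff f z d).

Lemma holo_Cderiv (f : C -> C) : holo f -> forall z, cdiff f z (Cderiv f z).
Proof. intros H z. exact (epsilon_spec (inhabits (RtoC 0)) (fun d => cdiff f z d) (H z)). Qed.

Definition steep_near (f : C -> C) (z : C) (r B : R) : Prop :=
  exists p, Cmod (p - z) < r /\ B < spherical_derivative f (Cderiv f) p.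

(** Its negation is Marty's criterion at [z] for a tail of the sequence: a bounded spherical
    derivative on some disc. *)
Definition frequently_steep (u : nat -> C -> C) (z : C) : Prop :=
  forall r B K, 0 < r -> exists k, (K <= k)%nat /\ steep_near (u k) z r B.

(** Unlike the frequent version, this passes to subsequences, so a single index can serve several
    points. *)
Definition eventually_steep (u : nat -> C -> C) (z : C) : Prop :=
  forall r B, 0 < r -> exists K, forall k, (K <= k)%nat -> steep_near (u k) z r B.

Lemma frequently_steep_subseq (u : nat -> C -> C) (z : C) : frequently_steep u z ->
  exists phi, strictly_incr phi /\ eventually_steep (fun k => u (phi k)) z.
Proof.
  intros H.
  destruct (frequently_subseq (fun n k => steep_near (u k) z (/ (INR n + 1)) (INR n))) as [phi [I Hphi]].
  - intros n N. apply H. pose proof (pos_INR n). apply Rinv_0_lt_compat. lra.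
  - exists phi. split; auto. intros r B Hr.
    destruct (INR_unbounded (Rmax (/ r) B)) as [K HK]. exists K. intros k Hk.
    apply le_INR in Hk. pose proof (Rmax_l (/ r) B). pose proof (Rmax_r (/ r) B).
    destruct (Hphi k) as [p [Hp1 Hp2]]. exists p. split; [|lra].
    eapply Rlt_trans; [exact Hp1|]. pose proof (Rinv_0_lt_compat r Hr).
    rewrite <- (Rinv_inv r). apply Rinv_lt_contravar; [nra|lra].
Qed.

Lemma eventually_steep_subseq (u : nat -> C -> C) (z : C) (phi : nat -> nat) :
  strictly_incr phi -> eventually_steep u z -> eventually_steep (fun k => u (phi k)) z.
Proof.
  intros I H r B Hr. destruct (H r B Hr) as [K HK]. exists K. intros k Hk. apply HK.
  pose proof (strictly_incr_ge phi k I). lia.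
Qed.

(** Discs are convex, so a bound on the spherical derivative integrates along segments to a
    Lipschitz bound for the stereographic coordinates. *)
Lemma not_steep_equicontinuous (u : nat -> C -> C) (z : C) : (forall k, holo (u k)) ->
  ~ frequently_steep u z -> exists r B K, 0 < r /\ 0 < B /\ forall k, (K <= k)%nat ->
    forall x y i, Cmod (x - z) <= r -> Cmod (y - z) <= r ->
      Rabs (stereo i (Some (u k y)) - stereo i (Some (u k x))) <= B * Cmod (y - x).
Proof.
  intros Hu H. apply NNPP. intros N. apply H. intros r B K Hr. apply NNPP. intros M. apply N.
  exists (r / 2), (2 * (Rabs B + 1)), K. pose proof (Rabs_pos B). repeat split; [lra|lra|].
  intros k Hk x y i Hx Hy. apply (stereo_lipschitz (u k) (Cderiv (u k))).
  intros t Ht. split; [apply holo_Cderiv; auto|]. apply Rnot_lt_le. intros L. apply M.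
  exists k. split; auto. exists (x + RtoC t * (y - x))%C. split.
  - pose proof (segment_dist x y z t (r / 2) Ht Hx Hy). lra.
  - pose proof (Rle_abs B). lra.
Qed.

Lemma open_Cball (z : C) (d : R) : @open C_UniformSpace (fun x : C => Cmod (x - z) < d).
Proof.
  intros x Hx.
  (* Balls of the uniform structure on [C] are squares, hence the factor [sqrt 2]. *)
  assert (S2 : 0 < sqrt 2) by (apply sqrt_lt_R0; lra).
  assert (P : 0 < (d - Cmod (x - z)) / sqrt 2) by (apply Rdiv_lt_0_compat; lra).
  exists (mkposreal _ P). intros y Hy. apply C_NormedModule_mixin_compat2 in Hy. simpl in Hy.
  replace (sqrt 2 * ((d - Cmod (x - z)) / sqrt 2)) with (d - Cmod (x - z)) in Hy by (field; lra).
  change (Cmod (y - x) < d - Cmod (x - z)) in Hy.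
  pose proof (Cmod_triangle_via x y z). lra.
Qed.

(** A diagonal subsequence makes the stereographic coordinates converge on a dense sequence, and
    equicontinuity near each point outside [S] spreads this to locally uniform convergence there. *)
Lemma convergent_subseq_off_steep (u : nat -> C -> C) (S : list C) : (forall k, holo (u k)) ->
  (forall z, ~ In z S -> ~ frequently_steep u z) ->
  exists phi g, strictly_incr phi /\ forall K : C -> Prop, compact_set K ->
    (forall z, K z -> ~ In z S) -> forall eps, 0 < eps -> exists N, forall k, (N <= k)%nat ->
      forall z, K z -> sphere_dist (Some (u (phi k) z)) (g z) < eps.
Proof.
  intros Hu HS. destruct C_dense_sequence as [q Hq].
  destruct (diagonal_subseq (fun m n => let (i, j) := of_nat m in stereo i (Some (u n (q j)))) 1)
    as [phi [I L]].
  { intros m n. destruct (of_nat m). apply stereo_bound. }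
  assert (Lq : forall i j, exists l, Un_cv (fun n => stereo i (Some (u (phi n) (q j)))) l).
  { intros i j. destruct (L (to_nat (i, j))) as [l Hl]. exists l. rewrite cancel_of_to in Hl. exact Hl. }
  assert (C1 : forall z i, ~ In z S -> forall e, 0 < e -> exists d N, 0 < d /\ forall x, Cmod (x - z) < d ->
    forall n m, (N <= n)%nat -> (N <= m)%nat ->
    Rabs (stereo i (Some (u (phi n) x)) - stereo i (Some (u (phi m) x))) < e).
  { intros z i Hz e He.
    destruct (not_steep_equicontinuous u z Hu (HS z Hz)) as [r [B [K [Hr [HB HK]]]]].
    set (d := Rmin r (e / (8 * B))). assert (Hd : 0 < d).
    { apply Rmin_pos; auto. apply Rdiv_lt_0_compat; lra. }
    assert (Hd1 : d <= r) by apply Rmin_l. assert (Hd2 : d <= e / (8 * B)) by apply Rmin_r.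
    assert (Hd3 : B * d <= e / 8).
    { apply Rmult_le_compat_l with (r := B) in Hd2; [|lra].
      replace (B * (e / (8 * B))) with (e / 8) in Hd2 by (field; lra). auto. }
    destruct (Hq z d Hd) as [j Hj]. destruct (Lq i j) as [l Hl].
    destruct (Hl (e / 8)) as [N HN]; [lra|].
    exists d, (max K N). split; auto. intros x Hx n m Hn Hm.
    assert (Dx : forall n, (max K N <= n)%nat ->
      Rabs (stereo i (Some (u (phi n) x)) - stereo i (Some (u (phi n) (q j)))) <= e / 4).
    { intros n' Hn'. eapply Rle_trans.
      - apply HK; try lra. pose proof (strictly_incr_ge phi n' I). lia.
      - pose proof (Cmod_triangle_via z x (q j)). rewrite (Cmod_minus_sym z) in H. nra. }
    pose proof (Dx n Hn) as A1. pose proof (Dx m Hm) as A2.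
    pose proof (HN n ltac:(lia)) as A3. pose proof (HN m ltac:(lia)) as A4. unfold Rdist in A3, A4.
    apply Rabs_le_between in A1, A2. apply Rabs_lt_between in A3, A4. apply Rabs_lt_between. lra. }
  assert (C2 : forall z i, ~ In z S -> exists l, Un_cv (fun n => stereo i (Some (u (phi n) z))) l).
  { intros z i Hz. destruct (Rcomplete.R_complete (fun n => stereo i (Some (u (phi n) z)))) as [l Hl].
    - intros e He. destruct (C1 z i Hz e He) as [d [N [Hd HN]]]. exists N. intros n m Hn Hm.
      apply HN; auto. rewrite Cmod_self_minus. auto.
    - exists l. auto. }
  (* On [S] the value [None] is a mere placeholder; this is why [good] below skips the points of [S]
     inside a disc. *)
  assert (C3 : forall z, exists p, ~ In z S -> forall i, (i < 3)%nat ->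
    Un_cv (fun n => stereo i (Some (u (phi n) z))) (stereo i p)).
  { intros z. destruct (classic (In z S)) as [Hz|Hz]; [exists None; tauto|].
    destruct (C2 z 0%nat Hz) as [a Ha]. destruct (C2 z 1%nat Hz) as [b Hb].
    destruct (C2 z 2%nat Hz) as [c Hc].
    assert (E : a ^ 2 + b ^ 2 + c ^ 2 = 1).
    { apply (UL_sequence (fun n => stereo 0 (Some (u (phi n) z)) * stereo 0 (Some (u (phi n) z))
        + stereo 1 (Some (u (phi n) z)) * stereo 1 (Some (u (phi n) z))
        + stereo 2 (Some (u (phi n) z)) * stereo 2 (Some (u (phi n) z)))).
      - replace (a ^ 2 + b ^ 2 + c ^ 2) with (a * a + b * b + c * c) by ring.
        repeat apply CV_plus; apply CV_mult; auto.
      - intros e He. exists 0%nat. intros n _. pose proof (stereo_sphere (u (phi n) z)) as E.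
        unfold Rdist. replace (_ - 1) with 0 by (rewrite <- E; ring). rewrite Rabs_R0. auto. }
    destruct (stereo_onto a b c E) as [p [<- [<- <-]]]. exists p. intros _ i Hi.
    destruct i as [|[|[|i]]]; auto. }
  destruct (choice _ C3) as [g Hg]. exists phi, g. split; auto.
  intros K HK HKS eps Heps.
  set (good := fun z d N => 0 < d /\ forall x, Cmod (x - z) < d -> ~ In x S -> forall n, (N <= n)%nat ->
     sphere_dist (Some (u (phi n) x)) (g x) < eps).
  assert (C4 : forall z, ~ In z S -> exists d N, good z d N).
  { intros z Hz.
    destruct (C1 z 0%nat Hz (eps / 6)) as [d0 [N0 [P0 H0]]]; [lra|].
    destruct (C1 z 1%nat Hz (eps / 6)) as [d1 [N1 [P1 H1]]]; [lra|].
    destruct (C1 z 2%nat Hz (eps / 6)) as [d2 [N2 [P2 H2]]]; [lra|].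
    exists (Rmin d0 (Rmin d1 d2)), (max N0 (max N1 N2)).
    split; [repeat (apply Rmin_pos; auto)|]. intros x Hx HxS n Hn.
    assert (X0 := Rlt_le_trans _ _ _ Hx (Rmin_l _ _)).
    assert (X' := Rlt_le_trans _ _ _ Hx (Rmin_r _ _)).
    assert (X1 := Rlt_le_trans _ _ _ X' (Rmin_l _ _)).
    assert (X2 := Rlt_le_trans _ _ _ X' (Rmin_r _ _)).
    assert (Lim : forall i N, (i < 3)%nat -> (forall m, (N <= m)%nat ->
       Rabs (stereo i (Some (u (phi n) x)) - stereo i (Some (u (phi m) x))) < eps / 6) ->
       Rabs (stereo i (Some (u (phi n) x)) - stereo i (g x)) < eps / 3).
    { intros i N Hi HN. destruct (Hg x HxS i Hi (eps / 6)) as [M HM]; [lra|].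
      specialize (HN (max N M) ltac:(lia)). specialize (HM (max N M) ltac:(lia)). unfold Rdist in HM.
      apply Rabs_lt_between in HN, HM. apply Rabs_lt_between. lra. }
    eapply Rle_lt_trans; [apply sphere_dist_le_stereo|].
    pose proof (Lim 0%nat N0 ltac:(lia) (fun m Hm => H0 x X0 n m ltac:(lia) Hm)).
    pose proof (Lim 1%nat N1 ltac:(lia) (fun m Hm => H1 x X1 n m ltac:(lia) Hm)).
    pose proof (Lim 2%nat N2 ltac:(lia) (fun m Hm => H2 x X2 n m ltac:(lia) Hm)). lra. }
  (* The cover is indexed by all triples of centre, radius and threshold; triples that are not
     [good] contribute the empty set. *)
  destruct (HK (C * R * nat)%type (fun t x => good (fst (fst t)) (snd (fst t)) (snd t)
      /\ Cmod (x - fst (fst t)) < snd (fst t))) as [l Hl].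
  - intros t. destruct (classic (good (fst (fst t)) (snd (fst t)) (snd t))) as [Gd|Gd].
    + intros x [_ Hx]. destruct (open_Cball _ _ x Hx) as [e He]. exists e. intros y Hy. split; auto.
    + intros x [Hx _]. contradiction.
  - intros x Hx. destruct (C4 x (HKS x Hx)) as [d [N HN]]. exists (x, d, N). simpl. split; auto.
    rewrite Cmod_self_minus. apply HN.
  - exists (list_max (map snd l)). intros k Hk z Hz. destruct (Hl z Hz) as [t [Ht [[_ Gd] Hzt]]].
    apply Gd; auto. eapply Nat.le_trans; [|exact Hk].
    pose proof (proj1 (list_max_le (map snd l) (list_max (map snd l))) (le_n _)) as F.
    rewrite Forall_forall in F. apply F. apply in_map. auto.
Qed.

Lemma exists_steep_points (Fam : (C -> C) -> Prop) (N : nat) : (forall h, Fam h -> holo h) ->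
  ~ quasi_normal (fun _ => True) Fam ->
  exists (u : nat -> C -> C) (S : list C), (forall k, Fam (u k)) /\ NoDup S /\ length S = N /\
    forall z, In z S -> eventually_steep u z.
Proof.
  intros HF Hq. apply not_all_ex_not in Hq. destruct Hq as [s Hs].
  apply imply_to_and in Hs. destruct Hs as [Hs1 Hs2].
  assert (K : exists phi S, strictly_incr phi /\ NoDup S /\ length S = N /\
    forall z, In z S -> eventually_steep (fun k => s (phi k)) z).
  { induction N as [|N [phi [S [I [HS1 [HS2 HS3]]]]]].
    - exists (fun n => n), nil. split; [apply strictly_incr_id|]. split; [constructor|].
      split; auto. intros z [].
    - destruct (classic (exists z, ~ In z S /\ frequently_steep (fun k => s (phi k)) z)) as [[z [Hz Hst]]|Hno].
      (* Thinning out makes the new point steep for all large indices and keeps the earlier points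
         so. *)
      + destruct (frequently_steep_subseq _ _ Hst) as [psi [Ipsi Hpsi]].
        exists (fun n => phi (psi n)), (z :: S). split; [apply strictly_incr_comp; auto|].
        split; [constructor; auto|]. split; [simpl; auto|].
        intros x [<-|Hx]; [exact Hpsi|].
        apply (eventually_steep_subseq (fun k => s (phi k))); auto.
      + exfalso. apply Hs2.
        destruct (convergent_subseq_off_steep (fun k => s (phi k)) S) as [psi [g [Ipsi Hg]]].
        * intros k. apply HF, Hs1.
        * intros z Hz Hst. apply Hno. eauto.
        * exists S, (fun n => phi (psi n)), g. split; auto.
          split; [apply strictly_incr_comp; auto|]. intros K HK HKS. apply Hg; auto.
          intros z Hz. apply (HKS z Hz). }
  destruct K as [phi [S [_ [H1 [H2 H3]]]]]. exists (fun k => s (phi k)), S. auto.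
Qed.

(** * Branching itineraries and shadowing *)

Lemma island_weaken (f : C -> C) (z z' a : C) (r r' eta eta' : R) :
  eta' <= eta -> Cmod (z - z') + r <= r' -> island f z r a eta -> island f z' r' a eta'.
Proof.
  intros He Hr [p [s [c [H1 [H2 [H3 [H4 H5]]]]]]]. exists p, s, c. repeat split; auto.
  - pose proof (Cmod_triangle_via z p z'). lra.
  - lra.
Qed.

Lemma uniform_constants {T : Type} (l : list T) (P : T -> R -> R -> Prop) :
  (forall a eta K eta' K', P a eta K -> 0 < eta' <= eta -> K <= K' -> P a eta' K') ->
  (forall a, In a l -> exists eta K, 0 < eta /\ 0 < K /\ P a eta K) ->
  exists eta K, 0 < eta /\ 0 < K /\ forall a, In a l -> P a eta K.
Proof.
  intros Hm. induction l as [|b l IH]; intros H.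
  - exists 1, 1. repeat split; try lra. intros a [].
  - destruct IH as [eta [K [H1 [H2 H3]]]]; [intros a Ha; apply H; right; auto|].
    destruct (H b (or_introl eq_refl)) as [eta' [K' [H1' [H2' H3']]]].
    pose proof (Rmin_l eta eta'). pose proof (Rmin_r eta eta').
    pose proof (Rmax_l K K'). pose proof (Rmax_r K K').
    assert (0 < Rmin eta eta') by (apply Rmin_pos; auto).
    exists (Rmin eta eta'), (Rmax K K'). split; [auto|]. split; [lra|].
    intros a [<-|Ha].
    + apply (Hm b eta' K'); [auto|lra|lra].
    + apply (Hm a eta K); [auto|lra|lra].
Qed.

Lemma finitely_many_lists {T : Type} (l : list T) (n : nat) :
  exists LL : list (list T), forall A, length A = n -> incl A l -> In A LL.
Proof.
  induction n as [|n [LL H]].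
  - exists (nil :: nil). intros A HA _. destruct A; [left; auto|discriminate].
  - exists (flat_map (fun A => map (fun a => a :: A) l) LL). intros A HA Hi.
    destruct A as [|a A]; [discriminate|]. apply in_flat_map. exists A. split.
    + apply H; [simpl in HA; lia|]. intros x Hx. apply Hi. right. auto.
    + apply (in_map (fun a => a :: A)). apply Hi. left. auto.
Qed.

(** The constants of [no_island_bound] depend on the 64 values, but only finitely many lists of 64
    values can be drawn from [l], so one pair [eta], [K] serves them all. *)
Lemma few_values_without_island (l : list C) : exists eta K, 0 < eta /\ 0 < K /\
  forall f p r, holo f -> 0 < r -> K / r < spherical_derivative f (Cderiv f) p ->
    forall A, NoDup A -> incl A l -> (forall a, In a A -> ~ island f p r a eta) -> (length A < 64)%nat.
Proof.
  destruct (finitely_many_lists l 64) as [LL HLL].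
  destruct (uniform_constants LL (fun A eta K => length A = 64%nat -> NoDup A ->
    forall f p r, holo f -> 0 < r -> (forall a, In a A -> ~ island f p r a eta) ->
      spherical_derivative f (Cderiv f) p <= K / r)) as [eta [K [H1 [H2 H3]]]].
  - intros A eta K eta' K' H He HK Hl Hnd f p r Hf Hr Hi.
    apply Rle_trans with (K / r).
    + apply H; auto. intros a Ha Hia. apply (Hi a Ha).
      apply (island_weaken f p p a r r eta eta'); [lra|rewrite Cmod_self_minus; lra|auto].
    + apply Rmult_le_compat_r; auto. left. apply Rinv_0_lt_compat; auto.
  - intros A _. destruct (classic (length A = 64%nat /\ NoDup A)) as [[Hl Hnd]|N].
    + destruct (no_island_bound A Hl Hnd) as [eta [K [H1 [H2 H3]]]]. exists eta, K.
      split; [auto|]. split; [auto|]. intros _ _ f p r Hf Hr Hi.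
      apply H3; auto. apply holo_Cderiv; auto.
    + exists 1, 1. split; [lra|]. split; [lra|]. tauto.
  - exists eta, K. split; [auto|]. split; [auto|]. intros f p r Hf Hr Hs A Hnd Hincl Hi.
    apply Nat.lt_nge. intros L.
    assert (Hin : forall x, In x (firstn 64 A) -> In x A).
    { intros x Hx. rewrite <- (firstn_skipn 64 A). apply in_or_app. auto. }
    assert (Hlen : length (firstn 64 A) = 64%nat) by (rewrite length_firstn; lia).
    assert (spherical_derivative f (Cderiv f) p <= K / r); [|lra].
    apply (H3 (firstn 64 A)); auto.
    + apply HLL; auto. intros x Hx. auto.
    + rewrite <- (firstn_skipn 64 A) in Hnd. apply NoDup_app_remove_r in Hnd. auto.
Qed.

(** [w] is the previous position and [z] the current one. An island over [x + delta * w] says that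
    some point near [z] has image [x + delta * w], so that the recurrence can continue at [x]. *)
Definition branching (h : C -> C) (delta : C) (S : list C) (rho eta : R) (L : nat)
    (nxt : C -> C -> list C) : Prop :=
  forall w z, In w S -> In z S -> length (nxt w z) = L /\ NoDup (nxt w z) /\ incl (nxt w z) S /\
    forall x, In x (nxt w z) -> island h z rho (x + delta * w)%C eta.

Lemma eventually_all_list {T : Type} (l : list T) (P : T -> nat -> Prop) :
  (forall a, In a l -> exists K, forall k, (K <= k)%nat -> P a k) ->
  exists K, forall k, (K <= k)%nat -> forall a, In a l -> P a k.
Proof.
  induction l as [|b l IH]; intros H.
  - exists 0%nat. intros k _ a [].
  - destruct IH as [K HK]; [intros a Ha; apply H; right; auto|].
    destruct (H b (or_introl eq_refl)) as [K' HK']. exists (max K K').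
    intros k Hk a [<-|Ha]; [apply HK'; lia|apply HK; auto; lia].
Qed.

Lemma exists_branching (Fam : (C -> C) -> Prop) (delta : C) (L : nat) :
  (forall h, Fam h -> holo h) -> ~ quasi_normal (fun _ => True) Fam ->
  exists h S d rho eta nxt, Fam h /\ S <> nil /\ 0 < d /\
    (forall x y, In x S -> In y S -> x <> y -> d <= Cmod (x - y)) /\
    0 < rho <= d / 4 /\ 0 < eta /\ (1 + Cmod delta) * rho <= eta / 2 /\
    branching h delta S rho eta L nxt.
Proof.
  intros HF Hq. destruct (exists_steep_points Fam (L + 63) HF Hq) as [u [S [Hu [HS1 [HS2 HS3]]]]].
  destruct (separation S) as [d [Hd Hsep]].
  destruct (uniform_constants S (fun w eta K => forall f p r, holo f -> 0 < r ->
    K / r < spherical_derivative f (Cderiv f) p ->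
    forall A, NoDup A -> incl A (map (fun x => x + delta * w)%C S) ->
      (forall a, In a A -> ~ island f p r a eta) -> (length A < 64)%nat)) as [eta [K [He [HK HA]]]].
  { intros w eta K eta' K' H He HK f p r Hf Hr Hs A Hnd Hi Hisl. apply (H f p r); auto.
    - eapply Rle_lt_trans; [|exact Hs]. apply Rmult_le_compat_r; auto. left. apply Rinv_0_lt_compat; auto.
    - intros a Ha Hia. apply (Hisl a Ha).
      apply (island_weaken f p p a r r eta eta'); [lra|rewrite Cmod_self_minus; lra|auto]. }
  { intros w _. apply few_values_without_island. }
  pose proof (Cmod_ge_0 delta) as Pd.
  (* The first bound keeps the discs around distinct positions apart, the second keeps the error of
     [x + delta * w] under [rho]-perturbations below [eta / 2]. *)
  set (rho := Rmin (d / 4) (eta / (2 * (1 + Cmod delta)))).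
  assert (Hrho : 0 < rho). { apply Rmin_pos; [lra|]. apply Rdiv_lt_0_compat; lra. }
  assert (Hrho1 : rho <= d / 4) by apply Rmin_l.
  assert (Hrho2 : (1 + Cmod delta) * rho <= eta / 2).
  { assert (K2 : rho <= eta / (2 * (1 + Cmod delta))) by apply Rmin_r.
    apply Rmult_le_compat_l with (r := 1 + Cmod delta) in K2; [|lra].
    replace ((1 + Cmod delta) * (eta / (2 * (1 + Cmod delta)))) with (eta / 2) in K2 by (field; lra). auto. }
  (* A steep point lies within [rho / 2] of [z] and its islands within [rho / 2] of that point,
     hence within [rho] of [z]. *)
  set (r := rho / 2).
  destruct (eventually_all_list S (fun z k => steep_near (u k) z r (K / r))) as [k0 Hk0].
  { intros z Hz. apply HS3; auto. unfold r. lra. }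
  set (h := u k0). assert (Hh : holo h) by (apply HF, Hu).
  assert (Hbr : forall w z, exists l, In w S -> In z S -> length l = L /\ NoDup l /\ incl l S /\
    forall x, In x l -> island h z rho (x + delta * w)%C eta).
  { intros w z. destruct (classic (In w S /\ In z S)) as [[Hw Hz]|N]; [|exists nil; tauto].
    set (b := fun x => if excluded_middle_informative (island h z rho (x + delta * w)%C eta) then true else false).
    assert (Hlt : (length (filter (fun x => negb (b x)) S) < 64)%nat).
    { destruct (Hk0 k0 (le_n _) z Hz) as [p [Hp1 Hp2]].
      rewrite <- (length_map (fun x => x + delta * w)%C).
      apply (HA w Hw h p r); auto; [unfold r; lra| | |].
      - apply Injective_map_NoDup.
        + intros x y E. replace x with ((x + delta * w) - delta * w)%C by ring. rewrite E. ring.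
        + apply NoDup_filter; auto.
      - intros a Ha. apply in_map_iff in Ha. destruct Ha as [x [<- Hx]]. apply filter_In in Hx.
        apply (in_map (fun x => x + delta * w)%C). tauto.
      - intros a Ha Hia. apply in_map_iff in Ha. destruct Ha as [x [<- Hx]]. apply filter_In in Hx.
        destruct Hx as [_ Hx]. unfold b in Hx.
        destruct (excluded_middle_informative _) as [|N]; [discriminate|]. apply N.
        apply (island_weaken h p z _ r rho eta eta); [lra|unfold r in *; lra|auto]. }
    pose proof (filter_length b S) as E.
    exists (firstn L (filter b S)). intros _ _.
    assert (Hin : forall x, In x (firstn L (filter b S)) -> In x (filter b S)).
    { intros x Hx. rewrite <- (firstn_skipn L (filter b S)). apply in_or_app. auto. }
    split; [rewrite length_firstn; lia|]. split; [|split].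
    - pose proof (NoDup_filter b HS1) as Nd. rewrite <- (firstn_skipn L (filter b S)) in Nd.
      apply NoDup_app_remove_r in Nd. auto.
    - intros x Hx. apply Hin, filter_In in Hx. tauto.
    - intros x Hx. apply Hin, filter_In in Hx. destruct Hx as [_ Hx]. unfold b in Hx.
      destruct (excluded_middle_informative _) as [|N]; [auto|discriminate]. }
  destruct (choice (fun wz l => In (fst wz) S -> In (snd wz) S -> length l = L /\ NoDup l /\ incl l S /\
    forall x, In x l -> island h (snd wz) rho (x + delta * fst wz)%C eta)) as [nxt Hnxt].
  { intros [w z]. apply Hbr. }
  exists h, S, d, rho, eta, (fun w z => nxt (w, z)). split; [apply Hu|].
  split. { intros ->. simpl in HS2. lia. }
  split; [lra|]. split; [auto|]. split; [lra|]. split; [auto|]. split; [auto|].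
  intros w z Hw Hz. apply (Hnxt (w, z)); auto.
Qed.

(** Newton-like iteration [x - (h x - b) / c] on every island simultaneously is a
    contraction in the supremum norm. *)
Lemma shadowing (h : C -> C) (delta : C) (rho eta : R) (sigma : nat -> C) :
  (forall z, ccont h z) -> 0 < rho -> 0 < eta -> (1 + Cmod delta) * rho <= eta / 2 ->
  (forall t, island h (sigma (S t)) rho (sigma (S (S t)) + delta * sigma t)%C eta) ->
  exists zeta : nat -> C, (forall t, Cmod (zeta t - sigma t) <= rho) /\
    forall t, zeta (S (S t)) = (h (zeta (S t)) - delta * zeta t)%C.
Proof.
  intros Hc Hrho Heta Hsmall Hisl.
  destruct (choice _ Hisl) as [p Hp]. destruct (choice _ Hp) as [s Hs]. destruct (choice _ Hs) as [c Hcc].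
  clear Hp Hs Hisl.
  pose proof (Cmod_ge_0 delta) as Pd.
  (* Row 0 puts position [t + 1] at the centre of its island. Position 0 is never corrected: it is
     the free initial value. *)
  set (Z := fix Z (m t : nat) {struct m} : C := match t with
    | O => sigma 0%nat
    | S t' => match m with
      | O => p t'
      | S m' => (Z m' (S t') - (h (Z m' (S t')) - Z m' (S (S t')) - delta * Z m' t') / c t')%C
      end end).
  assert (Z0 : forall m, Z m 0%nat = sigma 0%nat) by (intros []; auto).
  assert (ZS : forall m t, Z (S m) (S t) =
    (Z m (S t) - (h (Z m (S t)) - Z m (S (S t)) - delta * Z m t) / c t)%C) by reflexivity.
  (* The covering condition with [s t <= rho] gives [|c t| >= 2 * eta / rho], and
     [eta >= 2 * (1 + |delta|) * rho]. *)
  assert (Pc : forall t, 4 * (1 + Cmod delta) <= Cmod (c t)).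
  { intros t. destruct (Hcc t) as [H1 [H2 [H3 [H4 _]]]]. apply Cmod_gt_0 in H2.
    pose proof (Cmod_ge_0 (p t - sigma (S t))). pose proof (Cmod_ge_0 (h (p t) - (sigma (S (S t)) + delta * sigma t))).
    apply Rmult_le_reg_r with rho; auto. nra. }
  (* Half of [s t] pays for the nonlinearity of [h], the other half for the distance from [h (p t)]
     to the perturbed target, by the covering condition. *)
  assert (Inv : forall m t, Cmod (Z m (S t) - p t) <= s t).
  { assert (Near : forall m, (forall t, Cmod (Z m (S t) - p t) <= s t) -> forall t, Cmod (Z m t - sigma t) <= rho).
    { intros m H [|t]; [rewrite Z0, Cmod_self_minus; lra|].
      destruct (Hcc t) as [_ [_ [H3 _]]]. pose proof (Cmod_triangle_via (p t) (Z m (S t)) (sigma (S t))).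
      specialize (H t). lra. }
    induction m as [|m IH]; intros t; destruct (Hcc t) as [H1 [H2 [H3 [H4 H5]]]].
    - simpl. rewrite Cmod_self_minus. lra.
    - rewrite ZS. specialize (Near m IH). pose proof (Near t) as A1. pose proof (Near (S (S t))) as A2.
      specialize (IH t). specialize (H5 (Z m (S t)) (p t) IH ltac:(rewrite Cmod_self_minus; lra)).
      assert (Pct := proj1 (Cmod_gt_0 _) H2).
      set (x := Z m (S t)) in *. set (a := (sigma (S (S t)) + delta * sigma t)%C) in *.
      set (b := (Z m (S (S t)) + delta * Z m t)%C).
      assert (Hb : Cmod (a - b) <= eta).
      { unfold a, b. replace (sigma (S (S t)) + delta * sigma t - (Z m (S (S t)) + delta * Z m t))%C
          with (- ((Z m (S (S t)) - sigma (S (S t))) + delta * (Z m t - sigma t)))%C by ring.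
        rewrite Cmod_opp. eapply Rle_trans; [apply Cmod_triangle|]. rewrite Cmod_mult. nra. }
      replace (x - (h x - Z m (S (S t)) - delta * Z m t) / c t - p t)%C with
        ((- (h x - h (p t) - c t * (x - p t)) - (h (p t) - b)) / c t)%C by (unfold b; field; auto).
      rewrite Cmod_div by auto. apply Rmult_le_reg_r with (Cmod (c t)); auto.
      unfold Rdiv at 1. rewrite Rmult_assoc, Rinv_l, Rmult_1_r by lra.
      eapply Rle_trans; [apply Cmod_triangle_minus|]. rewrite Cmod_opp.
      pose proof (Cmod_triangle_via a (h (p t)) b).
      assert (Cmod (c t) * Cmod (x - p t) <= Cmod (c t) * s t) by (apply Rmult_le_compat_l; lra).
      lra. }
  assert (Near : forall m t, Cmod (Z m t - sigma t) <= rho).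
  { intros m [|t]; [rewrite Z0, Cmod_self_minus; lra|].
    destruct (Hcc t) as [_ [_ [H3 _]]]. pose proof (Cmod_triangle_via (p t) (Z m (S t)) (sigma (S t))).
    specialize (Inv m t). lra. }
  (* The rate [3 / 4] is [1 / 2] from the nonlinearity on the island plus
     [(1 + |delta|) / |c t| <= 1 / 4] from the neighbouring positions. *)
  assert (Contr : forall m t, Cmod (Z (S m) t - Z m t) <= 2 * rho * (3 / 4) ^ m).
  { induction m as [|m IH]; intros t.
    - pose proof (Near 1%nat t). pose proof (Near 0%nat t).
      pose proof (Cmod_triangle_via (sigma t) (Z 1%nat t) (Z 0%nat t)).
      rewrite (Cmod_minus_sym (sigma t)) in H1. simpl pow. lra.
    - destruct t as [|t]; [rewrite !Z0, Cmod_self_minus; apply Rmult_le_pos; [lra|apply pow_le; lra]|].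
      destruct (Hcc t) as [H1 [H2 [_ [_ H5]]]].
      specialize (H5 (Z (S m) (S t)) (Z m (S t)) (Inv (S m) t) (Inv m t)).
      assert (Pct := proj1 (Cmod_gt_0 _) H2). specialize (Pc t).
      pose proof (IH (S t)) as A1. pose proof (IH (S (S t))) as A2. pose proof (IH t) as A0.
      pose proof (ZS m t) as Ey. rewrite (ZS (S m) t).
      set (x := Z (S m) (S t)) in *. set (y := Z m (S t)) in *.
      set (x2 := Z (S m) (S (S t))) in *. set (y2 := Z m (S (S t))) in *.
      set (x0 := Z (S m) t) in *. set (y0 := Z m t) in *. set (q := 2 * rho * (3 / 4) ^ m) in *.
      assert (Ey' : h y = (c t * (y - x) + y2 + delta * y0)%C) by (rewrite Ey; field; auto).
      replace (x - (h x - x2 - delta * x0) / c t - x)%C with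
        ((- (h x - h y - c t * (x - y)) + ((x2 - y2) + delta * (x0 - y0))) / c t)%C
        by (rewrite Ey'; field; auto).
      rewrite Cmod_div by auto. apply Rmult_le_reg_r with (Cmod (c t)); auto.
      unfold Rdiv at 1. rewrite Rmult_assoc, Rinv_l, Rmult_1_r by lra.
      eapply Rle_trans; [apply Cmod_triangle|]. rewrite Cmod_opp.
      pose proof (Cmod_triangle (x2 - y2) (delta * (x0 - y0))) as A3. rewrite Cmod_mult in A3.
      assert (Pq : 0 <= q) by (eapply Rle_trans; [apply Cmod_ge_0|exact A0]).
      replace (2 * rho * (3 / 4) ^ S m) with (3 / 4 * q) by (unfold q; simpl; ring).
      assert (Cmod (c t) * Cmod (x - y) <= Cmod (c t) * q) by (apply Rmult_le_compat_l; lra).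
      assert (Cmod delta * Cmod (x0 - y0) <= Cmod delta * q) by (apply Rmult_le_compat_l; lra).
      assert (4 * (1 + Cmod delta) * q <= Cmod (c t) * q) by (apply Rmult_le_compat_r; lra).
      lra. }
  assert (Tail : forall m k t, Cmod (Z (m + k)%nat t - Z m t) <= 8 * rho * (3 / 4) ^ m).
  { intros m k t.
    assert (K : Cmod (Z (m + k)%nat t - Z m t) <= 8 * rho * ((3 / 4) ^ m - (3 / 4) ^ (m + k))).
    { induction k as [|k IH]; [rewrite Nat.add_0_r, Cmod_self_minus; lra|].
      rewrite Nat.add_succ_r. pose proof (Contr (m + k)%nat t).
      pose proof (Cmod_triangle_via (Z (m + k)%nat t) (Z (S (m + k)) t) (Z m t)). simpl pow. lra. }
    assert (0 < (3 / 4) ^ (m + k)) by (apply pow_lt; lra). nra. }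
  assert (Small : forall e, 0 < e -> exists N, forall m, (N <= m)%nat -> 8 * rho * (3 / 4) ^ m < e).
  { intros e He. destruct (pow_lt_1_zero (3 / 4)) with (y := e / (8 * rho)) as [N HN].
    - rewrite Rabs_right; lra.
    - apply Rdiv_lt_0_compat; lra.
    - exists N. intros m Hm. specialize (HN m Hm). rewrite Rabs_right in HN by (left; apply pow_lt; lra).
      apply Rmult_lt_compat_l with (r := 8 * rho) in HN; [|lra].
      replace (8 * rho * (e / (8 * rho))) with e in HN by (field; lra). lra. }
  assert (Lim : forall t, exists l, forall e, 0 < e -> exists N, forall m, (N <= m)%nat -> Cmod (Z m t - l) < e).
  { intros t. apply C_complete. intros e He. destruct (Small (e / 2)) as [N HN]; [lra|].
    exists N. intros n m Hn Hm. specialize (HN N (le_n N)).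
    pose proof (Tail N (n - N)%nat t) as A1. pose proof (Tail N (m - N)%nat t) as A2.
    replace (N + (n - N))%nat with n in A1 by lia. replace (N + (m - N))%nat with m in A2 by lia.
    pose proof (Cmod_triangle_via (Z N t) (Z n t) (Z m t)). rewrite (Cmod_minus_sym (Z N t)) in H. lra. }
  destruct (choice _ Lim) as [zeta Hz]. exists zeta. split.
  - intros t. apply Rnot_lt_le. intros L. destruct (Hz t (Cmod (zeta t - sigma t) - rho)) as [N HN]; [lra|].
    specialize (HN N (le_n N)). pose proof (Cmod_triangle_via (Z N t) (zeta t) (sigma t)).
    rewrite (Cmod_minus_sym (zeta t) (Z N t)) in H. pose proof (Near N t). lra.
  (* The residual [e] splits into the continuity error of [h], one correction step and the errors at
     times [t] and [t + 2]; each is at most [e / 4], two of them strictly. *)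
  - intros t. symmetry. apply Cmod_minus_0_eq. apply Rnot_lt_le. intros L.
    set (e := Cmod (h (zeta (S t)) - delta * zeta t - zeta (S (S t)))) in *.
    pose proof (Cmod_ge_0 (c t)) as Pct.
    destruct (Hc (zeta (S t)) (e / 4)) as [d [Pdd Hd]]; [lra|].
    destruct (Hz (S t) d Pdd) as [N1 HN1].
    destruct (Hz (S (S t)) (e / 4)) as [N2 HN2]; [lra|].
    destruct (Hz t (e / (4 * (1 + Cmod delta)))) as [N0 HN0]; [apply Rdiv_lt_0_compat; lra|].
    destruct (Small (e / (4 * (1 + Cmod (c t))))) as [N3 HN3]; [apply Rdiv_lt_0_compat; lra|].
    set (m := max (max N0 N1) (max N2 N3)).
    specialize (HN0 m ltac:(lia)). specialize (HN1 m ltac:(lia)). specialize (HN2 m ltac:(lia)).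
    specialize (HN3 m ltac:(lia)). specialize (Hd _ HN1).
    pose proof (Tail m 1%nat (S t)) as A. rewrite Nat.add_1_r in A.
    assert (A' : Cmod (Z (S m) (S t) - Z m (S t)) < e / (4 * (1 + Cmod (c t)))) by lra.
    pose proof (ZS m t) as E. destruct (Hcc t) as [_ [Nc _]].
    set (x := Z m (S t)) in *. set (x' := Z (S m) (S t)) in *. set (x2 := Z m (S (S t))) in *. set (x0 := Z m t) in *.
    assert (Ex : h x = (c t * (x - x') + x2 + delta * x0)%C) by (rewrite E; field; auto).
    assert (EE : (h (zeta (S t)) - delta * zeta t - zeta (S (S t)) =
      (h (zeta (S t)) - h x) + c t * (x - x') + delta * (x0 - zeta t) + (x2 - zeta (S (S t))))%C)
      by (rewrite Ex; ring).
    assert (Hle : e <= Cmod (h x - h (zeta (S t))) + Cmod (c t) * Cmod (x' - x)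
       + Cmod delta * Cmod (x0 - zeta t) + Cmod (x2 - zeta (S (S t)))).
    { unfold e. rewrite EE. eapply Rle_trans; [apply Cmod_triangle|]. apply Rplus_le_compat_r.
      eapply Rle_trans; [apply Cmod_triangle|]. rewrite Cmod_mult. apply Rplus_le_compat_r.
      eapply Rle_trans; [apply Cmod_triangle|]. rewrite Cmod_mult.
      rewrite (Cmod_minus_sym x x'), (Cmod_minus_sym (h x)). lra. }
    assert (B1 : Cmod (c t) * Cmod (x' - x) <= e / 4).
    { apply Rle_trans with ((1 + Cmod (c t)) * (e / (4 * (1 + Cmod (c t))))).
      - apply Rmult_le_compat; try lra. apply Cmod_ge_0.
      - right. field. lra. }
    assert (B2 : Cmod delta * Cmod (x0 - zeta t) <= e / 4).
    { apply Rle_trans with ((1 + Cmod delta) * (e / (4 * (1 + Cmod delta)))).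
      - apply Rmult_le_compat; try lra. apply Cmod_ge_0.
      - right. field. lra. }
    lra.
Qed.

(** * Entropy *)

Lemma digits_inj (L T j j' : nat) : (j < L ^ T)%nat -> (j' < L ^ T)%nat ->
  (forall t, (t < T)%nat -> ((j / L ^ t) mod L = (j' / L ^ t) mod L)%nat) -> j = j'.
Proof.
  revert j j'. induction T as [|T IH]; intros j j' Hj Hj' H; [simpl in *; lia|].
  simpl in Hj, Hj'. assert (HL : L <> 0%nat) by (intros ->; simpl in *; lia).
  assert (E : (j / L = j' / L)%nat).
  { apply IH.
    - apply Nat.Div0.div_lt_upper_bound; lia.
    - apply Nat.Div0.div_lt_upper_bound; lia.
    - intros t Ht. rewrite !Nat.Div0.div_div. apply (H (S t)). lia. }
  specialize (H 0%nat ltac:(lia)). rewrite Nat.pow_0_r, !Nat.div_1_r in H.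
  rewrite (Nat.div_mod_eq j L), (Nat.div_mod_eq j' L), E, H. auto.
Qed.

(** A state is the pair of previous and current position. The default [w] of [nth] is never met when
    [nxt] is branching and the digits are below [L]. *)
Fixpoint itinerary (nxt : C -> C -> list C) (w z : C) (chi : nat -> nat) (t : nat) : C * C :=
  match t with
  | O => (w, z)
  | S t' => (snd (itinerary nxt w z chi t'),
      nth (chi t') (nxt (fst (itinerary nxt w z chi t')) (snd (itinerary nxt w z chi t'))) w)
  end.

Lemma itinerary_in (h : C -> C) (delta : C) (S : list C) (rho eta : R) (L : nat)
    (nxt : C -> C -> list C) (w z : C) (chi : nat -> nat) :
  branching h delta S rho eta L nxt -> In w S -> In z S -> (forall t, (chi t < L)%nat) ->
  forall t, In (fst (itinerary nxt w z chi t)) S /\ In (snd (itinerary nxt w z chi t)) S.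
Proof.
  intros Hb Hw Hz Hchi. induction t as [|t [IH1 IH2]]; simpl; auto. split; auto.
  destruct (Hb _ _ IH1 IH2) as [H1 [H2 [H3 _]]]. apply H3, nth_In. rewrite H1. auto.
Qed.

(** Equal current positions give equal states, and successor lists have no repetitions, so each
    choice can be read off the next position. *)
Lemma itinerary_inj (h : C -> C) (delta : C) (S : list C) (rho eta : R) (L : nat)
    (nxt : C -> C -> list C) (w z : C) (chi chi' : nat -> nat) (T : nat) :
  branching h delta S rho eta L nxt -> In w S -> In z S ->
  (forall t, (chi t < L)%nat) -> (forall t, (chi' t < L)%nat) ->
  (forall t, (t <= T)%nat -> snd (itinerary nxt w z chi t) = snd (itinerary nxt w z chi' t)) ->
  forall t, (t < T)%nat -> chi t = chi' t.
Proof.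
  intros Hb Hw Hz Hchi Hchi' H t Ht.
  assert (E1 : fst (itinerary nxt w z chi t) = fst (itinerary nxt w z chi' t)).
  { destruct t as [|t]; [reflexivity|]. simpl. apply H. lia. }
  pose proof (H t ltac:(lia)) as E2. pose proof (H (Datatypes.S t) ltac:(lia)) as E3. simpl in E3.
  rewrite E1, E2 in E3.
  destruct (itinerary_in h delta S rho eta L nxt w z chi' Hb Hw Hz Hchi' t) as [I1 I2].
  destruct (Hb _ _ I1 I2) as [H1 [H2 _]].
  apply (proj1 (NoDup_nth _ w) H2); auto; rewrite H1; auto.
Qed.

(** * Compact invariant sets of bounded orbits *)

Definition close2 (d : R) (p q : C * C) : Prop :=
  Cmod (fst q - fst p) < d /\ Cmod (snd q - snd p) < d.

Lemma henon_continuous (f : C -> C) (delta : C) (p : C * C) (e : R) :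
  ccont f (fst p) -> 0 < e -> exists d, 0 < d /\ forall q, close2 d p q ->
    close2 e (henon f delta p) (henon f delta q).
Proof.
  intros Hf He. pose proof (Cmod_ge_0 delta) as Pd.
  destruct (Hf (e / 2)) as [d [P Hd]]; [lra|].
  exists (Rmin d (Rmin e (e / (2 * (1 + Cmod delta))))). split.
  { repeat (apply Rmin_pos; auto). apply Rdiv_lt_0_compat; lra. }
  intros q [H1 H2]. unfold close2, henon; cbn [fst snd].
  assert (A1 := Rlt_le_trans _ _ _ H1 (Rmin_l _ _)).
  assert (A2 := Rlt_le_trans _ _ _ H1 (Rmin_r _ _)).
  assert (A3 := Rlt_le_trans _ _ _ A2 (Rmin_l _ _)).
  assert (B1 := Rlt_le_trans _ _ _ H2 (Rmin_r _ _)).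
  assert (B2 := Rlt_le_trans _ _ _ B1 (Rmin_r _ _)).
  split; auto.
  replace (f (fst q) - delta * snd q - (f (fst p) - delta * snd p))%C with
    ((f (fst q) - f (fst p)) - delta * (snd q - snd p))%C by ring.
  eapply Rle_lt_trans; [apply Cmod_triangle_minus|]. rewrite Cmod_mult. specialize (Hd _ A1).
  assert (Cmod delta * Cmod (snd q - snd p) <= e / 2); [|lra].
  apply Rle_trans with ((1 + Cmod delta) * (e / (2 * (1 + Cmod delta)))).
  - apply Rmult_le_compat; try lra. apply Cmod_ge_0.
  - right. field. lra.
Qed.

Lemma henon_iter_continuous (f : C -> C) (delta : C) (p : C * C) (t : nat) (e : R) :
  (forall z, ccont f z) -> 0 < e -> exists d, 0 < d /\ forall q, close2 d p q ->
    close2 e (Nat.iter t (henon f delta) p) (Nat.iter t (henon f delta) q).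
Proof.
  intros Hf. revert e. induction t as [|t IH]; intros e He.
  - exists e. auto.
  - destruct (henon_continuous f delta (Nat.iter t (henon f delta) p) e (Hf _) He) as [d [P Hd]].
    destruct (IH d P) as [d' [P' Hd']]. exists d'. split; auto. intros q Hq. simpl. auto.
Qed.

(** Heine-Borel in four real dimensions, with a gauge: at a point of [X] the ball lies in one member
    of the cover, at any other point it misses [X] and contributes an empty list. *)
Lemma bounded_closed_compact (X : C * C -> Prop) (r : R) :
  (forall p, X p -> Cmod (fst p) <= r /\ Cmod (snd p) <= r) ->
  (forall p, ~ X p -> exists d, 0 < d /\ forall q, close2 d p q -> ~ X q) -> compact_set X.
Proof.
  intros Hb Hc I U HU Hcov.
  set (pt := fun t : Compactness.Tn 4 R =>
    let '(a, (b, (c, (e, _)))) := t in (((a, b), (c, e)) : C * C)).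
  assert (K : forall t, exists d : posreal, exists o : list I, forall x, close_n 4 d x t ->
    X (pt x) -> exists i, In i o /\ U i (pt x)).
  { intros t. destruct (classic (X (pt t))) as [Ht|Ht].
    - destruct (Hcov _ Ht) as [i Hi]. destruct (HU i _ Hi) as [d Hd]. exists d, (i :: nil).
      intros x Hx _. exists i. split; [left; auto|]. apply Hd.
      destruct t as [a [b [c [e []]]]]. destruct x as [a' [b' [c' [e' []]]]].
      simpl in Hx. destruct Hx as [X1 [X2 [X3 [X4 _]]]].
      split; split; assumption.
    - destruct (Hc _ Ht) as [d [P Hd]]. assert (P2 : 0 < d / 2) by lra.
      exists (mkposreal _ P2), nil. intros x Hx HX. exfalso. revert HX. apply Hd.
      destruct t as [a [b [c [e []]]]]. destruct x as [a' [b' [c' [e' []]]]].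
      simpl in Hx. destruct Hx as [X1 [X2 [X3 [X4 _]]]].
      assert (G : forall a b a' b', Rabs (a' - a) < d / 2 -> Rabs (b' - b) < d / 2 ->
        Cmod ((a', b') - (a, b)) < d).
      { intros a0 b0 a1 b1 G1 G2.
        replace ((a1, b1) - (a0, b0))%C with (RtoC (a1 - a0) + Ci * RtoC (b1 - b0))%C.
        2:{ unfold Ci, RtoC, Cminus, Cplus, Copp, Cmult; cbn [fst snd]. f_equal; ring. }
        eapply Rle_lt_trans; [apply Cmod_triangle|]. rewrite Cmod_mult, Cmod_Ci, !Cmod_R. lra. }
      split; apply G; assumption. }
  destruct (choice _ K) as [d Hd]. destruct (choice _ Hd) as [o Ho].
  (* The finite list of the gauge theorem comes under a double negation. *)
  destruct (NNPP _ (compactness_list 4 (-r, (-r, (-r, (-r, tt)))) (r, (r, (r, (r, tt)))) d)) as [l Hl].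
  exists (flat_map o l). intros [[a b] [c e]] Hx.
  destruct (Hb _ Hx) as [B1 B2]. cbn [fst snd] in B1, B2.
  destruct (Hl (a, (b, (c, (e, tt))))) as [t [Ht [_ Hcl]]].
  - assert (G : forall a b, Cmod (a, b) <= r -> (- r <= a <= r) /\ (- r <= b <= r)).
    { intros a0 b0 G0. pose proof (Rmax_Cmod (a0, b0)) as G1. cbn [fst snd] in G1.
      pose proof (Rmax_l (Rabs a0) (Rabs b0)). pose proof (Rmax_r (Rabs a0) (Rabs b0)).
      split; apply Rabs_le_between; lra. }
    destruct (G _ _ B1). destruct (G _ _ B2). simpl. tauto.
  - destruct (Ho t _ Hcl Hx) as [i [Hi HUi]]. exists i. split; auto. apply in_flat_map. eauto.
Qed.

(** The orbits that never leave a bidisc form a closed, forward invariant set containing all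
    shadowing orbits at once; it serves as the compact [X] in the entropy. *)
Definition bounded_orbit (F : C * C -> C * C) (r : R) (p : C * C) : Prop :=
  forall t, Cmod (fst (Nat.iter t F p)) <= r /\ Cmod (snd (Nat.iter t F p)) <= r.

Lemma bounded_orbit_invariant (F : C * C -> C * C) (r : R) (p : C * C) :
  bounded_orbit F r p -> bounded_orbit F r (F p).
Proof. intros H t. rewrite Nat.iter_swap. apply (H (S t)). Qed.

Lemma bounded_orbit_compact (f : C -> C) (delta : C) (r : R) : (forall z, ccont f z) ->
  compact_set (bounded_orbit (henon f delta) r).
Proof.
  intros Hf. apply (bounded_closed_compact _ r); [intros p Hp; exact (Hp 0%nat)|].
  intros p Hp. apply not_all_ex_not in Hp. destruct Hp as [t Ht].
  set (a := Nat.iter t (henon f delta) p) in *.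
  assert (K : exists e, 0 < e /\ forall b, close2 e a b -> ~ (Cmod (fst b) <= r /\ Cmod (snd b) <= r)).
  { destruct (Rle_lt_dec (Cmod (fst a)) r) as [L1|L1].
    - destruct (Rle_lt_dec (Cmod (snd a)) r) as [L2|L2]; [tauto|].
      exists (Cmod (snd a) - r). split; [lra|]. intros b [_ Hb] [_ H].
      pose proof (Cmod_le_plus_dist (snd a) (snd b)). rewrite (Cmod_minus_sym (snd a)) in H0. lra.
    - exists (Cmod (fst a) - r). split; [lra|]. intros b [Hb _] [H _].
      pose proof (Cmod_le_plus_dist (fst a) (fst b)). rewrite (Cmod_minus_sym (fst a)) in H0. lra. }
  destruct K as [e [He K]].
  destruct (henon_iter_continuous f delta p t e Hf He) as [d [Pd Hd]].
  exists d. split; auto. intros q Hq HX. apply (K _ (Hd q Hq)). apply HX.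
Qed.

Lemma dist2_ge_fst (p q : C * C) : Cmod (fst p - fst q) <= dist2 p q.
Proof.
  unfold dist2. rewrite <- (sqrt_pow2 (Cmod (fst p - fst q))) at 1 by apply Cmod_ge_0.
  apply sqrt_le_1_alt. pose proof (pow2_ge_0 (Cmod (snd p - snd q))). lra.
Qed.

(** One step is lost since words of length [T] are told apart within time [T + 1]. *)
Lemma entropy_from_separated (X : C * C -> Prop) (F : C * C -> C * C) (eps : R) (L : nat) :
  (1 <= L)%nat -> 0 < eps ->
  (forall T, exists E, separated_set X F (S T) eps E /\ length E = (L ^ T)%nat) ->
  Rbar_le (ln (INR L) / 2) (htop_compact X F).
Proof.
  intros HL He H.
  assert (HL1 : 1 <= INR L) by (apply (le_INR 1); auto).
  assert (Hln : 0 <= ln (INR L)) by (rewrite <- ln_1; apply Rcomplements.ln_le; lra).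
  assert (Term : forall T, (1 <= T)%nat -> Rbar_le (ln (INR L) / 2) (entropy_term X F eps (S T))).
  { intros T HT. destruct (H T) as [E [HE1 HE2]]. unfold entropy_term.
    assert (HK : Rbar_le (INR L ^ T) (Ksep X F (S T) eps)).
    { unfold Ksep. destruct (Lub_Rbar_correct (fun r => exists E, separated_set X F (S T) eps E /\ r = INR (length E))) as [A _].
      apply A. exists E. split; auto. rewrite HE2, pow_INR. auto. }
    assert (PL : 0 < INR L ^ T) by (apply pow_lt; lra).
    destruct (Ksep X F (S T) eps) as [k| |]; simpl in HK |- *; auto.
    destruct (Rle_dec k 0) as [L0|_]; [lra|].
    assert (Hk : INR T * ln (INR L) <= ln k).
    { rewrite <- (Rcomplements.ln_pow) by lra. apply Rcomplements.ln_le; lra. }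
    simpl. pose proof (pos_INR T). assert (1 <= INR T) by (apply (le_INR 1); auto).
    change (match T with O => 1 | S _ => INR T + 1 end) with (INR (S T)). rewrite S_INR.
    (* For [T >= 1] the ratio [T / (T + 1)] is at least [1 / 2], the origin of the division by 2. *)
    apply Rmult_le_reg_r with (INR T + 1); [lra|].
    unfold Rdiv at 2. rewrite (Rmult_assoc (ln k)), Rinv_l, Rmult_1_r by lra. nra. }
  unfold htop_compact.
  destruct (Lub_Rbar_correct (fun x => exists eps, 0 < eps /\
    Rbar_le x (Rbar_limsup (entropy_term X F eps)))) as [A _].
  apply A. exists eps. split; auto. unfold Rbar_limsup.
  match goal with |- Rbar_le _ (Glb_Rbar ?E) => destruct (Glb_Rbar_correct E) as [_ G] end.
  apply G. intros y [N HN]. eapply Rbar_le_trans; [|exact HN].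
  match goal with |- Rbar_le _ (Lub_Rbar ?E) => destruct (Lub_Rbar_correct E) as [B _] end.
  apply B. exists (S (S N)). split; [lia|]. apply Term. lia.
Qed.

(** Multiplication by [n] carries solutions of the recurrence for [h] to orbits of the Hénon map.
    Words of length [T] over [L] letters are coded by the base-[L] digits of the numbers below
    [L ^ T]. *)
Lemma henon_entropy_ge (f h : C -> C) (delta : C) (n : nat) (S : list C) (d rho eta : R) (L : nat)
    (nxt : C -> C -> list C) :
  (forall z, ccont f z) -> (forall z, ccont h z) -> (1 <= n)%nat ->
  (forall z, h z = (f (RtoC (INR n) * z) / RtoC (INR n))%C) ->
  (1 <= L)%nat -> S <> nil -> 0 < d ->
  (forall x y, In x S -> In y S -> x <> y -> d <= Cmod (x - y)) ->
  0 < rho <= d / 4 -> 0 < eta -> (1 + Cmod delta) * rho <= eta / 2 ->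
  branching h delta S rho eta L nxt ->
  Rbar_le (ln (INR L) / 2) (htop_C2 (henon f delta)).
Proof.
  intros Hf Hh Hn Ehf HL HS Hd Hsep Hrho Heta Hsmall Hb.
  destruct S as [|w0 S']; [congruence|]. set (S := w0 :: S') in *.
  assert (Hw0 : In w0 S) by (left; auto).
  assert (Pn : 1 <= INR n) by (apply (le_INR 1); auto).
  assert (Nn : RtoC (INR n) <> 0) by (intros E; injection E; lra).
  destruct (list_Cmod_bound S) as [M [HM HMS]].
  set (r := INR n * (M + rho)). set (F := henon f delta).
  set (chi := fun j t => ((j / L ^ t) mod L)%nat).
  assert (Hchi : forall j t, (chi j t < L)%nat) by (intros; apply Nat.mod_upper_bound; lia).
  (* Taking the first component delays time by one, so the sequence starts with [w0] twice and the
     next position after times [t], [t + 1] is the choice of digit [t]. *)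
  set (sg := fun j t => fst (itinerary nxt w0 w0 (chi j) t)).
  assert (Hsg : forall j t, sg j (Datatypes.S t) = snd (itinerary nxt w0 w0 (chi j) t)) by reflexivity.
  assert (Insg : forall j t, In (sg j t) S).
  { intros j t. apply (itinerary_in h delta S rho eta L nxt w0 w0 (chi j) Hb Hw0 Hw0 (Hchi j)). }
  assert (Sh : forall j, exists zeta : nat -> C, (forall t, Cmod (zeta t - sg j t) <= rho) /\
    forall t, zeta (Datatypes.S (Datatypes.S t)) = (h (zeta (Datatypes.S t)) - delta * zeta t)%C).
  { intros j. apply (shadowing h delta rho eta (sg j)); auto; [lra|].
    intros t. destruct (Hb (sg j t) (sg j (Datatypes.S t)) (Insg j t) (Insg j _)) as [H1 [_ [_ H4]]].
    apply H4. change (sg j (Datatypes.S (Datatypes.S t))) with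
      (nth (chi j t) (nxt (sg j t) (sg j (Datatypes.S t))) w0). apply nth_In. rewrite H1. auto. }
  destruct (choice _ Sh) as [ze Hze].
  set (P := fun j => (RtoC (INR n) * ze j 1%nat, RtoC (INR n) * ze j 0%nat)%C).
  assert (Orb : forall j t, Nat.iter t F (P j) =
    ((RtoC (INR n) * ze j (Datatypes.S t))%C, (RtoC (INR n) * ze j t)%C)).
  { intros j. induction t as [|t IH]; [reflexivity|]. simpl Nat.iter. rewrite IH.
    unfold F, henon; cbn [fst snd]. f_equal. destruct (Hze j) as [_ E]. rewrite E, Ehf. field. auto. }
  assert (Mn : forall x : C, Cmod (RtoC (INR n) * x) = INR n * Cmod x).
  { intros x. rewrite Cmod_mult, Cmod_R, Rabs_right by lra. auto. }
  assert (Bd : forall j t, Cmod (RtoC (INR n) * ze j t) <= r).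
  { intros j t. rewrite Mn. unfold r. apply Rmult_le_compat_l; [lra|].
    pose proof (Cmod_le_plus_dist (ze j t) (sg j t)). pose proof (HMS _ (Insg j t)).
    destruct (Hze j) as [A _]. specialize (A t). lra. }
  assert (PX : forall j, bounded_orbit F r (P j)).
  { intros j t. rewrite Orb. simpl. auto. }
  (* Distinct positions are [d] apart and the orbits follow them within [rho <= d / 4], so they
     differ by at least [d / 2]; the factor [n >= 1] does not shrink this. *)
  set (eps := d / 4).
  assert (Sep : forall T j j', (j < L ^ T)%nat -> (j' < L ^ T)%nat -> j <> j' ->
    exists k, (k < Datatypes.S T)%nat /\ dist2 (Nat.iter k F (P j)) (Nat.iter k F (P j')) > eps).
  { intros T j j' Hj Hj' Nj. apply NNPP. intros Hno. apply Nj. apply (digits_inj L T); auto.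
    apply (itinerary_inj h delta S rho eta L nxt w0 w0 (chi j) (chi j') T Hb Hw0 Hw0 (Hchi j) (Hchi j')).
    intros t Ht. apply NNPP. intros Nt. apply Hno. exists t. split; [lia|].
    rewrite <- !Hsg in Nt. specialize (Hsep _ _ (Insg j _) (Insg j' _) Nt).
    eapply Rge_gt_trans; [apply Rle_ge, dist2_ge_fst|]. rewrite !Orb. cbn [fst].
    replace (RtoC (INR n) * ze j (Datatypes.S t) - RtoC (INR n) * ze j' (Datatypes.S t))%C with
      (RtoC (INR n) * (ze j (Datatypes.S t) - ze j' (Datatypes.S t)))%C by ring. rewrite Mn.
    destruct (Hze j) as [A _]. destruct (Hze j') as [A' _].
    specialize (A (Datatypes.S t)). specialize (A' (Datatypes.S t)).
    pose proof (Cmod_triangle_via (ze j (Datatypes.S t)) (sg j (Datatypes.S t)) (sg j' (Datatypes.S t))) as T1.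
    pose proof (Cmod_triangle_via (ze j' (Datatypes.S t)) (ze j (Datatypes.S t)) (sg j' (Datatypes.S t))) as T2.
    rewrite (Cmod_minus_sym (sg j _) (ze j _)) in T1.
    unfold eps. pose proof (Cmod_ge_0 (ze j (Datatypes.S t) - ze j' (Datatypes.S t))). nra. }
  assert (Hmain : Rbar_le (ln (INR L) / 2) (htop_compact (bounded_orbit F r) F)).
  { apply (entropy_from_separated _ _ eps); auto; [unfold eps; lra|].
    intros T. exists (map P (seq 0 (L ^ T))). split; [|rewrite length_map, length_seq; auto].
    assert (Hin : forall p, In p (map P (seq 0 (L ^ T))) -> exists j, (j < L ^ T)%nat /\ p = P j).
    { intros p Hp. apply in_map_iff in Hp. destruct Hp as [j [<- Hj]]. apply in_seq in Hj.
      exists j. split; auto. lia. }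
    split; [|split].
    - assert (G : forall l, NoDup l -> (forall j, In j l -> (j < L ^ T)%nat) -> NoDup (map P l)).
      { induction l as [|j l IH]; intros Hnd Hl; simpl; constructor.
        - intros Hp. apply in_map_iff in Hp. destruct Hp as [j' [Ej Hj']]. inversion Hnd as [|? ? N1 N2]; subst.
          assert (Nj : j' <> j) by (intros ->; auto).
          destruct (Sep T j' j (Hl j' (or_intror Hj')) (Hl j (or_introl eq_refl)) Nj) as [k [_ Hk]].
          rewrite Ej in Hk. unfold dist2 in Hk. rewrite !Cmod_self_minus in Hk.
          replace (0 ^ 2 + 0 ^ 2) with 0 in Hk by ring. rewrite sqrt_0 in Hk. unfold eps in Hk. lra.
        - inversion Hnd; subst. apply IH; auto. intros j' Hj'. apply Hl. right. auto. }
      apply G; [apply seq_NoDup|]. intros j Hj. apply in_seq in Hj. lia.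
    - intros p Hp. destruct (Hin p Hp) as [j [_ ->]]. auto.
    - intros p q Hp Hq Npq. destruct (Hin p Hp) as [j [Hj ->]]. destruct (Hin q Hq) as [j' [Hj' ->]].
      apply Sep; auto. }
  unfold htop_C2.
  match goal with |- Rbar_le _ (Lub_Rbar ?E) => destruct (Lub_Rbar_correct E) as [B _] end.
  apply B. right. exists (bounded_orbit F r). split; [apply bounded_orbit_compact; auto|].
  split; [apply bounded_orbit_invariant|exact Hmain].
Qed.

Lemma rescaled_holo (f h : C -> C) : (forall z, exists d, cdiff f z d) -> rescaled_family f h -> holo h.
Proof.
  intros Hf [n [_ ->]] z. set (c := RtoC (INR n)). destruct (Hf (c * z)%C) as [d Hd].
  eexists. apply (cdiff_mult (fun z => f (c * z)%C) (fun _ => / c)%C); [|apply cdiff_const].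
  apply (cdiff_comp f (fun z => c * z)%C); [|exact Hd].
  apply cdiff_mult; [apply cdiff_const|apply cdiff_id].
Qed.

Theorem mainTheorem10 (f : C -> C) (delta : C) :
  transcendental_entire f -> delta <> RtoC 0 ->
  ~ quasi_normal (fun _ => True) (rescaled_family f) ->
  htop_C2 (henon f delta) = p_infty.
Proof.
  intros [Hent _] _ Hq.
  assert (Hf : forall z, exists d, cdiff f z d) by (intros z; apply ex_derive_cdiff, Hent).
  assert (Cf : forall z, ccont f z) by (intros z; destruct (Hf z) as [d Hd]; eapply cdiff_ccont; eauto).
  assert (K : forall L, (1 <= L)%nat -> Rbar_le (ln (INR L) / 2) (htop_C2 (henon f delta))).
  { intros L HL.
    destruct (exists_branching (rescaled_family f) delta L (fun h => rescaled_holo f h Hf) Hq)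
      as [h [S [d [rho [eta [nxt [Hh [HS [Hd [Hsep [Hrho [Heta [Hsm Hb]]]]]]]]]]]]].
    pose proof (rescaled_holo f h Hf Hh) as Hhol. destruct Hh as [n [Hn Eh]].
    apply (henon_entropy_ge f h delta n S d rho eta L nxt); auto.
    - intros z. destruct (Hhol z) as [e He]. eapply cdiff_ccont; eauto.
    - intros z. rewrite Eh. auto. }
  destruct (htop_C2 (henon f delta)) as [x| |]; auto.
  - exfalso. destruct (INR_unbounded (exp (2 * x + 2))) as [L HL].
    assert (0 < INR L) by (pose proof (exp_pos (2 * x + 2)); lra).
    specialize (K L (INR_lt 0 L H)). simpl in K.
    assert (2 * x + 2 < ln (INR L)); [|lra].
    rewrite <- (ln_exp (2 * x + 2)). apply ln_increasing; [apply exp_pos|auto].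
  - exfalso. exact (K 1%nat (le_n 1)).
Qed.
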